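(* Let $\Delta\in\mathbb C^{n\times n}$ be Hermitian and invertible, let $C,D\in\mathbb C^{n\times n}$ be $\Delta$-Hermitian, let $\lambda\in\mathbb C$ be nonreal, and suppose there is an invertible $U=[\,V\;\;V_c\;\;U_C\,]$ with $$CU=U\,\mathrm{diag}\big(\lambda I_p+N,\ (\lambda I_p+N)^*,\ C_C\big),\qquad U^*\Delta U=\mathrm{diag}\left(\begin{bmatrix}0 & I_p \\ I_p & 0\end{bmatrix},\Delta_C\right),\qquad \lambda,\bar\lambda\notin\Lambda(C_C).$$ With the notation of the context, assume $W_k=(E_k^{(c)})^*\Delta DE_k$ is invertible for all $k=1,\dots,m$, and fix $\rho\in\{1,\dots,m\}$. Suppose $F,F^{(c)}\in\mathbb C^{\rho s_\rho\times\ell}$ are full column rank matrices and $\Omega\in\mathbb C^{\ell\times\ell}$ with $$\Theta_\rho(S_\rho)F=F\Omega,\quad \Theta_\rho(S_\rho)^*F^{(c)}=F^{(c)}\Omega^*,\quad F^*F^{(c)}=I_\ell,$$ $$\Lambda(\Omega)\subseteq\Lambda(\Theta_\rho(S_\rho)),\qquad \Lambda(\Omega)\cap\big(\Lambda(\Theta_\rho(S_\rho))\setminus\Lambda(\Omega)\big)=\emptyset .$$ Let $Q,Q^{(c)}\in\mathbb C^{s_\rho\times\ell}$ be the matrices (which exist by the block structure of $\Theta_\rho(S_\rho)$) with $F=[Q^T\ (Q\Omega)^T\ \dots\ (Q\Omega^{\rho-1})^T]^T$, $F^{(c)}=[\Omega^{\rho-1}(Q^{(c)})^*\ \dots\ \Omega(Q^{(c)})^*\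 (Q^{(c)})^*]^*$, $S_\rho Q=Q\Omega^\rho$, $S_\rho^*Q^{(c)}=Q^{(c)}(\Omega^* )^\rho$. Then for $t>0$ sufficiently small there is a perturbed structured basis $(\widetilde V_\rho(t),\widetilde V_\rho^{(c)}(t),\widetilde\Theta_\rho(t))$ (defined in the context), and there exist matrices $\widetilde F(t)=F+O(t^{1/\rho})$, $\widetilde F^{(c)}(t)=F^{(c)}+O(t^{1/\rho})$, $\widetilde\Omega(t)=\Omega+O(t^{1/\rho})$ satisfying $$\widetilde\Theta_\rho(t)\widetilde F(t)=\widetilde F(t)\widetilde\Omega(t),\quad \widetilde\Theta_\rho^*(t)\widetilde F^{(c)}(t)=\widetilde F^{(c)}(t)\widetilde\Omega^*(t),\quad \widetilde F^*(t)\widetilde F^{(c)}(t)=I_\ell,$$ such that $\widetilde U_\Omega(t)=[\,L_\rho(t)\;\;L_\rho^{(c)}(t)\,]$ with $L_\rho(t)=\widetilde V_\rho(t)\widetilde F(t)$, $L_\rho^{(c)}(t)=\widetilde V_\rho^{(c)}(t)\widetilde F^{(c)}(t)$ satisfies $$(C+tD)\widetilde U_\Omega(t)=\widetilde U_\Omega(t)\begin{bmatrix}\lambda I_\ell+t^{1/\rho}\widetilde\Omega(t) & 0 \\ 0 & (\lambda I_\ell+t^{1/\rho}\widetilde\Omega(t))^*\end{bmatrix},\qquad \widetilde U_\Omega^*(t)\Delta\widetilde U_\Omega(t)=t^{1-1/\rho}\begin{bmatrix}0 & I_\ell \\ I_\ell & 0\end{bmatrix},$$ and $$L_\rho(t)=E_\rho\begin{bmatrix}I_{s_\rho}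 \\ G_\rho\end{bmatrix}Q+\sum_{k=1}^mV_kL_{k\rho}(t)+O(t),\qquad L_\rho^{(c)}(t)=E_\rho^{(c)}\begin{bmatrix}I_{s_\rho} \\ G_\rho^{(c)}\end{bmatrix}Q^{(c)}+\sum_{k=1}^mV_k^{(c)}L_{k\rho}^{(c)}(t)+O(t),$$ where $L_{k\rho}(t)=O(\delta_k(t))$ and $L_{k\rho}^{(c)}(t)=O(\delta_k^{c}(t))$ for $k\ne\rho$, and $$L_{\rho\rho}(t)=\big[\,0\ \ (Q(t^{1/\rho}\Omega))^T\ \dots\ (Q(t^{1/\rho}\Omega)^{\rho-1})^T\big]^T+O(\delta_\rho(t)),$$ $$L_{\rho\rho}^{(c)}(t)=\big[(t^{1/\rho}\Omega)^{\rho-1}(Q^{(c)})^*\ \dots\ (t^{1/\rho}\Omega)(Q^{(c)})^*\ \ 0\,\big]^*+O(\delta_\rho^{c}(t)).$$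
   Context: A matrix $C$ is $\Delta$-Hermitian (for Hermitian invertible $\Delta$) if $\Delta C=(\Delta C)^*$. $\Lambda(\cdot)$ is the spectrum; in the conditions relating $\Lambda(\Omega)$ and $\Lambda(\Theta_\rho(S_\rho))$ spectra are multisets (eigenvalues counted with algebraic multiplicity), so the condition says that no eigenvalue of $\Omega$ is among the remaining eigenvalues of $\Theta_\rho(S_\rho)$. $^*$ is conjugate transpose; $A^{-*}=(A^{-1})^*$. Jordan structure: integers $m\ge1$, $s_1,\dots,s_{m-1}\ge0$, $s_m>0$, $p=\sum_{j=1}^m js_j$, $N=\mathrm{diag}(N_1,\dots,N_m)$, where $N_j$ is the $j\times j$ block matrix with blocks of size $s_j\times s_j$, having $I_{s_j}$ on the first block superdiagonal and zeros elsewhere ($N_1=0_{s_1}$). Partitions: $V=[V_1\ \dots\ V_m]$, $V_c=[V_1^{(c)}\ \dots\ V_m^{(c)}]$ with $V_j,V_j^{(c)}$ having $js_j$ columns, and $V_j=[V_{j1}\ \dots\ V_{jj}]$, $V_j^{(c)}=[V_{j1}^{(c)}\ \dots\ V_{jj}^{(c)}]$ with each block having $s_j$ columns. $E_k=[V_{k1}\ V_{k+1,1}\ \dots\ V_{m1}]$, $E_k^{(c)}=[V_{kk}^{(c)}\ V_{k+1,k+1}^{(c)}\ \dots\ V_{mm}^{(c)}]$, $k=1,\dots,m$. For $\rho<m$: $G_\rho=-W_{\rho+1}^{-1}(E_{\rho+1}^{(c)})^*\Delta DV_{\rho1}$, $G_\rho^{(c)}=-W_{\rho+1}^{-*}E_{\rho+1}^*\Delta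 DV_{\rho\rho}^{(c)}$, $S_\rho=(V_{\rho\rho}^{(c)})^*\Delta D(V_{\rho1}+E_{\rho+1}G_\rho)$. For $\rho=m$: $G_\rho,G_\rho^{(c)}$ are absent (empty) and $S_m=(V_{mm}^{(c)})^*\Delta DV_{m1}$. $\Theta_\rho(S)$ is the $\rho\times\rho$ block matrix with $s_\rho\times s_\rho$ blocks, with $I_{s_\rho}$ on the first block superdiagonal, $S$ in the bottom-left block, zeros elsewhere ($\Theta_1(S)=S$). Order notation: $t>0$ is real and sufficiently small; $O(t^d)$ is a matrix with norm at most a constant (independent of $t$) times $t^d$ for all sufficiently small $t>0$. For a matrix with $k$ block rows, $O([t^{d_1}\ \dots\ t^{d_k}]^T)$ means the $i$th block row is $O(t^{d_i})$. For fixed $\rho$, $\delta_k(t)$ is the following vector of length $k$ (applied to matrices with $k$ block rows of height $s_k$): for $k<\rho$, $[t^{1-k/\rho}\ t^{1-(k-1)/\rho}\ \dots\ t^{1-1/\rho}]^T$; for $k=\rho$, $[t^{1/\rho}\ t^{2/\rho}\ \dots\ t]^T$; for $k>\rho$, $[t^{1/\rho}\ t^{1/\rho}\ t^{2/\rho}\ \dots\ t\ \dots\ t]^T$, i.e. first entry $t^{1/\rho}$ and $i$th entry $t^{\min(i-1,\rho)/\rho}$ for $i\ge2$. $\delta_k^{c}(t)$ is $\delta_k(t)$ with entries in reverse order. Perturbed structured basis: a family (for all sufficiently small $t>0$) of matrices $\widetilde V_\rho(t),\widetilde V_\rho^{(c)}(t)\in\mathbb C^{n\times\rho s_\rho}$,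 $\widetilde\Theta_\rho(t)=\Theta_\rho(S_\rho)+O(t^{1/\rho})$ with $$\widetilde V_\rho(t)=E_\rho\begin{bmatrix}I_{s_\rho} & 0 \\ G_\rho & 0\end{bmatrix}+\sum_{k=1}^mV_k\widetilde X_{k\rho}(t)+O(t),\quad \widetilde V_\rho^{(c)}(t)=E_\rho^{(c)}\begin{bmatrix}0 & I_{s_\rho} \\ 0 & G_\rho^{(c)}\end{bmatrix}+\sum_{k=1}^mV_k^{(c)}\widetilde X_{k\rho}^{(c)}(t)+O(t),$$ where $\widetilde X_{k\rho}=O(\delta_k)$, $\widetilde X_{k\rho}^{(c)}=O(\delta_k^{c})$ for $k\ne\rho$, $\widetilde X_{\rho\rho}=\mathrm{diag}(0_{s_\rho},t^{1/\rho}I_{s_\rho},\dots,t^{1-1/\rho}I_{s_\rho})$, $\widetilde X_{\rho\rho}^{(c)}=\mathrm{diag}(t^{1-1/\rho}I_{s_\rho},\dots,t^{1/\rho}I_{s_\rho},0_{s_\rho})+O(\delta_\rho^{c})$, such that $\widetilde U_\rho=[\widetilde V_\rho\ \widetilde V_\rho^{(c)}]$ satisfies $(C+tD)\widetilde U_\rho=\widetilde U_\rho\,\mathrm{diag}\big(\lambda I+t^{1/\rho}\widetilde\Theta_\rho,(\lambda I+t^{1/\rho}\widetilde\Theta_\rho)^*\big)$ and $\widetilde U_\rho^*\Delta\widetilde U_\rho=t^{1-1/\rho}\begin{bmatrix}0 & I_{\rho s_\rho} \\ I_{\rho s_\rho} & 0\end{bmatrix}$. *)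

(* Defs.v *)
From HB Require Import structures.
From mathcomp Require Import all_boot all_order all_algebra.
From mathcomp Require Import finmap multiset complex.
From mathcomp Require Import all_classical all_reals all_analysis.
Set Implicit Arguments.
Unset Strict Implicit.
Unset Printing Implicit Defensive.
Import Order.TTheory GRing.Theory Num.Theory.
Import numFieldNormedType.Exports.
Local Open Scope ring_scope.
Local Open Scope complex_scope.
Local Open Scope sesquilinear_scope.
Local Open Scope classical_set_scope.

(* All integer indices below (j, k, rho and block positions passed to V, Vc,
   s) are 1-based naturals, while bigop and block-matrix ordinals are 0-based,
   hence the successors.  A ^t* is the conjugate transpose; it binds less
   tightly than application. *)

Section Spectrum.
Variable K : closedFieldType.

(* Eigenvalues counted with algebraic multiplicity. *)
Definition spectrum r (A : 'M[K]_r) : {mset K}%mset :=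
  seq_mset (sval (closed_field_poly_normal (char_poly A))).

(* Invertibility of a matrix whose two dimensions are equal only up to a
   propositional equality; it forces n = r. *)
Definition invertible_mx n r (U : 'M[K]_(n, r)) :=
  exists U' : 'M[K]_(r, n), U *m U' = 1%:M /\ U' *m U = 1%:M.

End Spectrum.

Section Asymptotics.
Variable R : realType.

(* A(t) = O(g(t)) as t -> 0 with t > 0; mx_norm is the max-entry norm, which
   makes sense for empty matrices. *)
Definition isO (g : R -> R) a b (A : R -> 'M[R[i]]_(a, b)) :=
  exists c : R, \forall t \near 0^'+, mx_norm (A t) <= (c * g t)%:C.

Definition isO_rows (g : R -> nat -> R) k w b
    (X : R -> 'M[R[i]]_(\sum_(i < k) w, b)) :=
  forall i : 'I_k, isO (fun t => g t i.+1) (fun t => submxcol (X t) i).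

(* delta rho k t i is the i-th entry, 1 <= i <= k, of delta_k(t). *)
Definition delta (rho k : nat) (t : R) (i : nat) : R :=
  if (k < rho)%N then t `^ (1 - (k.+1 - i)%:R / rho%:R)
  else if k == rho then t `^ (i%:R / rho%:R)
  else if (i <= 1)%N then t `^ (1 / rho%:R)
  else t `^ ((minn i.-1 rho)%:R / rho%:R).

Definition deltac (rho k : nat) (t : R) (i : nat) : R :=
  delta rho k t (k.+1 - i).

Definition rho_root (rho : nat) (t : R) : R[i] := (t `^ (1 / rho%:R))%:C.

End Asymptotics.

Section Blocks.
Variable K : pzRingType.

(* Theta r S; for r = 1 this is S. *)
Definition Theta r d (S : 'M[K]_d) : 'M[K]_(\sum_(i < r) d) :=
  \mxblock_(i < r, j < r)
    (if j == i.+1 :> nat then 1%:M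
     else if (i.+1 == r) && (j == 0%N :> nat) then S else 0 : 'M[K]_(d, d)).

(* The block row [0 .. 0 A 0 .. 0] with r blocks and A in position j0. *)
Definition row_at r d a (j0 : nat) (A : 'M[K]_(a, d)) :
    'M[K]_(a, \sum_(j < r) d) :=
  \mxrow_(j < r) (if j.+1 == j0 then A else 0 : 'M[K]_(a, d)).

Definition scalar_blocks r d (c : nat -> K) : 'M[K]_(\sum_(i < r) d) :=
  \mxdiag_(i < r) ((c i.+1)%:M : 'M[K]_d).

Definition Nblock (s : nat -> nat) k : 'M[K]_(\sum_(i < k) s k) :=
  \mxblock_(i < k, j < k)
    (if j == i.+1 :> nat then 1%:M else 0 : 'M[K]_(s k, s k)).

Definition Njordan (s : nat -> nat) m :
    'M[K]_(\sum_(j < m) \sum_(i < j.+1) s j.+1) :=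
  \mxdiag_(j < m) Nblock s j.+1.

Definition swap_mx p : 'M[K]_(p + p) := block_mx 0 1%:M 1%:M 0.

End Blocks.

Section Structure.
Variables (R : realType) (m n : nat) (s : nat -> nat).
Local Notation K := R[i].
(* A partitioned matrix V is given by its blocks: V j i is V_{ji}, of width
   s_j, for 1 <= i <= j <= m.  Values outside this range (and s_j outside
   1 <= j <= m) are never used. *)
Variables V Vc : forall j i : nat, 'M[K]_(n, s j).
Variables (Delta C D : 'M[K]_n).

Definition blockrow (B : forall j i : nat, 'M[K]_(n, s j)) k :
    'M[K]_(n, \sum_(i < k) s k) := \mxrow_(i < k) B k i.+1.

Definition fullrow (B : forall j i : nat, 'M[K]_(n, s j)) :
    'M[K]_(n, \sum_(j < m) \sum_(i < j.+1) s j.+1) :=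
  \mxrow_(j < m) blockrow B j.+1.

(* For k = m + 1 these have no columns. *)
Definition E k : 'M[K]_(n, \sum_(i < m.+1 - k) s (k + i)%N) :=
  \mxrow_(i < m.+1 - k) V (k + i)%N 1%N.

Definition Ec k : 'M[K]_(n, \sum_(i < m.+1 - k) s (k + i)%N) :=
  \mxrow_(i < m.+1 - k) Vc (k + i)%N (k + i)%N.

Definition W k := (Ec k)^t* *m Delta *m D *m E k.

(* For rho = m the matrices G and Gc have no rows, and the corresponding term
   of Srho vanishes. *)
Definition G rho := - invmx (W rho.+1) *m (Ec rho.+1)^t* *m Delta *m D *m V rho 1%N.

Definition Gc rho :=
  - (invmx (W rho.+1))^t* *m (E rho.+1)^t* *m Delta *m D *m Vc rho rho.

Definition Srho rho : 'M[K]_(s rho) :=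
  (Vc rho rho)^t* *m Delta *m D *m (V rho 1%N + E rho.+1 *m G rho).

(* E_rho = [V_{rho 1}, E_{rho+1}] and its companion, with the first block split
   off so that they multiply [I; G_rho] and [I; G_rho^(c)]. *)
Definition Esplit rho := row_mx (V rho 1%N) (E rho.+1).
Definition Ecsplit rho := row_mx (Vc rho rho) (Ec rho.+1).

Variable lambda : K.

(* (C + tD) [L Lc] = [L Lc] diag(B, B^* ), with B = lambda I + t^(1/rho) Om, and
   [L Lc]^* Delta [L Lc] = t^(1 - 1/rho) [0 I; I 0]. *)
Definition structured_pair rho l (t : R) (L Lc : 'M[K]_(n, l)) (Om : 'M[K]_l) :=
  let U := row_mx L Lc in
  let B := lambda%:M + rho_root rho t *: Om in
  (C + t%:C *: D) *m U = U *m block_mx B 0 0 (B^t*) /\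
  U^t* *m Delta *m U = (t `^ (1 - 1 / rho%:R))%:C *: swap_mx K l.

Definition perturbed_structured_basis rho
    (tV tVc : R -> 'M[K]_(n, \sum_(j < rho) s rho))
    (tTheta : R -> 'M[K]_(\sum_(j < rho) s rho)) : Prop :=
  [/\ isO (fun t => t `^ (1 / rho%:R))
        (fun t => tTheta t - Theta rho (Srho rho)),
      exists X : forall k : nat,
          R -> 'M[K]_(\sum_(i < k) s k, \sum_(j < rho) s rho),
        [/\ isO id (fun t => tV t
              - (Esplit rho *m row_at rho 1 (col_mx 1%:M (G rho))
                 + \sum_(1 <= k < m.+1) blockrow V k *m X k t)),
            forall k, (1 <= k <= m)%N -> k != rho ->
              isO_rows (delta rho k) (X k)
          & \forall t \near (0 : R)^'+, X rho t =
              scalar_blocks rho (s rho) (fun i =>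
                if i == 1%N then 0 else (t `^ (i.-1%:R / rho%:R))%:C)],
      exists Xc : forall k : nat,
          R -> 'M[K]_(\sum_(i < k) s k, \sum_(j < rho) s rho),
        [/\ isO id (fun t => tVc t
              - (Ecsplit rho *m row_at rho rho (col_mx 1%:M (Gc rho))
                 + \sum_(1 <= k < m.+1) blockrow Vc k *m Xc k t)),
            forall k, (1 <= k <= m)%N -> k != rho ->
              isO_rows (deltac rho k) (Xc k)
          & isO_rows (deltac rho rho) (fun t => Xc rho t
              - scalar_blocks rho (s rho) (fun i =>
                  if i == rho then 0
                  else (t `^ ((rho - i)%:R / rho%:R))%:C))]
    & \forall t \near (0 : R)^'+, structured_pair rho t (tV t) (tVc t) (tTheta t)].

End Structure.

(* Main.v *)
Require Import Defs.
From HB Require Import structures.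
From mathcomp Require Import all_boot all_order all_algebra.
From mathcomp Require Import finmap multiset complex.
From mathcomp Require Import all_classical all_reals all_analysis.
From mathcomp Require Import ring lra zify.
(* With z = t^(1/rho), scaling the Jordan coordinates of C + tD - lambda by suitable
   powers of z turns (C + tD) X = X (lambda + z Theta) into a pencil equation
   P(z) x = Q(z) x Theta with coefficients polynomial in z.  At z = 0 it is solved by
   Theta = Theta_rho(S_rho), with G_rho appearing in the leading coordinates; once the
   coordinates of x along V_rho are fixed, its linearization is injective because
   W_(rho+1) and S_rho (a Schur complement in W_rho) are invertible.  A contraction
   argument then gives a solution x(z) within O(z) of the limit.

   The same argument for conj(lambda), with the order of the blocks reversed, gives the
   companion family.  The two families have Gram matrix z^(rho-1) (1 + O(z)); dividing the
   second by 1 + O(z) normalizes it, and since C + tD is Delta-Hermitian this also forces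
   its eigenvalue block to be the conjugate of the first one.  Both families are isotropic
   since lambda is not real.  The simple invariant subspace (F, Fc) of Theta_rho(S_rho) is
   continued by the pencil argument with Q = 1. *)

Set Implicit Arguments.
Unset Strict Implicit.
Unset Printing Implicit Defensive.
Import Order.TTheory GRing.Theory Num.Theory.
Import numFieldNormedType.Exports.
Import ComplexField.Normc.
Local Open Scope ring_scope.
Local Open Scope complex_scope.
Local Open Scope sesquilinear_scope.
Local Open Scope classical_set_scope.

(** * Matrix norms *)

(** Row (k,i) of C - lambda reads coordinate i + 1 of chain k, while D carries the factor t = z^rho.
    If coordinate (k,i) has a weight z^alpha that gains one power per step along the chain and is
    capped at rho, both terms acquire a common left factor. At z = 0, D then acts only on the first
    vectors of the chains k >= rho, which is where W_(rho+1), G_rho and S_rho come from. The cap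
    makes Q(0) singular on long chains and on the complement of the chains, so the limit is a
    genuine pencil and not the eigenvalue problem of a matrix.

    Normalizing x by its coordinates along V_rho determines Theta and makes the V_rho coefficient of
    the first family exact, as the definition of a structured basis demands. The Gram correction is
    therefore put on the second family, whose coefficient may carry an O-term. *)

Section ConjugateTranspose.
Variable R : rcfType.
Local Notation K := R[i].

Lemma trCM a b c (A : 'M[K]_(a, b)) (B : 'M[K]_(b, c)) : (A *m B)^t* = B^t* *m A^t*.
Proof. by rewrite trmx_mul map_mxM. Qed.

Lemma trC0 a b : (0 : 'M[K]_(a, b))^t* = 0.
Proof. by rewrite trmx0 map_mx0. Qed.

Lemma trC1 a : (1%:M : 'M[K]_a)^t* = 1%:M.
Proof. by rewrite trmx1 map_mx1. Qed.

Lemma trCD a b (A B : 'M[K]_(a, b)) : (A + B)^t* = A^t* + B^t*.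
Proof. by rewrite linearD /= map_mxD. Qed.

Lemma trCB a b (A B : 'M[K]_(a, b)) : (A - B)^t* = A^t* - B^t*.
Proof. by rewrite linearB /= map_mxB. Qed.

Lemma trCZ a b x (A : 'M[K]_(a, b)) : (x *: A)^t* = x^*%R *: A^t*.
Proof. by rewrite linearZ /= map_mxZ. Qed.

Lemma trC_sum (I : Type) (r : seq I) (P : pred I) a b (f : I -> 'M[K]_(a, b)) :
  (\sum_(i <- r | P i) f i)^t* = \sum_(i <- r | P i) (f i)^t*.
Proof.
elim/big_rec2: _ => [|i x y _ <-]; first exact: trC0.
exact: trCD.
Qed.

Lemma conj_realC (x : R) : ((x%:C)^*)%R = x%:C.
Proof. by apply: conj_Creal; apply/complex_realP; exists x. Qed.

End ConjugateTranspose.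
Section Norm.
Variable R : realType.
Local Notation K := R[i].

(** The entry sum is submultiplicative, unlike the max-entry [mx_norm] of the statement, and it is
    real-valued, which suits [lra]. Bounds return to [mx_norm] through [mx_norm_le]. *)
Definition nrm a b (A : 'M[K]_(a, b)) : R := \sum_i \sum_j normc (A i j).

Lemma normc_ge0 (x : K) : 0 <= normc x.
Proof. by case: x => x y; rewrite sqrtr_ge0. Qed.

Lemma normc_normr (x : K) : `|x| = (normc x)%:C.
Proof. by []. Qed.

Lemma normcD (x y : K) : normc (x + y) <= normc x + normc y.
Proof. by rewrite -lecR rmorphD; apply: (@ler_normD _ K). Qed.

Lemma normcN (x : K) : normc (- x) = normc x.
Proof. by apply: complexI; rewrite -!normc_normr normrN. Qed.

Lemma nrm_ge0 a b (A : 'M[K]_(a, b)) : 0 <= nrm A.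
Proof. by apply: sumr_ge0 => i _; apply: sumr_ge0 => j _; apply: normc_ge0. Qed.

Lemma nrm0 a b : nrm (0 : 'M[K]_(a, b)) = 0.
Proof. by rewrite /nrm big1 // => i _; rewrite big1 // => j _; rewrite mxE normc0. Qed.

Lemma nrm_entry a b (A : 'M[K]_(a, b)) i j : normc (A i j) <= nrm A.
Proof.
rewrite /nrm (bigD1 i) //= (bigD1 j) //= -addrA lerDl addr_ge0 //.
  by apply: sumr_ge0 => k _; apply: normc_ge0.
by apply: sumr_ge0 => k _; apply: sumr_ge0 => ? _; apply: normc_ge0.
Qed.

Lemma nrm_eq0 a b (A : 'M[K]_(a, b)) : nrm A = 0 -> A = 0.
Proof.
move=> h; apply/matrixP => i j; rewrite mxE; apply: eq0_normc; apply/eqP.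
by rewrite eq_le normc_ge0 -h nrm_entry.
Qed.

Lemma nrmD a b (A B : 'M[K]_(a, b)) : nrm (A + B) <= nrm A + nrm B.
Proof.
rewrite /nrm -big_split ler_sum // => i _; rewrite -big_split ler_sum // => j _.
by rewrite mxE normcD.
Qed.

Lemma nrmN a b (A : 'M[K]_(a, b)) : nrm (- A) = nrm A.
Proof. by apply: eq_bigr => i _; apply: eq_bigr => j _; rewrite mxE normcN. Qed.

Lemma nrmB a b (A B : 'M[K]_(a, b)) : nrm (A - B) <= nrm A + nrm B.
Proof. by rewrite (le_trans (nrmD _ _)) ?nrmN. Qed.

Lemma normc_sum (I : Type) (r : seq I) (P : pred I) (f : I -> K) :
  normc (\sum_(i <- r | P i) f i) <= \sum_(i <- r | P i) normc (f i).
Proof.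
elim/big_rec2: _ => [|i x y _ h]; first by rewrite normc0.
by rewrite (le_trans (normcD _ _)) ?lerD2l.
Qed.

Lemma nrm_sum (I : Type) (r : seq I) (P : pred I) a b (f : I -> 'M[K]_(a, b)) :
  nrm (\sum_(i <- r | P i) f i) <= \sum_(i <- r | P i) nrm (f i).
Proof.
elim/big_rec2: _ => [|i x y _ h]; first by rewrite nrm0.
by rewrite (le_trans (nrmD _ _)) ?lerD2l.
Qed.

Lemma nrmM a b c (A : 'M[K]_(a, b)) (B : 'M[K]_(b, c)) :
  nrm (A *m B) <= nrm A * nrm B.
Proof.
rewrite /nrm mulr_suml ler_sum // => i _.
have le1 : \sum_j normc ((A *m B) i j) <=
    \sum_j \sum_k normc (A i k) * normc (B k j).
  apply: ler_sum => j _; rewrite mxE (le_trans (normc_sum _ _ _)) //.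
  by apply: ler_sum => k _; rewrite normcM.
rewrite (le_trans le1) // exchange_big mulr_suml ler_sum // => k _ /=.
rewrite -mulr_sumr ler_wpM2l ?normc_ge0 // (bigD1 k) //= lerDl.
by apply: sumr_ge0 => ? _; apply: sumr_ge0 => ? _; apply: normc_ge0.
Qed.

Lemma nrmZ a b (x : K) (A : 'M[K]_(a, b)) : nrm (x *: A) = normc x * nrm A.
Proof.
rewrite /nrm mulr_sumr; apply: eq_bigr => i _; rewrite mulr_sumr.
by apply: eq_bigr => j _; rewrite mxE normcM.
Qed.

Lemma nrm_tr a b (A : 'M[K]_(a, b)) : nrm A^T = nrm A.
Proof.
rewrite /nrm exchange_big; apply: eq_bigr => i _; apply: eq_bigr => j _.
by rewrite mxE.
Qed.

Lemma normc_conj (x : K) : normc x^*%R = normc x.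
Proof. by case: x => x y /=; rewrite sqrrN. Qed.

Lemma nrm_trC a b (A : 'M[K]_(a, b)) : nrm (A^t*) = nrm A.
Proof.
rewrite -nrm_tr; apply: eq_bigr => i _; apply: eq_bigr => j _.
by rewrite !mxE normc_conj.
Qed.

Lemma normcR (x : R) : normc (x%:C) = `|x|.
Proof. by rewrite /= expr0n addr0 sqrtr_sqr. Qed.

Lemma normc_real (x : R) : 0 <= x -> normc (x%:C) = x.
Proof. by move=> x0; rewrite normcR ger0_norm. Qed.

Lemma mx_norm_le a b (A : 'M[K]_(a, b)) (c : R) : nrm A <= c -> mx_norm A <= c%:C.
Proof.
move=> Ac; have [->|/mx_norm_neq0[[i j] ->]] := eqVneq (mx_norm A) 0.
  by rewrite lecR (le_trans _ Ac) ?nrm_ge0.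
have -> : `|A i j| = (normc (A i j))%:C by [].
by rewrite lecR (le_trans _ Ac) ?nrm_entry.
Qed.

(* u k -/+ c 2^(1-k) are monotone and bound each other. *)
Lemma geometric_limit (u : nat -> R) (c : R) :
  (forall k, `|u k.+1 - u k| <= c * 2^-1 ^+ k) ->
  {l : R | forall k, `|u k - l| <= c * 2 * 2^-1 ^+ k}.
Proof.
move=> h.
pose v k := u k - c * 2 * 2^-1 ^+ k; pose w k := u k + c * 2 * 2^-1 ^+ k.
have c0 : 0 <= c.
  by have := le_trans (normr_ge0 _) (h 0%N); rewrite expr0 mulr1.
have step k : v k <= v k.+1 /\ w k.+1 <= w k.
  have := h k; rewrite ler_norml /v /w exprS.
  set e := _ ^+ k => /andP[h1 h2]; split; lra.
have vm : {homo v : a b / (a <= b)%N >-> a <= b}.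
  by apply: homo_leq => //; [apply: le_trans|move=> i; case: (step i)].
have wm : {homo w : a b / (a <= b)%N >-> b <= a}.
  apply: (@homo_leq _ w (fun x y => y <= x)) => //; [|by move=> i; case: (step i)].
  by move=> y x z h1 h2; apply: le_trans h2 h1.
have vw i j : v i <= w j.
  apply: (@le_trans _ _ (v (maxn i j))); first by rewrite vm // leq_maxl.
  apply: (@le_trans _ _ (w (maxn i j))); last by rewrite wm // leq_maxr.
  have : 0 <= c * 2 * 2^-1 ^+ maxn i j.
    by rewrite !mulr_ge0 ?exprn_ge0 ?invr_ge0.
  by rewrite /v /w; lra.
pose E := [set v k | k in [set: nat]].
have hs : has_sup E.
  by split; [exists (v 0%N); exists 0%N|exists (w 0%N) => _ [k _ <-]].
exists (sup E) => k; rewrite ler_norml; apply/andP.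
have h1 : v k <= sup E by apply: ub_le_sup; [case: hs|exists k].
have h2 : sup E <= w k by apply: ge_sup; [case: hs|move=> _ [j _ <-]].
by move: h1 h2; rewrite /v /w; split; lra.
Qed.

(** Completeness, entry by entry on real and imaginary parts; the rate is kept so that the limit can
    be estimated afterwards. *)
Lemma nrm_limit a b (u : nat -> 'M[K]_(a, b)) (c : R) :
  (forall k, nrm (u k.+1 - u k) <= c * 2^-1 ^+ k) ->
  exists (l : 'M[K]_(a, b)) (c' : R), forall k, nrm (u k - l) <= c' * 2^-1 ^+ k.
Proof.
move=> h.
have hre (x : K) : `|complex.Re x| <= normc x.
  by case: x => x y /=; rewrite -sqrtr_sqr ler_wsqrtr // lerDl sqr_ge0.
have him (x : K) : `|complex.Im x| <= normc x.
  by case: x => x y /=; rewrite -sqrtr_sqr ler_wsqrtr // lerDr sqr_ge0.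
have hn (x : K) : normc x <= `|complex.Re x| + `|complex.Im x|.
  case: x => x y /=.
  rewrite -[leRHS]ger0_norm ?addr_ge0 // -sqrtr_sqr ler_wsqrtr // sqrrD.
  rewrite !real_normK ?num_real // addrAC lerDl.
  by rewrite mulrn_wge0 // mulr_ge0.
have rel i j : {l : R | forall k, `|complex.Re (u k i j) - l| <= c * 2 * 2^-1 ^+ k}.
  apply: geometric_limit => k; apply: le_trans (h k).
  apply: le_trans (nrm_entry _ i j); rewrite !mxE -raddfB; exact: hre.
have iml i j : {l : R | forall k, `|complex.Im (u k i j) - l| <= c * 2 * 2^-1 ^+ k}.
  apply: geometric_limit => k; apply: le_trans (h k).
  apply: le_trans (nrm_entry _ i j); rewrite !mxE -raddfB; exact: him.
exists (\matrix_(i, j) ((sval (rel i j)) +i* sval (iml i j))).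
exists (\sum_(i < a) \sum_(j < b) (c * 2 + c * 2)) => k.
rewrite /nrm mulr_suml ler_sum // => i _; rewrite mulr_suml ler_sum // => j _.
rewrite !mxE (le_trans (hn _)) // !raddfB /= mulrDl lerD //.
  exact: (svalP (rel i j)).
exact: (svalP (iml i j)).
Qed.

End Norm.

(** * Perturbation of matrix pencils *)

Section FixedPoint.
Variable R : realType.
Local Notation K := R[i].

(** Stands in for passing to the limit in an inequality: a geometric error term may be dropped. *)
Lemma le_geometric (x y c : R) :
  (forall k, x <= y + c * 2^-1 ^+ k) -> x <= y.
Proof.
move=> h; rewrite leNgt; apply/negP => yx.
have c0 : 0 < c by have := h 0%N; rewrite expr0; lra.
have d0 : 0 < (x - y) / c by rewrite divr_gt0 // subr_gt0.
have := h (Num.bound ((x - y) / c)^-1).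
set k := Num.bound _.
have kb : ((x - y) / c)^-1 < k%:R by rewrite archi_boundP // invr_ge0 ltW.
have : ((x - y) / c)^-1 < 2 ^+ k.
  by rewrite (lt_trans kb) // -natrX ltr_nat ltn_expl.
rewrite exprVn -[X in _ < X]invrK ltf_pV2 ?posrE ?invr_gt0 ?exprn_gt0 //.
by rewrite ltr_pdivlMr // => h1 h2; lra.
Qed.

(** Iterates from 0 stay in the ball because r/2 from the Lipschitz bound and r/2 from f 0 add up to
    r, and their increments halve. *)
Lemma contraction_fixpoint a b (f : 'M[K]_(a, b) -> 'M[K]_(a, b)) (r : R) :
  nrm (f 0) <= r / 2 ->
  (forall h h', nrm h <= r -> nrm h' <= r -> nrm (f h - f h') <= nrm (h - h') / 2) ->
  exists2 h, nrm h <= r & f h = h.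
Proof.
move=> f0 fl.
have r0 : 0 <= r by have := nrm_ge0 (f 0); lra.
pose u k := iter k f 0.
have ur k : nrm (u k) <= r.
  elim: k => [|k IH]; first by rewrite nrm0.
  have -> : u k.+1 = (f (u k) - f 0) + f 0 by rewrite subrK.
  rewrite (le_trans (nrmD _ _)) //.
  by have := fl _ 0 IH; rewrite nrm0 subr0 => /(_ r0); lra.
have us k : nrm (u k.+1 - u k) <= r * 2^-1 ^+ k.
  elim: k => [|k IH]; first by rewrite expr0 subr0 /=; lra.
  by rewrite exprS; have := fl _ _ (ur k.+1) (ur k); rewrite -!iterS -!/(u _); lra.
have [l [c hc]] := nrm_limit us.
have lr : nrm l <= r.
  apply: (@le_geometric _ _ c) => k.
  have -> : l = u k - (u k - l) by rewrite opprB addrC subrK.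
  by rewrite (le_trans (nrmB _ _)) // lerD.
exists l => //; apply/eqP; rewrite -subr_eq0; apply/eqP/nrm_eq0/eqP.
rewrite eq_le nrm_ge0 andbT; apply: (@le_geometric _ _ c) => k; rewrite add0r.
have -> : f l - l = (u k.+1 - l) - (f (u k) - f l) by rewrite opprB [RHS]addrC -[u k.+1]/(f (u k)) addrA subrK.
rewrite (le_trans (nrmB _ _)) //.
have := hc k; have := hc k.+1; have := fl _ _ (ur k) lr; rewrite exprS.
by set e := _ ^+ k; lra.
Qed.

(** Domain and codomain coincide, so injectivity yields an inverse. Its norm constant is the sum of
    the norms of its values on the elementary matrices. *)
Lemma linear_inverse a b (L0 : 'M[K]_(a, b) -> 'M[K]_(a, b)) :
  linear L0 -> (forall h, L0 h = 0 -> h = 0) ->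
  exists (g : 'M[K]_(a, b) -> 'M[K]_(a, b)) (c : R),
    [/\ forall y, L0 (g y) = y,
        forall y y', g (y - y') = g y - g y',
        0 <= c & forall y, nrm (g y) <= c * nrm y].
Proof.
move=> lL0.
pose L : {linear 'M[K]_(a, b) -> 'M[K]_(a, b)} :=
  HB.pack L0 (GRing.isLinear.Build _ _ _ _ L0 lL0).
move=> Li; pose ML := lin_mx L.
have MLu : ML \in unitmx.
  rewrite -row_free_unit; apply: inj_row_free => v hv.
  have /(Li _) : L (vec_mx v) = 0.
    by apply: (can_inj mxvecK); rewrite -mul_vec_lin vec_mxK hv linear0.
  by move=> e; rewrite -[v]vec_mxK e linear0.
pose g0 := fun y => vec_mx (mxvec y *m invmx ML).
have g0L : linear g0 by move=> x y z; rewrite /g0 !linearP mulmxDl -scalemxAl linearP.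
have g0D : {morph g0 : x y / x + y}.
  by move=> x y; have := g0L 1 x y; rewrite !scale1r.
have g0Z x y : g0 (x *: y) = x *: g0 y.
  by rewrite /g0 linearZ -scalemxAl linearZ.
have g0s (I : finType) (F : I -> 'M[K]_(a, b)) : g0 (\sum_i F i) = \sum_i g0 (F i).
  apply: (big_morph g0 g0D).
  by rewrite /g0 linear0 mul0mx linear0.
exists g0, (\sum_i \sum_j nrm (g0 (delta_mx i j))); split.
- move=> y; apply: (can_inj mxvecK); rewrite -[L0]/(L : _ -> _).
  by rewrite -mul_vec_lin vec_mxK -mulmxA mulVmx // mulmx1.
- by move=> y y'; rewrite g0D -scaleN1r g0Z scaleN1r.
- by apply: sumr_ge0 => i _; apply: sumr_ge0 => j _; apply: nrm_ge0.
move=> y; rewrite {1}[y]matrix_sum_delta g0s (le_trans (nrm_sum _ _ _)) //.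
rewrite mulr_suml ler_sum // => i _; rewrite g0s (le_trans (nrm_sum _ _ _)) //.
rewrite mulr_suml ler_sum // => j _; rewrite g0Z nrmZ mulrC.
by rewrite ler_wpM2l ?nrm_ge0 ?nrm_entry.
Qed.

Lemma linear_surjective a b (L : 'M[K]_(a, b) -> 'M[K]_(a, b)) :
  linear L -> (forall h, L h = 0 -> h = 0) -> forall y, exists x, L x = y.
Proof. by move=> l /(linear_inverse l) [g [c [gK _ _ _]]] y; exists (g y). Qed.

(** With g the inverse of L, the equation reads h = g (e h). A remainder of size eps at 0 and
    quadratic up to eps makes this a contraction on a ball of radius proportional to eps. *)
Lemma perturbed_linear_solve a b (L : 'M[K]_(a, b) -> 'M[K]_(a, b)) (c : R) :
  linear L -> (forall h, L h = 0 -> h = 0) -> 0 <= c ->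
  exists c' e0 : R, [/\ 0 <= c', 0 < e0 & forall (eps : R) (e : 'M[K]_(a, b) -> 'M[K]_(a, b)),
    0 <= eps <= e0 -> nrm (e 0) <= c * eps ->
    (forall h h', nrm h <= 1 -> nrm h' <= 1 ->
       nrm (e h - e h') <= c * (eps + nrm h + nrm h') * nrm (h - h')) ->
    exists2 h, nrm h <= c' * eps & L h = e h].
Proof.
move=> lL /(linear_inverse lL) [g [k [gK gB k0 gk]]] c0.
have kc0 : 0 <= k * c by rewrite mulr_ge0.
(* The factor 2 places g (e 0) in half the ball; [d] collects the smallness conditions c' eps <= 1
   and k c (1 + 2 c') eps <= 1/2. *)
pose c' := 2 * (k * c).
have c'0 : 0 <= c' by rewrite mulr_ge0.
pose d := c' + k * c * (1 + 2 * c') * 2 + 1.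
have d0 : 0 < d.
  by rewrite ltr_wpDl // addr_ge0 // !mulr_ge0 // addr_ge0 // mulr_ge0.
exists c', d^-1; split=> //; first by rewrite invr_gt0.
move=> eps e /andP[e0 e1] he0 heL.
have de : d * eps <= 1 by rewrite mulrC -ler_pdivlMr // div1r.
have c'e : c' * eps <= 1.
  apply: le_trans de; rewrite ler_wpM2r // /d -addrA lerDl addr_ge0 //.
  by rewrite !mulr_ge0 // addr_ge0 // mulr_ge0.
have ke : k * c * (1 + 2 * c') * eps <= 2^-1.
  suff : k * c * (1 + 2 * c') * 2 * eps <= 1 by set w := k * c * _; lra.
  apply: le_trans de; rewrite ler_wpM2r // /d addrAC.
  by rewrite lerDr addr_ge0.
have [||h hr hf] := @contraction_fixpoint a b (g \o e) (c' * eps).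
- rewrite /= (le_trans (gk _)) // (le_trans (ler_wpM2l k0 he0)) //.
  by rewrite /c'; lra.
- move=> h h' hh hh' /=; rewrite -gB (le_trans (gk _)) //.
  have hl := heL h h' (le_trans hh c'e) (le_trans hh' c'e).
  rewrite (le_trans (ler_wpM2l k0 hl)) // !mulrA -(mulrC 2^-1).
  rewrite ler_wpM2r ?nrm_ge0 // (le_trans _ ke) // -!(mulrA (k * c)) ler_wpM2l //.
  lra.
by exists h => //; rewrite -{1}hf /= gK.
Qed.

End FixedPoint.

Section Pencil.
Variable R : realType.
Local Notation K := R[i].

Lemma nrmM_le a b c (A : 'M[K]_(a, b)) (B : 'M[K]_(b, c)) (x y : R) :
  nrm A <= x -> nrm B <= y -> nrm (A *m B) <= x * y.
Proof.
move=> Ax By; rewrite (le_trans (nrmM _ _)) // ler_pM ?nrm_ge0 //.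
Qed.

Lemma nrmD_le a b (A B : 'M[K]_(a, b)) (x y : R) :
  nrm A <= x -> nrm B <= y -> nrm (A + B) <= x + y.
Proof. by move=> Ax By; rewrite (le_trans (nrmD _ _)) // lerD. Qed.

Lemma nrmB_le a b (A B : 'M[K]_(a, b)) (x y : R) :
  nrm A <= x -> nrm B <= y -> nrm (A - B) <= x + y.
Proof. by move=> Ax By; rewrite (le_trans (nrmB _ _)) // lerD. Qed.

Lemma nrmBC a b (A B : 'M[K]_(a, b)) : nrm (A - B) = nrm (B - A).
Proof. by rewrite -nrmN opprB. Qed.

Lemma subrACA (V : zmodType) (a b c d : V) : a - b - (c - d) = (a - c) - (b - d).
Proof. by rewrite !opprB [LHS]addrACA [RHS]addrACA [- b - c]addrC. Qed.

Lemma sub3rACA (V : zmodType) (a b c a' b' c' : V) :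
  a - b - c - (a' - (b' + c')) = (a - a') + (b' - b) + (c' - c).
Proof.
by rewrite opprB !addrA [LHS](ACl (1*6*4*2*5*3)).
Qed.

Lemma mulmx_subM a b c (A A' : 'M[K]_(a, b)) (B B' : 'M[K]_(b, c)) :
  A *m B - A' *m B' = (A - A') *m B + A' *m (B - B').
Proof. by rewrite mulmxBl mulmxBr addrA subrK. Qed.

Lemma nrm_subM a b c (A A' : 'M[K]_(a, b)) (B B' : 'M[K]_(b, c)) (x y u v : R) :
  nrm (A - A') <= x -> nrm B <= y -> nrm A' <= u -> nrm (B - B') <= v ->
  nrm (A *m B - A' *m B') <= x * y + u * v.
Proof. by move=> *; rewrite mulmx_subM nrmD_le // nrmM_le. Qed.

Lemma riccati_sub n r (P Q : 'M[K]_n) (Pi : 'M[K]_(r, n)) (x y : 'M[K]_(n, r)) :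
  (P *m x - Q *m x *m (Pi *m P *m x)) - (P *m y - Q *m y *m (Pi *m P *m y))
  = P *m (x - y) - (Q *m (x - y) *m (Pi *m P *m x) + Q *m y *m (Pi *m P *m (x - y))).
Proof.
rewrite subrACA (mulmx_subM (Q *m x) (Q *m y)).
by rewrite (mulmxBr P) (mulmxBr Q) (mulmxBr (Pi *m P)).
Qed.

Lemma linear_fun_mul a b c d (A : 'M[K]_(a, b)) (B : 'M[K]_(c, d)) :
  linear (fun X => A *m X *m B).
Proof. by move=> k x y; rewrite linearP mulmxDl -scalemxAl. Qed.

Lemma linear_fun_sub (U V : lmodType K) (f g : U -> V) :
  linear f -> linear g -> linear (fun x => f x - g x).
Proof. by move=> hf hg k x y; rewrite hf hg scalerBr opprD addrACA. Qed.

Lemma linear_fun_add (U V : lmodType K) (f g : U -> V) :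
  linear f -> linear g -> linear (fun x => f x + g x).
Proof. by move=> hf hg k x y; rewrite hf hg scalerDr addrACA. Qed.

Lemma linear_fun_comp (U V W : lmodType K) (f : V -> W) (g : U -> V) :
  linear f -> linear g -> linear (f \o g).
Proof. by move=> hf hg k x y; rewrite /= hg hf. Qed.

Lemma linear_funB (U V : lmodType K) (f : U -> V) :
  linear f -> forall x y, f x - f y = f (x - y).
Proof. by move=> hf x y; have := hf (-1) y x; rewrite !scaleN1r ![- _ + _]addrC. Qed.

Lemma lipschitz_bound (c1 c2 e a b w m M p : R) :
  0 <= c1 -> 0 <= c2 -> 0 <= e -> 0 <= a -> 0 <= b -> 0 <= m -> 0 <= M -> 0 <= p ->
  0 <= w -> w <= m * p ->
  (c1 * e + c2 * a + c2 * b) * w <= (c1 + c2) * (M + m) * (e + a + b) * p.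
Proof.
move=> c10 c20 e0 a0 b0 m0 M0 p0 w0 wm.
rewrite [leRHS](_ : _ = ((c1 + c2) * (e + a + b)) * ((M + m) * p)); last by ring.
have p1 := mulr_ge0 c10 a0; have p2 := mulr_ge0 c10 b0.
have p3 := mulr_ge0 c20 e0; have p4 := mulr_ge0 c20 a0.
have p5 := mulr_ge0 c20 b0; have p6 := mulr_ge0 c10 e0.
apply: ler_pM => //; [lra|lra|apply: (le_trans wm)].
by rewrite ler_wpM2r // lerDr.
Qed.

(* Normalizing by Pi x = 1 eliminates Theta = Pi P x, leaving a quadratic equation. *)
Lemma pencil_perturbation n r (P0 Q0 : 'M[K]_n) (Pi : 'M[K]_(r, n))
    (x0 : 'M[K]_(n, r)) (Th0 : 'M[K]_r) :
  Pi *m x0 = 1%:M -> P0 *m x0 = Q0 *m x0 *m Th0 -> Pi *m Q0 = Pi ->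
  (forall h, Pi *m h = 0 ->
     P0 *m h - Q0 *m h *m Th0 = Q0 *m x0 *m (Pi *m P0 *m h) -> h = 0) ->
  exists c e0 : R, [/\ 0 <= c, 0 < e0 & forall (eps : R) (P Q : 'M[K]_n),
    0 <= eps <= e0 -> nrm (P - P0) <= eps -> nrm (Q - Q0) <= eps -> Pi *m Q = Pi ->
    exists x, [/\ nrm (x - x0) <= c * eps, Pi *m x = 1%:M &
                P *m x = Q *m x *m (Pi *m P *m x)]].
Proof.
move=> Pix0 Px0 PiQ0 uniq0.
have Th0E : Th0 = Pi *m P0 *m x0.
  by rewrite -mulmxA Px0 -!mulmxA (mulmxA Pi) PiQ0 mulmxA Pix0 mul1mx.
pose L0 h := P0 *m h - Q0 *m h *m Th0 - Q0 *m x0 *m (Pi *m P0 *m h).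
pose pr (h : 'M[K]_(n, r)) := h - x0 *m (Pi *m h).
pose L h := L0 (pr h) + x0 *m (Pi *m h).
have mulL (A : 'M[K]_n) : linear (fun h : 'M[K]_(n, r) => A *m h).
  by move=> k x y; rewrite linearP.
have prL : linear pr.
  by apply: linear_fun_sub => [|k x y]; [|rewrite !linearP].
have L0L : linear L0.
  apply: linear_fun_sub => [|k x y]; last by rewrite !linearP.
  by apply: linear_fun_sub (mulL P0) (linear_fun_mul Q0 Th0).
have LL : linear L.
  apply: linear_fun_add => [|k x y]; last by rewrite !linearP.
  exact: (linear_fun_comp L0L prL).
have Pipr h : Pi *m pr h = 0 by rewrite /pr mulmxBr (mulmxA Pi x0) Pix0 mul1mx subrr.
have PiL0 h : Pi *m h = 0 -> Pi *m L0 h = 0.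
  move=> h0; rewrite /L0 !mulmxBr !mulmxA PiQ0 Pix0 mul1mx h0 mul0mx subr0.
  by rewrite -!mulmxA subrr.
have PiL h : Pi *m L h = Pi *m h.
  by rewrite /L mulmxDr PiL0 ?Pipr // add0r (mulmxA Pi x0) Pix0 mul1mx.
have Linj h : L h = 0 -> h = 0.
  move=> Lh; have Pih : Pi *m h = 0 by rewrite -PiL Lh mulmx0.
  have prh : pr h = h by rewrite /pr Pih mulmx0 subr0.
  move: Lh; rewrite /L prh Pih mulmx0 addr0 => /eqP; rewrite subr_eq0 => /eqP.
  exact: uniq0.
(* For eps <= 1, M bounds all the data, m bounds [pr], and X bounds x0 + pr h on the unit ball; c1
   and c2 are the coefficients of eps and of the norms of h, h' in the Lipschitz estimate. *)
pose M := 1 + nrm P0 + nrm Q0 + nrm x0 + nrm Pi.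
have [nP0 nQ0 nx0 nPi] : [/\ 0 <= nrm P0, 0 <= nrm Q0, 0 <= nrm x0 & 0 <= nrm Pi].
  by rewrite !nrm_ge0.
have M0 : 1 <= M by rewrite /M; lra.
have Mge0 : 0 <= M by lra.
pose m := 1 + M * M.
have m0 : 1 <= m by rewrite /m lerDl mulr_ge0.
pose X := M + m.
pose c1 := 1 + M * M * X + 3 * (M * M * M); pose c2 := M * M * M * m.
have MM0 : 0 <= M * M by rewrite mulr_ge0.
have MMM0 : 0 <= M * M * M by rewrite mulr_ge0.
have X0 : 0 <= X by rewrite /X; lra.
have MMX0 : 0 <= M * M * X by rewrite mulr_ge0.
have c10 : 0 <= c1 by rewrite /c1; lra.
have c20 : 0 <= c2 by rewrite mulr_ge0 //; lra.
pose c := (c1 + c2) * (M + m).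
have c0 : 0 <= c by rewrite mulr_ge0 ?addr_ge0 //; lra.
have [c' [e0 [c'0 e00 H]]] := perturbed_linear_solve LL Linj c0.
exists c', (Num.min e0 1); split=> //; first by rewrite lt_min e00 ltr01.
move=> eps P Q /andP[ep0]; rewrite le_min => /andP[ee0 e1] hP hQ PiQ.
pose f x := P *m x - Q *m x *m (Pi *m P *m x).
pose e h := L0 (pr h) - f (x0 + pr h).
have nP : nrm P <= M.
  have -> : P = (P - P0) + P0 by rewrite subrK.
  by apply: le_trans (nrmD_le hP (lexx _)) _; rewrite /M; lra.
have nP0M : nrm P0 <= M by rewrite /M; lra.
have nQ0M : nrm Q0 <= M by rewrite /M; lra.
have nPiM : nrm Pi <= M by rewrite /M; lra.
have nx0M : nrm x0 <= M by rewrite /M; lra.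
have nQ : nrm Q <= M.
  have -> : Q = (Q - Q0) + Q0 by rewrite subrK.
  by apply: le_trans (nrmD_le hQ (lexx _)) _; rewrite /M; lra.
have npr h : nrm (pr h) <= m * nrm h.
  apply: le_trans (nrmB_le (lexx _) (nrmM_le nx0M (nrmM_le nPiM (lexx _)))) _.
  by rewrite le_eqVlt; apply/orP; left; apply/eqP; rewrite /m; ring.
have pr0 : pr 0 = 0 by rewrite /pr !mulmx0 subrr.
have L00 : L0 0 = 0 by rewrite /L0 !mulmx0 mul0mx !subrr.
have [] := H eps e; first by rewrite ep0.
- rewrite /e pr0 L00 sub0r addr0 nrmN.
  have -> : f x0 = (P - P0) *m x0
      - (Q *m x0 *m (Pi *m P *m x0) - Q0 *m x0 *m (Pi *m P0 *m x0)).
    by rewrite /f -Th0E -Px0 mulmxBl opprB addrA subrK.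
  have t1 := nrmM_le hP nx0M.
  have b1 : nrm (Q *m x0 - Q0 *m x0) <= eps * M by rewrite -mulmxBl nrmM_le.
  have b2 : nrm (Pi *m P *m x0) <= M * M * M by rewrite !nrmM_le.
  have b3 : nrm (Q0 *m x0) <= M * M by rewrite nrmM_le.
  have b4 : nrm (Pi *m P *m x0 - Pi *m P0 *m x0) <= M * eps * M.
    by rewrite -mulmxBl -mulmxBr !nrmM_le.
  apply: le_trans (nrmB_le t1 (nrm_subM b1 b2 b3 b4)) _.
  rewrite [leLHS](_ : _ = (1 + 2 * (M * M * M)) * eps * M); last by ring.
  rewrite mulrAC /c ler_wpM2r // ler_pM //; first by lra.
    by rewrite /c1; lra.
  by lra.
- move=> h1 h2 h11 h21.
  pose d := pr h1 - pr h2; pose x1 := x0 + pr h1; pose x2 := x0 + pr h2.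
  have dE : d = pr (h1 - h2) by rewrite /d (linear_funB prL).
  have dx : x1 - x2 = d by rewrite /x1 /x2 opprD addrACA subrr add0r.
  have eE : e h1 - e h2 = (P0 - P) *m d
     + (Q *m d *m (Pi *m P *m x1) - Q0 *m d *m (Pi *m P0 *m x0))
     + (Q *m x2 *m (Pi *m P *m d) - Q0 *m x0 *m (Pi *m P0 *m d)).
    have lE : L0 (pr h1) - L0 (pr h2) = L0 d by exact: (linear_funB L0L (pr h1) (pr h2)).
    have rE : f x1 - f x2 = P *m d - (Q *m d *m (Pi *m P *m x1)
                                      + Q *m x2 *m (Pi *m P *m d)).
      by rewrite -dx; apply: riccati_sub.
    transitivity ((L0 (pr h1) - L0 (pr h2)) - (f x1 - f x2)); first exact: subrACA.
    apply: (etrans (congr2 (fun a b => a - b) lE rE)).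
    by rewrite -Th0E [(P0 - P) *m d]mulmxBl; apply: sub3rACA.
  have m00 : 0 <= m by lra.
  pose w := nrm d; pose k1 := m * nrm h1; pose k2 := m * nrm h2.
  have hd : nrm d <= w by [].
  have n1 := nrm_ge0 h1; have n2 := nrm_ge0 h2.
  have hx1 : nrm x1 <= X.
    apply: nrmD_le => //; apply: le_trans (npr h1) _.
    by rewrite -[leRHS]mulr1 ler_wpM2l.
  have b0 : nrm (P0 - P) <= eps by rewrite nrmBC.
  have a1 : nrm (Q *m d - Q0 *m d) <= eps * w by rewrite -mulmxBl nrmM_le.
  have a2 : nrm (Pi *m P *m x1) <= M * M * X by rewrite !nrmM_le.
  have a3 : nrm (Q0 *m d) <= M * w by rewrite nrmM_le.
  have a4 : nrm (Pi *m P *m x1 - Pi *m P0 *m x0) <= M * eps * M + M * M * k1.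
    have -> : Pi *m P *m x1 - Pi *m P0 *m x0 = Pi *m (P - P0) *m x0 + Pi *m P *m pr h1.
      by rewrite /x1 mulmxDr (mulmxBr Pi) (mulmxBl (Pi *m P)) addrAC.
    by apply: nrmD_le; apply: nrmM_le => //; apply: nrmM_le.
  have a5 : nrm (Q *m x2 - Q0 *m x0) <= eps * M + M * k2.
    have -> : Q *m x2 - Q0 *m x0 = (Q - Q0) *m x0 + Q *m pr h2.
      by rewrite /x2 mulmxDr (mulmxBl Q) addrAC.
    by apply: nrmD_le; apply: nrmM_le.
  have a6 : nrm (Pi *m P *m d) <= M * M * w by rewrite !nrmM_le.
  have a7 : nrm (Q0 *m x0) <= M * M by rewrite nrmM_le.
  have a8 : nrm (Pi *m P *m d - Pi *m P0 *m d) <= M * eps * w.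
    by rewrite -mulmxBl -mulmxBr !nrmM_le.
  have T := nrmD_le (nrmD_le (nrmM_le b0 hd) (nrm_subM a1 a2 a3 a4)) (nrm_subM a5 a6 a7 a8).
  rewrite eE; apply: (le_trans T).
  rewrite [leLHS](_ : _ = (c1 * eps + c2 * nrm h1 + c2 * nrm h2) * w); last first.
    by rewrite /c1 /c2 /X /k1 /k2; ring.
  have wm : w <= m * nrm (h1 - h2) by rewrite /w dE npr.
  by apply: lipschitz_bound wm => //; apply: nrm_ge0.
move=> h hc Lh; exists (x0 + h).
(* Because Pi Q = Pi, f sends solutions of Pi x = 1 into the kernel of Pi. Hence the fixed point has
   Pi h = 0, and L h = e h becomes f (x0 + h) = 0. *)
have Pif x : Pi *m x = 1%:M -> Pi *m f x = 0.
  by move=> Pix; rewrite mulmxBr !mulmxA PiQ Pix mul1mx subrr.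
have Pih : Pi *m h = 0.
  have z1 : Pi *m L0 (pr h) = 0 by apply/PiL0/Pipr.
  have z2 : Pi *m f (x0 + pr h) = 0.
    by apply: Pif; rewrite (mulmxDr Pi x0) Pipr addr0.
  rewrite -PiL Lh (mulmxBr Pi (L0 (pr h)) (f (x0 + pr h))).
  by apply: (etrans (congr2 (fun a b => a - b) z1 z2)); rewrite subrr.
have prh : pr h = h by rewrite /pr Pih mulmx0 subr0.
move: Lh; rewrite /L /e prh Pih mulmx0 addr0 => /eqP.
rewrite eq_sym subr_eq addrC -subr_eq subrr eq_sym subr_eq0 => /eqP fx.
split; first by rewrite addrAC subrr add0r.
  by rewrite mulmxDr Pix0 Pih addr0.
exact: fx.
Qed.

End Pencil.

(** * Simple invariant subspaces *)

Section SpectralSplitting.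
Variable R : realType.
Local Notation K := R[i].

Lemma spectrum_char_poly r (A : 'M[K]_r) :
  char_poly A = \prod_(z <- sval (closed_field_poly_normal (char_poly A))) ('X - z%:P).
Proof.
case: closed_field_poly_normal => s /= {1}->.
by rewrite (monicP (char_poly_monic A)) scale1r.
Qed.

Lemma mem_spectrum r (A : 'M[K]_r) x : (x \in spectrum A) = root (char_poly A) x.
Proof.
rewrite [in RHS]spectrum_char_poly root_prod_XsubC /spectrum.
by rewrite (perm_mem (perm_eq_seq_mset _)).
Qed.

Lemma spectrum_mul r1 r2 r3 (A : 'M[K]_r1) (B : 'M[K]_r2) (C : 'M[K]_r3) :
  char_poly A = char_poly B * char_poly C ->
  spectrum A = (spectrum B `+` spectrum C)%mset.
Proof.
rewrite (spectrum_char_poly A) (spectrum_char_poly B) (spectrum_char_poly C).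
rewrite -big_cat /= => /prod_XsubC_eq /eq_seq_msetP; rewrite /spectrum => ->.
by apply/msetP => x; rewrite !msetE2 !mset_seqE count_cat.
Qed.

Lemma not_root_unitmx r (A : 'M[K]_r) x :
  ~~ root (char_poly A) x -> A - x%:M \in unitmx.
Proof.
rewrite -eigenvalue_root_char /eigenvalue negbK /eigenspace => /eqP h.
by rewrite -row_free_unit -kermx_eq0 h.
Qed.

(** Cayley-Hamilton for B: G times the product of the factors B - x is zero. Each factor passes to
    the left of G as A - x, which is invertible because x is not a root for A. *)
Lemma sylvester_injective r l (A : 'M[K]_r) (B : 'M[K]_l) (G : 'M[K]_(r, l)) :
  (forall x, root (char_poly A) x -> root (char_poly B) x -> False) ->
  A *m G = G *m B -> G = 0.
Proof.
case: l => [|l] in B G *; first by move=> _ _; apply/matrixP => ? [].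
move=> dis AG; have := Cayley_Hamilton B.
have := spectrum_char_poly B; set s := sval _ => sE.
have {dis} : all (fun x => ~~ root (char_poly A) x) s.
  apply/allP => x xs; apply/negP => /dis; apply.
  by rewrite sE root_prod_XsubC.
rewrite sE rmorph_prod /=; move: {sE} s => s As h.
have {h} : G *m \prod_(x <- s) horner_mx B ('X - x%:P) = 0 by rewrite h mulmx0.
elim: s As => [|x s IH] /=; first by rewrite big_nil mulmx1.
move=> /andP[Ax As]; rewrite big_cons -mulmxE mulmxA rmorphB /= horner_mx_X horner_mx_C.
have -> : G *m (B - x%:M) = (A - x%:M) *m G.
  by rewrite mulmxBr mulmxBl AG scalar_mxC.
rewrite -mulmxA => /(congr1 (mulmx (invmx (A - x%:M)))).
by rewrite mulKmx ?not_root_unitmx // mulmx0; apply: IH.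
Qed.

(** The rectangular form accommodates [row_mx F F'] below, whose number of columns equals d only
    propositionally. *)
Lemma char_poly_similar d e (A : 'M[K]_(d, e)) (B : 'M[K]_(e, d)) (N : 'M[K]_e) :
  A *m B = 1%:M -> B *m A = 1%:M -> char_poly (A *m N *m B) = char_poly N.
Proof.
move=> AB BA; have de : d = e.
  by apply/eqP; rewrite eqn_leq (mulmx1_min AB) (mulmx1_min BA).
subst e; rewrite /char_poly.
pose PA := map_mx (@polyC K) A; pose PB := map_mx (@polyC K) B.
have PAB : PA *m PB = 1%:M by rewrite -map_mxM AB map_mx1.
have -> : char_poly_mx (A *m N *m B) = PA *m char_poly_mx N *m PB.
  rewrite /char_poly_mx mulmxBr mulmxBl !map_mxM; congr (_ - _).
  by rewrite -/PA -/PB (scalar_mxC 'X PA) -mulmxA PAB mulmx1.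
by rewrite !det_mulmx mulrAC -det_mulmx PAB det1 mul1r.
Qed.

Lemma char_poly_block_diag r1 r2 (A : 'M[K]_r1) (B : 'M[K]_r2) :
  char_poly (block_mx A 0 0 B) = char_poly A * char_poly B.
Proof. by rewrite /char_poly char_block_diag_mx det_ublock. Qed.

Lemma char_poly_tr r (A : 'M[K]_r) : char_poly A^T = char_poly A.
Proof.
rewrite /char_poly -det_tr; congr (\det _).
by rewrite /char_poly_mx linearB /= tr_scalar_mx -map_trmx trmxK.
Qed.

(** The complementary projector 1 - F G splits Th into diag(Om, Th'), and the multiset hypothesis
    says that Th' and Om share no eigenvalue. A solution h of either kind factors through the
    complement, where it satisfies a homogeneous Sylvester equation. *)
Lemma simple_invariant_unique d l (Th : 'M[K]_d) (F : 'M[K]_(d, l))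
    (G : 'M[K]_(l, d)) (Om : 'M[K]_l) :
  Th *m F = F *m Om -> G *m Th = Om *m G -> G *m F = 1%:M ->
  (spectrum Om `&` (spectrum Th `\` spectrum Om))%mset = mset0 ->
  (forall h, G *m h = 0 -> Th *m h = h *m Om -> h = 0) /\
  (forall h, h *m F = 0 -> h *m Th = Om *m h -> h = 0).
Proof.
move=> ThF GTh GF dis.
pose P := 1%:M - F *m G.
have PF : P *m F = 0 by rewrite mulmxBl mul1mx -mulmxA GF mulmx1 subrr.
have PP : P *m P = P by rewrite {2}/P mulmxBr mulmx1 mulmxA PF mul0mx subr0.
(* A rank factorization of P provides bases of the complement together with cancellation laws. *)
have [r [F' [G' [FG' cancelL cancelR]]]] : exists r (F' : 'M[K]_(d, r)) (G' : 'M[K]_(r, d)),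
    [/\ F' *m G' = P,
        forall p (x : 'M[K]_(_, p)), F' *m x = 0 -> x = 0
      & forall p (x : 'M[K]_(p, _)), x *m G' = 0 -> x = 0].
  exists (\rank P), (col_base P), (row_base P); split; first exact: mulmx_base.
    have /row_fullP[L LF] := col_base_full P.
    by move=> p x /(congr1 (mulmx L)); rewrite mulmxA LF mul1mx mulmx0.
  have /row_freeP[L LF] := row_base_free P.
  by move=> p x /(congr1 (mulmx^~ L)); rewrite -mulmxA LF mulmx1 mul0mx.
have G'F' : G' *m F' = 1%:M.
  apply/eqP; rewrite -subr_eq0; apply/eqP/cancelL/cancelR.
  by rewrite mulmxBr mulmxBl mulmx1 mulmxA FG' -(mulmxA P) FG' PP subrr.
have GP : G *m P = 0 by rewrite mulmxBr mulmx1 mulmxA GF mul1mx subrr.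
have GF' : G *m F' = 0 by apply: cancelR; rewrite -(mulmxA G) FG' GP.
have G'F : G' *m F = 0 by apply: cancelL; rewrite mulmxA FG' PF.
pose Th' := G' *m Th *m F'.
have PTh : P *m Th = Th *m P.
  by rewrite /P mulmxBl mulmxBr mul1mx mulmx1 mulmxA ThF -!mulmxA GTh.
have G'Th : G' *m Th = Th' *m G'.
  rewrite /Th' -[RHS](mulmxA _ F') FG' -(mulmxA G') -PTh -FG' !mulmxA G'F'.
  by rewrite mul1mx.
have ThF' : Th *m F' = F' *m Th'.
  by rewrite /Th' !mulmxA FG' PTh -FG' -!mulmxA G'F' mulmx1.
have ThE : Th = row_mx F F' *m block_mx Om 0 0 Th' *m col_mx G G'.
  rewrite mul_row_block !mulmx0 addr0 add0r mul_row_col -ThF -ThF' -!mulmxA.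
  by rewrite FG' -mulmxDr /P addrC subrK mulmx1.
have sp : spectrum Th = (spectrum Om `+` spectrum Th')%mset.
  apply: spectrum_mul; rewrite ThE char_poly_similar ?char_poly_block_diag //.
    by rewrite mul_row_col FG' addrC subrK.
  by rewrite mul_col_row GF GF' G'F G'F' -scalar_mx_block.
have disj x : root (char_poly Th') x -> root (char_poly Om) x -> False.
  rewrite -!mem_spectrum => h1 h2.
  have : x \in (spectrum Om `&` (spectrum Th `\` spectrum Om))%mset.
    by rewrite sp msetDKB in_msetI h1 h2.
  by rewrite dis in_mset0.
split=> h h0 hh.
  have hE : h = F' *m (G' *m h).
    by rewrite mulmxA FG' mulmxBl mul1mx -mulmxA h0 mulmx0 subr0.
  rewrite hE (_ : G' *m h = 0) ?mulmx0 //.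
  apply: (sylvester_injective disj).
  by rewrite mulmxA -G'Th -mulmxA hh mulmxA.
have hE : h = (h *m F') *m G'.
  by rewrite -mulmxA FG' mulmxBr mulmx1 mulmxA h0 mul0mx subr0.
rewrite hE (_ : h *m F' = 0) ?mul0mx //.
apply: trmx_inj; rewrite trmx0.
apply: (@sylvester_injective _ _ Th'^T Om^T).
  by move=> x; rewrite !char_poly_tr; apply: disj.
by rewrite -!trmx_mul -mulmxA -ThF' mulmxA hh -mulmxA.
Qed.

End SpectralSplitting.

(** * Asymptotics *)

Section BigO.
Variable R : realType.
Local Notation K := R[i].
Local Notation near0 P := (\forall t \near (0 : R)^'+, P t).

Definition bigO a b (g : R -> R) (A : R -> 'M[K]_(a, b)) :=
  exists c : R, \forall t \near 0^'+, nrm (A t) <= c * g t.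

(** Fixed points are found separately for each t; choice assembles them into a family, about which
    only norm bounds are claimed. *)
Lemma near_choice (T : Type) (x0 : T) (P : R -> T -> Prop) :
  (\forall t \near (0 : R)^'+, exists x, P t x) ->
  exists f, \forall t \near (0 : R)^'+, P t (f t).
Proof.
move=> h; have /choice[f hf] : forall t, exists x, (exists y, P t y) -> P t x.
  by move=> t; have [[y Py]|n] := pselect (exists y, P t y); [exists y|exists x0].
by exists f; apply: filterS h => t; apply: hf.
Qed.

Lemma bigO_isO a b g (A : R -> 'M[K]_(a, b)) : bigO g A -> isO g A.
Proof. by move=> [c h]; exists c; apply: filterS h => t; apply: mx_norm_le. Qed.

Lemma bigO_ext a b g (A B : R -> 'M[K]_(a, b)) :
  (\forall t \near (0 : R)^'+, A t = B t) -> bigO g A -> bigO g B.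
Proof. by move=> e [c h]; exists c; apply: filterS2 e h => t ->. Qed.

Lemma bigO_le a b g h (A : R -> 'M[K]_(a, b)) :
  (\forall t \near (0 : R)^'+, 0 <= g t <= h t) -> bigO g A -> bigO h A.
Proof.
move=> gh [c hA]; exists `|c|; apply: filterS2 gh hA => t /andP[g0 gh] hA.
rewrite (le_trans hA) // (le_trans (ler_wpM2r g0 (ler_norm c))) //.
by rewrite ler_wpM2l.
Qed.

Lemma bigO_const a b (A : 'M[K]_(a, b)) : bigO (fun=> 1) (fun=> A).
Proof. by exists (nrm A); apply: nearW => t; rewrite mulr1. Qed.

Lemma bigO0 a b g : bigO g (fun=> 0 : 'M[K]_(a, b)).
Proof. by exists 0; apply: nearW => t; rewrite nrm0 mul0r. Qed.

Lemma bigOD a b g (A B : R -> 'M[K]_(a, b)) :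
  bigO g A -> bigO g B -> bigO g (fun t => A t + B t).
Proof.
move=> [c hA] [d hB]; exists (c + d); apply: filterS2 hA hB => t hA hB.
by rewrite mulrDl nrmD_le.
Qed.

Lemma bigON a b g (A : R -> 'M[K]_(a, b)) : bigO g A -> bigO g (fun t => - A t).
Proof. by move=> [c hA]; exists c; apply: filterS hA => t; rewrite nrmN. Qed.

Lemma bigO_trC a b g (A : R -> 'M[K]_(a, b)) : bigO g A -> bigO g (fun t => (A t)^t*).
Proof. by move=> [c hA]; exists c; apply: filterS hA => t; rewrite nrm_trC. Qed.

Lemma bigOM a b c g h (A : R -> 'M[K]_(a, b)) (B : R -> 'M[K]_(b, c)) :
  bigO g A -> bigO h B -> bigO (fun t => g t * h t) (fun t => A t *m B t).
Proof.
move=> [x hA] [y hB]; exists (x * y); apply: filterS2 hA hB => t hA hB.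
by rewrite mulrACA nrmM_le.
Qed.

Lemma bigOMl a b c g (A : R -> 'M[K]_(a, b)) (B : R -> 'M[K]_(b, c)) :
  bigO (fun=> 1) A -> bigO g B -> bigO g (fun t => A t *m B t).
Proof.
move=> hA hB; have [k hk] := bigOM hA hB; exists k.
by apply: filterS hk => t; rewrite mul1r.
Qed.

Lemma bigOMr a b c g (A : R -> 'M[K]_(a, b)) (B : R -> 'M[K]_(b, c)) :
  bigO g A -> bigO (fun=> 1) B -> bigO g (fun t => A t *m B t).
Proof.
move=> hA hB; have [k hk] := bigOM hA hB; exists k.
by apply: filterS hk => t; rewrite mulr1.
Qed.

Lemma bigO_sum (I : Type) (r : seq I) (P : pred I) a b g (A : I -> R -> 'M[K]_(a, b)) :
  (forall i, P i -> bigO g (A i)) -> bigO g (fun t => \sum_(i <- r | P i) A i t).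
Proof.
move=> h; elim: r => [|i r IH].
  by apply: bigO_ext (bigO0 a b g); apply: nearW => t; rewrite big_nil.
case: (boolP (P i)) => Pi.
  apply: bigO_ext (bigOD (h _ Pi) IH).
  by apply: nearW => t; rewrite big_cons Pi.
by apply: bigO_ext IH; apply: nearW => t; rewrite big_cons (negbTE Pi).
Qed.

Lemma bigO_scale a b (x : R -> R) g (A : R -> 'M[K]_(a, b)) :
  (\forall t \near (0 : R)^'+, 0 <= x t) -> bigO g A ->
  bigO (fun t => x t * g t) (fun t => (x t)%:C *: A t).
Proof.
move=> x0 [c hA]; exists c; apply: filterS2 x0 hA => t x0 hA.
by rewrite nrmZ normc_real // mulrCA ler_wpM2l.
Qed.

Variable z : R -> R.
Hypothesis z_gt0 : \forall t \near (0 : R)^'+, 0 < z t.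
Hypothesis z_small : forall e, 0 < e -> \forall t \near (0 : R)^'+, z t <= e.

Lemma near_small (c e : R) : 0 < e -> \forall t \near (0 : R)^'+, c * z t <= e.
Proof.
move=> e0; have c0 : 0 < `|c| + 1 by have := normr_ge0 c; lra.
have := z_small (divr_gt0 e0 c0); move: z_gt0; apply: filterS2 => t t0.
rewrite ler_pdivlMr // mulrC => h; apply: le_trans h.
apply: ler_wpM2r; first exact: ltW.
by apply: le_trans (ler_norm c) _; rewrite lerDl.
Qed.

Lemma bigOz_bounded a b (A : R -> 'M[K]_(a, b)) : bigO z A -> bigO (fun=> 1) A.
Proof.
apply: bigO_le; move: z_gt0 (z_small ltr01); apply: filterS2 => t z0 z1.
by rewrite ltW.
Qed.

Lemma bigOz_limit_bounded a b (A : R -> 'M[K]_(a, b)) (A0 : 'M[K]_(a, b)) :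
  bigO z (fun t => A t - A0) -> bigO (fun=> 1) A.
Proof.
move=> /bigOz_bounded h; apply: bigO_ext (bigOD h (bigO_const A0)).
by apply: nearW => t; rewrite subrK.
Qed.

Lemma bigOz_mulB a b c (A : R -> 'M[K]_(a, b)) (B : R -> 'M[K]_(b, c)) A0 B0 :
  bigO z (fun t => A t - A0) -> bigO z (fun t => B t - B0) ->
  bigO z (fun t => A t *m B t - A0 *m B0).
Proof.
move=> hA hB; have h1 := bigOMr hA (bigOz_limit_bounded hB).
have h2 := bigOMl (bigO_const A0) hB.
by apply: bigO_ext (bigOD h1 h2); apply: nearW => t; rewrite [RHS]mulmx_subM.
Qed.

Lemma bigOz_const a b (A : 'M[K]_(a, b)) : bigO z (fun=> A - A).
Proof. by rewrite subrr; apply: bigO0. Qed.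

Lemma bigOz_trC a b (A : R -> 'M[K]_(a, b)) A0 :
  bigO z (fun t => A t - A0) -> bigO z (fun t => (A t)^t* - A0^t*).
Proof.
move=> /bigO_trC; apply: bigO_ext; apply: nearW => t.
by rewrite trCB.
Qed.

(** X = M^-1 - 1 satisfies X = -(M - 1)(X + 1), and half of X can be absorbed on the left. The
    entry-sum norm of the identity is its size, hence the factor [nrm 1%:M]. *)
Lemma nrm_small_unitmx r (M : 'M[K]_r) : nrm (M - 1%:M) <= 2^-1 ->
  M \in unitmx /\ nrm (invmx M - 1%:M) <= 2 * nrm (1%:M : 'M[K]_r) * nrm (M - 1%:M).
Proof.
move=> hM; have Mu : M \in unitmx.
  rewrite -row_free_unit; apply: inj_row_free => v vM.
  have /nrm_eq0 // : nrm v = 0.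
  have vE : v *m (M - 1%:M) = - v by rewrite mulmxBr vM mulmx1 sub0r.
  have := nrmM v (M - 1%:M); rewrite vE nrmN => h.
  have := ler_wpM2l (nrm_ge0 v) hM; have := nrm_ge0 v; lra.
split=> //; pose X := invmx M - 1%:M.
have XE : X = - ((M - 1%:M) *m (X + 1%:M)).
  by rewrite subrK mulmxBl mulmxV // mul1mx opprB.
have := nrmM (M - 1%:M) (X + 1%:M); rewrite -nrmN -XE => h.
have h2 := ler_wpM2l (nrm_ge0 (M - 1%:M)) (nrmD X 1%:M).
have h3 := ler_wpM2r (nrm_ge0 X) hM.
have := le_trans h h2; rewrite mulrDr -/X; lra.
Qed.

Lemma bigOz_invmx r (M : R -> 'M[K]_r) : bigO z (fun t => M t - 1%:M) ->
  (\forall t \near (0 : R)^'+, M t \in unitmx) /\ bigO z (fun t => invmx (M t) - 1%:M).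
Proof.
move=> [c hM]; have h2 : (0 : R) < 2^-1 by rewrite invr_gt0.
split.
  by move: hM (near_small c h2); apply: filterS2 => t h1 h3;
    have [] := nrm_small_unitmx (le_trans h1 h3).
exists (2 * nrm (1%:M : 'M[K]_r) * c).
move: hM (near_small c h2); apply: filterS2 => t h1 h3.
have [_ h4] := nrm_small_unitmx (le_trans h1 h3).
apply: le_trans h4 _; rewrite -[leRHS]mulrA ler_wpM2l // mulr_ge0 ?nrm_ge0 //.
Qed.

Lemma pencil_family n r (P Q : R -> 'M[K]_n) (P0 Q0 : 'M[K]_n) (Pi : 'M[K]_(r, n))
    (x0 : 'M[K]_(n, r)) (Th0 : 'M[K]_r) :
  Pi *m x0 = 1%:M -> P0 *m x0 = Q0 *m x0 *m Th0 -> Pi *m Q0 = Pi ->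
  (forall h, Pi *m h = 0 ->
     P0 *m h - Q0 *m h *m Th0 = Q0 *m x0 *m (Pi *m P0 *m h) -> h = 0) ->
  bigO z (fun t => P t - P0) -> bigO z (fun t => Q t - Q0) ->
  (\forall t \near (0 : R)^'+, Pi *m Q t = Pi) ->
  exists (x : R -> 'M[K]_(n, r)) (Th : R -> 'M[K]_r),
    [/\ bigO z (fun t => x t - x0), bigO z (fun t => Th t - Th0) &
        \forall t \near (0 : R)^'+, Pi *m x t = 1%:M /\ P t *m x t = Q t *m x t *m Th t].
Proof.
move=> Pix0 Px0 PiQ0 uniq0 hP [q hQ] PiQ.
have [c [e0 [c0 e00 H]]] := pencil_perturbation Pix0 Px0 PiQ0 uniq0.
have [p hP'] := hP.
(* A single eps has to dominate the deviations of both P and Q. *)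
pose e := `|p| + `|q|.
have e_ge0 : 0 <= e by rewrite addr_ge0.
have /(near_choice 0)[x hx] : \forall t \near (0 : R)^'+, exists x,
    [/\ nrm (x - x0) <= c * (e * z t), Pi *m x = 1%:M
      & P t *m x = Q t *m x *m (Pi *m P t *m x)].
  near=> t.
  have z0 : 0 < z t by near: t.
  have ze : e * z t <= e0 by near: t; apply: near_small.
  have pt : nrm (P t - P0) <= p * z t by near: t.
  have qt : nrm (Q t - Q0) <= q * z t by near: t.
  have PiQt : Pi *m Q t = Pi by near: t.
  have z0' := ltW z0.
  apply: H => //; first by rewrite mulr_ge0.
    apply: (le_trans pt); rewrite ler_wpM2r // (le_trans (ler_norm p)) //.
    by rewrite lerDl.
  apply: (le_trans qt); rewrite ler_wpM2r // (le_trans (ler_norm q)) //.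
  by rewrite lerDr.
have hx0 : bigO z (fun t => x t - x0).
  by exists (c * e); apply: filterS hx => t []; rewrite mulrA.
exists x, (fun t => Pi *m P t *m x t); split=> //; last first.
  by apply: filterS hx => t [].
have -> : Th0 = Pi *m P0 *m x0.
  by rewrite -mulmxA Px0 -!mulmxA (mulmxA Pi) PiQ0 mulmxA Pix0 mul1mx.
apply: bigOz_mulB => //; apply: bigOz_mulB => //; exact: bigOz_const.
Unshelve. all: by end_near.
Qed.

(** Right and left subspaces are continued independently, for Th with Pi = [Fc^t*] and for its
    adjoint with Pi = [F^t*]. Their Gram matrix M tends to 1 and intertwines the two blocks, so
    dividing the second family by M turns its block into the adjoint of the first. *)
Lemma simple_pair_family d l (Th : 'M[K]_d) (F Fc : 'M[K]_(d, l)) (Om : 'M[K]_l)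
    (tTh : R -> 'M[K]_d) :
  Th *m F = F *m Om -> Th^t* *m Fc = Fc *m Om^t* -> F^t* *m Fc = 1%:M ->
  (spectrum Om `&` (spectrum Th `\` spectrum Om))%mset = mset0 ->
  bigO z (fun t => tTh t - Th) ->
  exists (tF tFc : R -> 'M[K]_(d, l)) (tOm : R -> 'M[K]_l),
    [/\ bigO z (fun t => tF t - F), bigO z (fun t => tFc t - Fc),
        bigO z (fun t => tOm t - Om) &
        \forall t \near (0 : R)^'+,
          [/\ tTh t *m tF t = tF t *m tOm t,
              (tTh t)^t* *m tFc t = tFc t *m (tOm t)^t*
            & (tF t)^t* *m tFc t = 1%:M]].
Proof.
move=> ThF ThFc FFc dis hTh.
have FcTh : Fc^t* *m Th = Om *m Fc^t*.
  by have := congr1 (fun M => M^t*) ThFc; rewrite !trCM !trmxCK.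
have FTh : F^t* *m Th^t* = Om^t* *m F^t*.
  by have := congr1 (fun M => M^t*) ThF; rewrite !trCM.
have FcF : Fc^t* *m F = 1%:M.
  by have := congr1 (fun M => M^t*) FFc; rewrite trCM trmxCK trC1.
have [U1 U2] := simple_invariant_unique ThF FcTh FcF dis.
have one d' : bigO z (fun=> 1%:M - (1%:M : 'M[K]_d')) by exact: bigOz_const.
have [|||||tF [tOm [hF hOm hFF]]] := @pencil_family d l tTh (fun=> 1%:M) Th 1%:M (Fc^t*) F Om
  _ _ _ _ hTh (one d) _.
- by [].
- by rewrite mul1mx.
- by rewrite mulmx1.
- move=> h h0 /eqP; rewrite !mul1mx FcTh -(mulmxA Om) h0 !mulmx0 subr_eq0 => /eqP.
  exact: U1.
- by apply: nearW => t; rewrite mulmx1.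
have [|||||tFc [tOmc [hFc hOmc hFFc]]] := @pencil_family d l (fun t => (tTh t)^t*)
  (fun=> 1%:M) (Th^t*) 1%:M (F^t*) Fc (Om^t*) _ _ _ _ (bigOz_trC hTh) (one d) _.
- by [].
- by rewrite mul1mx.
- by rewrite mulmx1.
- move=> h h0 /eqP; rewrite !mul1mx FTh -(mulmxA (Om^t*)) h0 !mulmx0 subr_eq0 => /eqP hh.
  suff h'0 : h^t* = 0 by rewrite -[h]trmxCK h'0 trC0.
  apply: U2; first by rewrite -[F]trmxCK -trCM h0 trC0.
  by have := congr1 (fun M => M^t*) hh; rewrite !trCM !trmxCK.
- by apply: nearW => t; rewrite mulmx1.
have hM : bigO z (fun t => (tF t)^t* *m tFc t - 1%:M).
  by rewrite -FFc; apply: bigOz_mulB => //; apply: bigOz_trC.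
have [Mu hMi] := bigOz_invmx hM.
exists tF, (fun t => tFc t *m invmx ((tF t)^t* *m tFc t)), tOm; split=> //.
  by rewrite -[Fc]mulmx1; apply: bigOz_mulB => //; rewrite mulmx1.
move: hFF hFFc Mu; apply: filterS3 => t [_]; rewrite mul1mx => e1 [_].
rewrite mul1mx => e2 Mu.
have e3 : (tF t)^t* *m (tTh t)^t* = (tOm t)^t* *m (tF t)^t*.
  by have := congr1 (fun M => M^t*) e1; rewrite !trCM.
set M := _ *m tFc t.
have e4 : M *m tOmc t = (tOm t)^t* *m M.
  by rewrite /M -mulmxA -e2 mulmxA e3 mulmxA.
split=> //; last by rewrite mulmxA mulmxV.
rewrite mulmxA e2 -!mulmxA; congr (_ *m _).
by apply: (can_inj (mulKmx Mu)); rewrite mulmxA e4 -mulmxA mulmxV // mulmx1 mulKVmx.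
Qed.

End BigO.

(** * Coordinates along the Jordan chains *)

Lemma sum_triangle_single (T : nmodType) m (F : nat -> nat -> T) k i :
  (1 <= i <= k)%N -> (k <= m)%N ->
  (forall k' i', (1 <= i' <= k')%N -> (k' <= m)%N -> (k' != k) || (i' != i) ->
     F k' i' = 0) ->
  \sum_(1 <= k' < m.+1) \sum_(1 <= i' < k'.+1) F k' i' = F k i.
Proof.
move=> ik km F0.
rewrite (bigD1_seq k) ?iota_uniq ?mem_index_iota //=; last by lia.
rewrite (bigD1_seq i) ?iota_uniq ?mem_index_iota //=.
rewrite !big1_seq ?addr0 // => [k'|i'].
  rewrite mem_index_iota => /andP[k'k k'r]; apply: big1_seq => i'.
  by rewrite mem_index_iota => /= i'r; rewrite F0 ?k'k //; lia.
by rewrite mem_index_iota => /andP[i'i i'r]; rewrite F0 ?i'i ?orbT //; lia.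
Qed.

Section JordanFamily.
Variable R : realType.
Local Notation K := R[i].
Variables (m n : nat) (s : nat -> nat).
Variables (V : forall j i : nat, 'M[K]_(n, s j)) (A : forall j i : nat, 'M[K]_(s j, n)).
Local Notation inr k i := ((1 <= i <= k)%N && (k <= m)%N).

Definition biorthogonal :=
  (forall k i i', inr k i -> inr k i' -> A k i *m V k i' = (i == i')%:R%:M) /\
  (forall k k' i i', inr k i -> inr k' i' -> k != k' -> A k i *m V k' i' = 0).

(** When [A] is built from the chains of the conjugate eigenvalue, the range of this projector
    contains those chains as well as U_C. *)
Definition coordproj : 'M[K]_n :=
  1%:M - \sum_(1 <= k < m.+1) \sum_(1 <= i < k.+1) V k i *m A k i.

(* The operator z^(f k i) on the range of V k i, and z^g on the complement. *)
Definition scaling (f : nat -> nat -> nat) (g : nat) (z : R) : 'M[K]_n :=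
  \sum_(1 <= k < m.+1) \sum_(1 <= i < k.+1) (z ^+ f k i)%:C *: (V k i *m A k i)
  + (z ^+ g)%:C *: coordproj.

(* For A dual to V, these select the last, respectively first, coordinate of each chain
   of length at least k; EA k plays the role of (E_k^(c))^* Delta. *)
Definition EA k : 'M[K]_(\sum_(i < m.+1 - k) s (k + i)%N, n) :=
  \mxcol_(i < m.+1 - k) A (k + i)%N (k + i)%N.

Definition EA1 k : 'M[K]_(\sum_(i < m.+1 - k) s (k + i)%N, n) :=
  \mxcol_(i < m.+1 - k) A (k + i)%N 1%N.

Hypothesis VA : biorthogonal.

Lemma coord_sum (F : nat -> nat -> K) k i : inr k i ->
  A k i *m (\sum_(1 <= k < m.+1) \sum_(1 <= i < k.+1) F k i *: (V k i *m A k i))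
  = F k i *: A k i.
Proof.
move=> /andP[ik km]; case: VA => VA1 VA2.
rewrite mulmx_sumr.
under eq_bigr do rewrite mulmx_sumr.
rewrite (sum_triangle_single ik km) /=.
  by rewrite -scalemxAr mulmxA VA1 ?ik ?km // eqxx mul1mx.
move=> k' i' ik' km' ne; rewrite -scalemxAr mulmxA.
have [e|ne'] := eqVneq k' k.
  subst k'; move: ne; rewrite eqxx /= => ne.
  by rewrite VA1 ?ik ?km ?ik' // eq_sym (negbTE ne) mul_scalar_mx scale0r scaler0.
by rewrite VA2 ?ik ?km ?ik' ?km' 1?eq_sym // mul0mx scaler0.
Qed.

Lemma sum_coord (F : nat -> nat -> K) k i : inr k i ->
  (\sum_(1 <= k < m.+1) \sum_(1 <= i < k.+1) F k i *: (V k i *m A k i)) *m V k i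
  = F k i *: V k i.
Proof.
move=> /andP[ik km]; case: VA => VA1 VA2.
rewrite mulmx_suml.
under eq_bigr do rewrite mulmx_suml.
rewrite (sum_triangle_single ik km) /=.
  by rewrite -scalemxAl -mulmxA VA1 ?ik ?km // eqxx mulmx1.
move=> k' i' ik' km' ne; rewrite -scalemxAl -mulmxA.
have [e|ne'] := eqVneq k' k.
  subst k'; move: ne; rewrite eqxx /= => ne.
  by rewrite VA1 ?ik ?km ?ik' // (negbTE ne) mul_mx_scalar scale0r scaler0.
by rewrite VA2 ?ik ?km ?ik' ?km' // mulmx0 scaler0.
Qed.

Lemma sum_scale1 : \sum_(1 <= k < m.+1) \sum_(1 <= i < k.+1) V k i *m A k i
  = \sum_(1 <= k < m.+1) \sum_(1 <= i < k.+1) 1 *: (V k i *m A k i).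
Proof. by apply: eq_bigr => k _; apply: eq_bigr => i _; rewrite scale1r. Qed.

Lemma coord_proj k i : inr k i -> A k i *m coordproj = 0.
Proof.
by move=> r; rewrite mulmxBr mulmx1 sum_scale1 (coord_sum (fun _ _ => 1)) // scale1r subrr.
Qed.

Lemma proj_coord k i : inr k i -> coordproj *m V k i = 0.
Proof.
by move=> r; rewrite mulmxBl mul1mx sum_scale1 (sum_coord (fun _ _ => 1)) // scale1r subrr.
Qed.

Lemma proj_sum (F : nat -> nat -> K) :
  coordproj *m (\sum_(1 <= k < m.+1) \sum_(1 <= i < k.+1) F k i *: (V k i *m A k i)) = 0.
Proof.
rewrite mulmx_sumr big_nat big1 // => k kr; rewrite mulmx_sumr big_nat big1 // => i ir.
by rewrite -scalemxAr mulmxA proj_coord ?mul0mx ?scaler0 //; lia.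
Qed.

Lemma proj_idem : coordproj *m coordproj = coordproj.
Proof. by rewrite {2}/coordproj mulmxBr mulmx1 sum_scale1 proj_sum subr0. Qed.

(** Operator identities below are verified row by row through this decomposition instead of by
    manipulating double sums. *)
Lemma coord_ext b (X Y : 'M[K]_(n, b)) :
  (forall k i, inr k i -> A k i *m X = A k i *m Y) ->
  coordproj *m X = coordproj *m Y -> X = Y.
Proof.
move=> h hp; have e (Z : 'M[K]_(n, b)) :
    Z = \sum_(1 <= k < m.+1) \sum_(1 <= i < k.+1) V k i *m (A k i *m Z) + coordproj *m Z.
  rewrite mulmxBl mul1mx mulmx_suml.
  under [X in _ + (_ - X)]eq_bigr do rewrite mulmx_suml.
  under [X in _ + (_ - X)]eq_bigr do under eq_bigr do rewrite -mulmxA.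
  by rewrite addrC subrK.
rewrite [X]e [Y]e hp; congr (_ + _); apply: eq_big_nat => k kr.
by apply: eq_big_nat => i ir; rewrite h //; lia.
Qed.

Lemma coord_scaling f g z k i : inr k i ->
  A k i *m scaling f g z = (z ^+ f k i)%:C *: A k i.
Proof.
move=> r; rewrite mulmxDr (coord_sum (fun k i => (z ^+ f k i)%:C)) //.
by rewrite -scalemxAr coord_proj // scaler0 addr0.
Qed.

Lemma proj_scaling f g z : coordproj *m scaling f g z = (z ^+ g)%:C *: coordproj.
Proof.
by rewrite mulmxDr (proj_sum (fun k i => (z ^+ f k i)%:C)) add0r -scalemxAr proj_idem.
Qed.

Lemma scaling_mul f g f' g' z : scaling f g z *m scaling f' g' z
  = scaling (fun k i => f k i + f' k i)%N (g + g')%N z.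
Proof.
apply: coord_ext => [k i r|]; rewrite mulmxA ?coord_scaling ?proj_scaling //.
  by rewrite -scalemxAl coord_scaling // scalerA exprD rmorphM.
by rewrite -scalemxAl proj_scaling // scalerA exprD rmorphM.
Qed.

Lemma scaling_const c z : scaling (fun _ _ => c) c z = (z ^+ c)%:C%:M.
Proof.
apply: coord_ext => [k i r|]; rewrite ?coord_scaling ?proj_scaling //.
  by rewrite mul_mx_scalar.
by rewrite mul_mx_scalar.
Qed.

Lemma eq_scaling f g f' g' z :
  (forall k i, inr k i -> f k i = f' k i) -> g = g' -> scaling f g z = scaling f' g' z.
Proof.
move=> e ->; apply: coord_ext => [k i r|]; last by rewrite !proj_scaling.
by rewrite !coord_scaling // e.
Qed.

Lemma E_coord b k (w : forall j, 'M[K]_(s j, b)) :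
  E m V k *m \mxcol_(i < m.+1 - k) w (k + i)%N
  = \sum_(k <= j < m.+1) V j 1%N *m w j.
Proof.
rewrite mul_mxrow_mxcol -[in RHS](add0n k) big_addn big_mkord.
by apply: eq_bigr => i _; rewrite addnC.
Qed.

Lemma EA1_mul b k (y : 'M[K]_(n, b)) : EA1 k *m y = \mxcol_(i < m.+1 - k) (A (k + i)%N 1%N *m y).
Proof. by rewrite mxcol_mul. Qed.

Lemma EA_mul b k (y : 'M[K]_(n, b)) :
  EA k *m y = \mxcol_(i < m.+1 - k) (A (k + i)%N (k + i)%N *m y).
Proof. by rewrite mxcol_mul. Qed.

Lemma E_EA1 b k (y : 'M[K]_(n, b)) :
  E m V k *m (EA1 k *m y) = \sum_(k <= j < m.+1) V j 1%N *m (A j 1%N *m y).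
Proof. by rewrite EA1_mul (E_coord k (fun j => A j 1%N *m y)). Qed.

Lemma EA1_eq0 b k (y : 'M[K]_(n, b)) :
  (EA1 k *m y = 0) <-> (forall j, (k <= j <= m)%N -> A j 1%N *m y = 0).
Proof.
rewrite EA1_mul; split=> [h j /andP[kj jm]|h].
  have jk : (j - k < m.+1 - k)%N by lia.
  have := congr1 (fun M => submxcol M (Ordinal jk)) h.
  by rewrite /= mxcolK submxcol0 /= subnKC.
rewrite -[RHS]submxcolK; apply/eq_mxcolP => i.
by rewrite submxcol0 h //; have := ltn_ord i; lia.
Qed.

Lemma EA_eq0 b k (y : 'M[K]_(n, b)) :
  (forall j, (k <= j <= m)%N -> A j j *m y = 0) -> EA k *m y = 0.
Proof.
move=> h; rewrite EA_mul -[RHS]submxcolK; apply/eq_mxcolP => i.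
by rewrite submxcol0 h //; have := ltn_ord i; lia.
Qed.

Lemma EA1_E k : (0 < k)%N -> EA1 k *m E m V k = 1%:M.
Proof.
move=> k0; rewrite /EA1 /E mul_mxcol_mxrow -[RHS]submxblockK; apply/eq_mxblockP => i j.
case: VA => VA1 VA2; have := ltn_ord i; have := ltn_ord j => hj hi.
have -> : 1%:M = \mxdiag_(i < m.+1 - k) (1%:M : 'M[K]_(s (k + i)%N)) by rewrite mxdiagZ.
rewrite mxblockK; case: eqVneq => [e|ne].
  by subst j; rewrite conform_mx_id VA1 ?eqxx //; lia.
by rewrite VA2 //; [lia|lia|rewrite eqn_add2l; apply: contra ne => /eqP/val_inj->].
Qed.

End JordanFamily.

(** * The limit matrix Theta *)

Section ThetaBlocks.
Variable F : fieldType.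
Variables r d : nat.

Lemma submxblock_one (i j : 'I_r) :
  submxblock (1%:M : 'M[F]_(\sum_(i < r) d)) i j = (i == j)%:R%:M.
Proof.
rewrite -mxdiagZ mxblockK; case: (eqVneq i j) => [e|_]; last by rewrite raddf0.
by subst j; rewrite conform_mx_id.
Qed.

Lemma Theta_row (S : 'M[F]_d) (i j : 'I_r) : j = i.+1 :> nat ->
  submxcol (Theta r S) i = submxcol 1%:M j.
Proof.
move=> ji; rewrite -[LHS]submxrowK -[RHS]submxrowK; apply/eq_mxrowP => k.
rewrite -!submxblockEv mxblockK submxblock_one -(inj_eq val_inj) /= eq_sym ji.
case: eqVneq => // _; case: ifP => [/andP[/eqP e _]|_]; last by rewrite raddf0.
by have := ltn_ord j; rewrite ji e ltnn.
Qed.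

Lemma Theta_last (S : 'M[F]_d) (i j : 'I_r) : i.+1 = r -> j = 0%N :> nat ->
  submxcol (Theta r S) i = S *m submxcol 1%:M j.
Proof.
move=> ir j0; rewrite -[LHS]submxrowK -[submxcol 1%:M j]submxrowK mul_mxrow.
apply/eq_mxrowP => k; rewrite -!submxblockEv mxblockK submxblock_one.
rewrite ir eqxx (ltn_eqF (ltn_ord k)) -(inj_eq val_inj) /= j0 eq_sym.
by rewrite mul_mx_scalar; case: eqP => _; rewrite ?scale1r ?scale0r.
Qed.

Lemma mul_Theta_succ b (S : 'M[F]_d) (x : 'M[F]_(b, \sum_(i < r) d)) (i j : 'I_r) :
  j = i.+1 :> nat -> submxrow (x *m Theta r S) j = submxrow x i.
Proof.
move=> ji; rewrite -{1}[x]submxrowK /Theta mul_mxrow_mxblock mxrowK.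
rewrite (bigD1 i) //= ji eqxx mulmx1 big1 ?addr0 //.
move=> k ki; rewrite eqSS eq_sym (inj_eq val_inj) (negbTE ki) andbF.
by rewrite mulmx0.
Qed.

Lemma mul_Theta_first b (S : 'M[F]_d) (x : 'M[F]_(b, \sum_(i < r) d)) (i j : 'I_r) :
  i.+1 = r -> j = 0%N :> nat -> submxrow (x *m Theta r S) j = submxrow x i *m S.
Proof.
move=> ir j0; rewrite -{1}[x]submxrowK /Theta mul_mxrow_mxblock mxrowK.
have r0 : (0 == r)%N = false by rewrite -ir.
rewrite (bigD1 i) //= ir j0 eqxx r0 /= big1 ?addr0 // => k ki.
case: eqP => [e|_]; last by rewrite mulmx0.
by move: ki; rewrite -(inj_eq val_inj) /=; have := e; lia.
Qed.

(** Right multiplication by Theta moves block column i to i + 1 and returns the last one to the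
    front multiplied by S. *)
Lemma Theta_mul_eq0 b (S : 'M[F]_d) (x : 'M[F]_(b, \sum_(i < r) d)) :
  S \in unitmx -> x *m Theta r S = 0 -> x = 0.
Proof.
move=> Su h; rewrite -[x]submxrowK -[RHS]submxrowK; apply/eq_mxrowP => i.
rewrite submxrow0; have [ir|ir] := eqVneq i.+1 r.
  have r0 : (0 < r)%N by rewrite -ir.
  have := mul_Theta_first S x ir (erefl : Ordinal r0 = 0%N :> nat).
  rewrite h submxrow0 => /esym /(congr1 (mulmx^~ (invmx S))).
  by rewrite mulmxK // mul0mx.
have ir' : (i.+1 < r)%N by rewrite ltn_neqAle ir ltn_ord.
by rewrite -(mul_Theta_succ S x (erefl : Ordinal ir' = i.+1 :> nat)) h submxrow0.
Qed.

Lemma row_at_one a (i : 'I_r) (M : 'M[F]_(a, d)) :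
  row_at r i.+1 M = M *m submxcol 1%:M i.
Proof.
rewrite /row_at -[submxcol 1%:M i]submxrowK mul_mxrow; apply: eq_mxrow => j.
rewrite -submxblockEv submxblock_one eqSS -(inj_eq val_inj) /= eq_sym mul_mx_scalar.
by case: eqP => _; rewrite ?scale1r ?scale0r.
Qed.

End ThetaBlocks.

(* The coordinate along V k i of the solution has order z^(alpha rho k i); this is the
   vector delta_k of the statement, except that for k > rho the first entry is O(1)
   (it carries G_rho) until its limit has been subtracted. *)
Definition alpha (rho k i : nat) := minn (i.-1 + (rho - k)) rho.

Lemma sub_addl (T : zmodType) (a b c : T) : (a + b) - (a + c) = b - c.
Proof. by rewrite opprD addrACA subrr add0r. Qed.

Lemma shifted_eigen (F : pzRingType) n b (C D : 'M[F]_n) (x : F) (Y T : 'M[F]_(n, b)) :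
  (C - x%:M + D) *m Y = T -> (C + D) *m Y = x *: Y + T.
Proof. by move=> <-; rewrite addrAC mulmxBl mul_scalar_mx [RHS]addrC subrK. Qed.

(** * The scaled pencil and its limit at z = 0 *)

Section InvariantFamily.
Variable R : realType.
Local Notation K := R[i].
Variables (m n : nat) (s : nat -> nat).
Variables (V : forall j i : nat, 'M[K]_(n, s j)) (A : forall j i : nat, 'M[K]_(s j, n)).
Variables (C D : 'M[K]_n) (lambda : K) (rho : nat).
Local Notation inr k i := ((1 <= i <= k)%N && (k <= m)%N).

Hypothesis rho_m : (1 <= rho <= m)%N.
Hypothesis VA : biorthogonal m V A.
Hypothesis CV1 : forall k, (1 <= k <= m)%N -> C *m V k 1%N = lambda *: V k 1%N.
Hypothesis CVS : forall k i, inr k i -> inr k i.+1 ->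
  C *m V k i.+1 = lambda *: V k i.+1 + V k i.
Hypothesis AC : forall k i, inr k i ->
  A k i *m C = lambda *: A k i + (if (i < k)%N then A k i.+1 else 0).
Hypothesis kerC : forall b (y : 'M[K]_(n, b)), C *m y = lambda *: y ->
  (forall k i, inr k i -> A k i *m y = 0) -> y = 0.

Local Notation proj := (coordproj m V A).
Local Notation Sc := (scaling m V A).
Local Notation EA := (EA m A).
Local Notation EA1 := (EA1 m A).
Local Notation E := (E m V).
Local Notation al := (alpha rho).

(** Row weights: row (k,i) of N reads coordinate i + 1, of weight alpha + 1 up to the cap. The cap
    leaves a nonnegative power rho - beta for the D-term, and [gamma] is 1 where the cap loses a
    factor z. *)
Let beta k i := minn (al k i).+1 rho.
Let gamma k i := (rho <= al k i)%N : nat.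
Let N := C - lambda%:M.

(** Written with the abstract dual family [A], so that exchanging the roles of V and Vc yields the
    adjoint of W_k and the matrix G_rho^(c) from the same formulas. *)
Definition Wn k := EA k *m D *m E k.
Definition Gn := - invmx (Wn rho.+1) *m EA rho.+1 *m D *m V rho 1%N.
Definition Sn := A rho rho *m D *m (V rho 1%N + E rho.+1 *m Gn).

Let Sa z := Sc al rho z.
Let Sb z := Sc beta rho z.
Let Qz z := Sc gamma 1 z.
Let Sr z := Sc (fun k i => rho - beta k i)%N 0 z.
Let Pz z := N + Sr z *m D *m Sa z.

Lemma coord_N k i : inr k i ->
  A k i *m N = if (i < k)%N then A k i.+1 else 0.
Proof. by move=> r; rewrite mulmxBr AC // mul_mx_scalar addrAC subrr add0r. Qed.

Lemma proj_N_V k i : inr k i -> proj *m N *m V k i = 0.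
Proof.
move=> r; rewrite -mulmxA (mulmxBl C) mul_scalar_mx.
case: i r => [|[|i]] r; first by lia.
  by rewrite CV1 ?subrr ?mulmx0 //; lia.
rewrite CVS //; last by lia.
by rewrite addrAC subrr add0r proj_coord //; lia.
Qed.

Lemma proj_N : proj *m N = N *m proj.
Proof.
have e : proj *m N *m proj = proj *m N.
  rewrite {2}/coordproj mulmxBr mulmx1 mulmx_sumr big_nat big1 ?subr0 // => k kr.
  rewrite mulmx_sumr big_nat big1 // => i ir.
  by rewrite mulmxA proj_N_V ?mul0mx //; lia.
apply: (@coord_ext R m n s V A) => [k i r|]; last by rewrite !mulmxA proj_idem // -e.
rewrite !mulmxA coord_proj // mul0mx coord_N //.
by case: ifP => h; rewrite ?mul0mx // coord_proj //; lia.
Qed.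

Lemma N_scaling z : N *m Sa z = Sb z *m N.
Proof.
apply: (@coord_ext R m n s V A) => [k i r|]; last first.
  rewrite mulmxA proj_N -mulmxA proj_scaling // mulmxA proj_scaling //.
  by rewrite -scalemxAr -proj_N scalemxAl.
rewrite !mulmxA coord_N // coord_scaling // -scalemxAl coord_N //.
case: ifP => h; last by rewrite mul0mx scaler0.
rewrite coord_scaling //; last by lia.
by congr (_%:C *: _); congr (_ ^+ _); rewrite /beta /alpha; lia.
Qed.

(** Together with [scaled_shift], this exhibits [Sb z] as a left factor of both sides of the shifted
    equation: a solution of Pz x = Qz x Th solves that equation after multiplication by [Sb z]. *)
Lemma scaled_pencil z : (N + (z ^+ rho)%:C *: D) *m Sa z = Sb z *m Pz z.
Proof.
rewrite (mulmxDl N) (mulmxDr (Sb z) N) N_scaling; congr (_ + _).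
rewrite !mulmxA (scaling_mul VA).
rewrite (@eq_scaling _ _ _ _ _ _ VA _ _ (fun _ _ => rho) rho) ?addn0 //.
  by rewrite scaling_const // mul_scalar_mx.
by move=> k i r; rewrite /beta /alpha; lia.
Qed.

Lemma scaled_shift z : z%:C *: Sa z = Sb z *m Qz z.
Proof.
rewrite (scaling_mul VA) -mul_scalar_mx -[z in z%:C]expr1.
rewrite -(scaling_const VA 1) (scaling_mul VA).
apply: (eq_scaling VA) => [k i r|]; last by rewrite addnC.
by rewrite /beta /gamma /alpha; lia.
Qed.

(** Weight zero occurs only at i = 1 with k >= rho. *)
Let Sa0E : Sa 0 = \sum_(rho <= k < m.+1) V k 1%N *m A k 1%N.
Proof.
rewrite /Sa /scaling.
have -> : ((0 : R) ^+ rho)%:C = 0 by rewrite expr0n; case: rho rho_m.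
rewrite scale0r addr0 (@big_cat_nat _ _ _ rho) /=; [|lia|lia].
rewrite big_nat big1 ?add0r; last first.
  move=> k kr; rewrite big_nat big1 // => i ir.
  have : (0 < al k i)%N by rewrite /alpha; lia.
  by case: (al k i) => // a _; rewrite expr0n scale0r.
apply: eq_big_nat => k kr; rewrite big_ltn; last by lia.
have -> : al k 1 = 0%N by rewrite /alpha; lia.
rewrite expr0 scale1r big_nat big1 ?addr0 // => i ir.
have : (0 < al k i)%N by rewrite /alpha; lia.
by case: (al k i) => // a _; rewrite expr0n scale0r.
Qed.

Let Sa0_mul b (y : 'M[K]_(n, b)) :
  Sa 0 *m y = V rho 1%N *m (A rho 1%N *m y) + E rho.+1 *m (EA1 rho.+1 *m y).
Proof.
rewrite Sa0E big_ltn; last by lia.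
rewrite mulmxDl -mulmxA E_EA1 mulmx_suml; congr (_ + _).
by apply: eq_bigr => k _; rewrite mulmxA.
Qed.

(** beta = rho happens at the end of a chain with k <= rho and at i >= rho on a longer one. By
    [coord_Q0], the right side of the limit equation is lost on chain rows exactly for i > rho. *)
Let coord_P0 k i : inr k i -> A k i *m Pz 0 =
  (if (i < k)%N then A k i.+1 else 0)
  + (if beta k i == rho then A k i *m D *m Sa 0 else 0).
Proof.
move=> r; rewrite (mulmxDr (A k i) N) coord_N // !mulmxA coord_scaling //; congr (_ + _).
rewrite -!scalemxAl expr0n; case: (eqVneq (beta k i) rho) => [->|ne].
  by rewrite subnn scale1r.
have -> : (rho - beta k i == 0)%N = false by move: ne; rewrite /beta; lia.
by rewrite scale0r.
Qed.

Let coord_Q0 k i : inr k i -> A k i *m Qz 0 = if (al k i < rho)%N then A k i else 0.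
Proof.
move=> r; rewrite coord_scaling // /gamma expr0n leqNgt.
by case: ltnP => _; rewrite ?scale1r ?scale0r.
Qed.

Let proj_Q0 : proj *m Qz 0 = 0.
Proof. by rewrite proj_scaling // expr1 scale0r. Qed.

Let proj_P0 b (h : 'M[K]_(n, b)) : Sa 0 *m h = 0 -> proj *m Pz 0 *m h = proj *m N *m h.
Proof.
by move=> Sh; rewrite (mulmxDr proj N) (mulmxDl (proj *m N)) -!mulmxA Sh !mulmx0 addr0.
Qed.

Hypothesis W1 : Wn rho.+1 \in unitmx.
Hypothesis W0 : Wn rho \in unitmx.

Lemma Sn_unit : Sn \in unitmx.
Proof.
(* Transposing turns the left kernel vector of [inj_row_free] into a right one. *)
rewrite -unitmx_tr -row_free_unit; apply: inj_row_free => v0 hv.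
pose v := v0^T; suff : v = 0 by move=> /(congr1 trmx); rewrite trmxK trmx0.
have {hv} : Sn *m v = 0 by apply: trmx_inj; rewrite trmx_mul trmxK trmx0.
move: v => v Sv; pose y := (V rho 1%N + E rho.+1 *m Gn) *m v.
have y1 : A rho 1%N *m y = v.
  case: VA => VA1 VA2.
  rewrite /y mulmxA mulmxDr VA1 ?eqxx; [|lia|lia].
  suff -> : A rho 1%N *m (E rho.+1 *m Gn) = 0 by rewrite addr0 mul1mx.
  rewrite mulmxA /Defs.E mul_mxrow -[RHS](mul0mx _ Gn); congr (_ *m _).
  rewrite -[RHS]submxrowK; apply: eq_mxrow => i.
  by rewrite submxrow0 VA2 //; have := ltn_ord i; lia.
have y2 : EA1 rho.+1 *m y = Gn *m v.
  rewrite /y (mulmxA (EA1 rho.+1)) (mulmxDr (EA1 rho.+1)).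
  rewrite (mulmxA (EA1 rho.+1) (E rho.+1)) EA1_E // (mul1mx Gn).
  suff -> : EA1 rho.+1 *m V rho 1%N = 0 by rewrite add0r.
  apply/(EA1_eq0 m A) => j jr; case: VA => _ VA2.
  by rewrite VA2 //; lia.
have yS : y = Sa 0 *m y.
  by rewrite Sa0_mul y1 y2 /y mulmxDl -(mulmxA _ Gn).
have yE : y = E rho *m (EA1 rho *m y).
  by rewrite E_EA1 {1}yS Sa0E mulmx_suml; apply: eq_bigr => k _; rewrite mulmxA.
have Wy : Wn rho *m (EA1 rho *m y) = 0.
  rewrite /Wn -mulmxA -yE -mulmxA; apply: EA_eq0 => j jr.
  have [e|ne] := eqVneq j rho.
    by subst j; move: Sv; rewrite /Sn -2!mulmxA.
  (* [EA] is [EA1] for the family that ignores its second index, so the componentwise criterion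
     applies to it. *)
  have := (EA1_eq0 m (fun j i => A j j) rho.+1 (D *m y)).1.
  apply; last by lia.
  change (EA rho.+1 *m (D *m y) = 0).
  rewrite /y (mulmxA D) (mulmxA (EA rho.+1)) (mulmxDr D) (mulmxDr (EA rho.+1)).
  rewrite /Gn !mulNmx !mulmxN !mulmxA.
  rewrite -/(Wn rho.+1) mulmxV // mul1mx subrr mul0mx //.
have : EA1 rho *m y = 0.
  by rewrite -[LHS](mulKmx W0) Wy mulmx0.
by move=> /(EA1_eq0 m A) /(_ rho); rewrite y1; apply; lia.
Qed.

(** The normalizing functional Pi of the pencil argument; [Pirho_Q] below supplies Pi Q = Pi. *)
Definition Pirho : 'M[K]_(\sum_(i < rho) s rho, n) := \mxcol_(i < rho) A rho i.+1.

Lemma Pirho_eq0 b (h : 'M[K]_(n, b)) : Pirho *m h = 0 ->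
  forall i, (1 <= i <= rho)%N -> A rho i *m h = 0.
Proof.
move=> h0 [//|i] ir; have ilt : (i < rho)%N by lia.
have := congr1 (fun M => submxcol M (Ordinal ilt)) h0.
by rewrite /= /Pirho -submxcol_mul mxcolK submxcol0.
Qed.

Lemma Pirho_V : Pirho *m blockrow V rho = 1%:M.
Proof.
rewrite /Pirho /blockrow mul_mxcol_mxrow -[RHS]submxblockK.
apply: eq_mxblock => i j; rewrite submxblock_one; case: VA => VA1 _.
have := ltn_ord i; have := ltn_ord j => hj hi.
by rewrite VA1; [rewrite eqSS|lia|lia].
Qed.

Lemma V_coord b (u : 'M[K]_(_, b)) k i : inr k i -> k != rho ->
  A k i *m (blockrow V rho *m u) = 0.
Proof.
move=> r kr; rewrite mulmxA /blockrow mul_mxrow -[RHS](mul0mx _ u); congr (_ *m _).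
rewrite -[RHS]submxrowK; apply: eq_mxrow => j; rewrite submxrow0.
by case: VA => _ VA2; rewrite VA2 //; have := ltn_ord j; lia.
Qed.

Lemma proj_blockrow b (u : 'M[K]_(_, b)) : proj *m (blockrow V rho *m u) = 0.
Proof.
rewrite mulmxA /blockrow mul_mxrow -[RHS](mul0mx _ u); congr (_ *m _).
rewrite -[RHS]submxrowK; apply: eq_mxrow => j; rewrite submxrow0.
by rewrite proj_coord //; have := ltn_ord j; lia.
Qed.

Local Notation Th := (Theta rho Sn).
Local Notation b := (\sum_(i < rho) s rho)%N.

(* The last rows of the chains k > rho force the leading coordinates to vanish; the
   D-terms then disappear and the rest follows up or down each chain. *)
Lemma chain_eq0 (h x0 : 'M[K]_(n, b)) (Psi : 'M[K]_b) :
  Pirho *m h = 0 -> Psi = 0 \/ Psi = Pirho *m Pz 0 *m h ->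
  (forall k i, inr k i -> k != rho ->
     A k i *m Pz 0 *m h = A k i *m Qz 0 *m (h *m Th + x0 *m Psi)) ->
  proj *m Pz 0 *m h = 0 -> h = 0.
Proof.
move=> Pih hPsi rows prow; have Arho := Pirho_eq0 Pih.
have top : EA1 rho.+1 *m h = 0.
  rewrite -[LHS](mulKmx W1).
  suff -> : Wn rho.+1 *m (EA1 rho.+1 *m h) = 0 by rewrite mulmx0.
  rewrite /Wn -!mulmxA; apply: EA_eq0 => j jr.
  have := rows j j; rewrite coord_P0 ?coord_Q0; [|lia|lia].
  rewrite ltnn add0r.
  have -> : beta j j == rho by rewrite /beta /alpha; lia.
  have -> : (al j j < rho)%N = false by rewrite /alpha; lia.
  rewrite mul0mx -!mulmxA Sa0_mul Arho ?mulmx0 ?add0r; last by lia.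
  by apply; lia.
have Sh : Sa 0 *m h = 0 by rewrite Sa0_mul top Arho ?mulmx0 ?addr0 //; lia.
have coordP k i : inr k i -> A k i *m Pz 0 *m h = if (i < k)%N then A k i.+1 *m h else 0.
  move=> r; rewrite coord_P0 // mulmxDl.
  rewrite [X in _ + X](_ : _ = 0) ?addr0; last first.
    by case: ifP => _; rewrite ?mul0mx // -!mulmxA Sh !mulmx0.
  by case: ifP => _; rewrite ?mul0mx.
(* With the D-terms gone, the rows of [Pirho *m Pz 0 *m h] are coordinates of h along V_rho or
   zero. *)
have Psi0 : Psi = 0.
  case: hPsi => // ->; rewrite -[RHS]submxcolK /Pirho !mxcol_mul.
  apply: eq_mxcol => i; rewrite submxcol0 coordP; last by have := ltn_ord i; lia.
  by case: ifP => // ir; rewrite Arho //; lia.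
have {}rows k i : inr k i -> k != rho ->
    (if (i < k)%N then A k i.+1 *m h else 0) =
    (if (al k i < rho)%N then A k i *m h *m Th else 0).
  move=> r kr; have := rows k i r kr; rewrite coordP // Psi0 mulmx0 addr0 => ->.
  by rewrite coord_Q0 //; case: ifP => _; rewrite ?mul0mx // mulmxA.
have topj j : (rho <= j <= m)%N -> A j 1%N *m h = 0.
  move=> jr; have [->|ne] := eqVneq j rho; first by rewrite Arho //; lia.
  by apply: ((EA1_eq0 m A rho.+1 h).1 top); lia.
apply: (@coord_ext R m n s V A) => [k i r|].
  rewrite mulmx0; have [kr|kr] := leqP rho k.
    have [e|ne] := eqVneq k rho; first by subst k; rewrite Arho //; lia.
    elim: i r => [|[|i] IH] r; first by lia.
      by rewrite topj //; lia.
    have := rows k i.+1; rewrite IH; [|lia].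
    have -> : (i.+1 < k)%N by lia.
    by rewrite mul0mx => ->; [case: ifP|lia|].
  (* On a chain shorter than rho the recursion runs from the last coordinate back to the first and
     cancels Theta at each step. *)
  have kne : k != rho by lia.
  have [d di] : exists d, d = (k - i)%N by eexists.
  elim: d i di r => [|d IH] i di r.
    have ik : i = k by lia.
    subst i; have := rows k k r kne; rewrite ltnn.
    have -> : (al k k < rho)%N by rewrite /alpha; lia.
    by move=> /esym /(Theta_mul_eq0 Sn_unit).
  have ik : (i < k)%N by lia.
  have := rows k i r kne; rewrite ik.
  have -> : (al k i < rho)%N by rewrite /alpha; lia.
  rewrite IH; [|lia|lia].
  by move=> /esym /(Theta_mul_eq0 Sn_unit).
rewrite mulmx0; apply: kerC => [|k i r]; last by rewrite mulmxA coord_proj // mul0mx.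
move: prow; rewrite proj_P0 // proj_N -mulmxA (mulmxBl C) mul_scalar_mx => /eqP.
by rewrite subr_eq0 => /eqP.
Qed.

Lemma Pirho_Q z : Pirho *m Qz z = Pirho.
Proof.
rewrite /Pirho mxcol_mul; apply: eq_mxcol => i; have := ltn_ord i => hi.
rewrite coord_scaling //; last by lia.
have -> : gamma rho i.+1 = 0%N by rewrite /gamma /alpha; lia.
by rewrite expr0 scale1r.
Qed.

(** The equation is imposed off the rho-rows only, with Pi x0 = 1 in their place (the operator [T]).
    This square system is injective by [chain_eq0]; the omitted rows then hold by the companion form
    of Theta and the definition of S_rho. *)
Lemma limit_solution : exists x0 : 'M[K]_(n, b),
  [/\ Pirho *m x0 = 1%:M, EA1 rho.+1 *m x0 = Gn *m (A rho 1%N *m x0) &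
      Pz 0 *m x0 = Qz 0 *m x0 *m Th].
Proof.
pose u (y : 'M[K]_(n, b)) := Pz 0 *m y - Qz 0 *m y *m Th.
pose T y := u y - blockrow V rho *m (Pirho *m u y) + blockrow V rho *m (Pirho *m y).
have mulL c d e (B : 'M[K]_(c, d)) : linear (fun h : 'M[K]_(d, e) => B *m h).
  by move=> k x y; rewrite linearP.
have uL : linear u.
  exact: (linear_fun_sub (mulL _ _ _ (Pz 0)) (linear_fun_mul (Qz 0) Th)).
have TL : linear T.
  apply: linear_fun_add => [|k x y]; last by rewrite !linearP.
  apply: linear_fun_sub => // k x y; rewrite uL.
  by move: (u x) (u y) => ? ?; rewrite !linearP.
have PiT y : Pirho *m T y = Pirho *m y.
  rewrite /T; move: (u y) => w.
  by rewrite mulmxDr mulmxBr !(mulmxA _ (blockrow V rho)) Pirho_V !mul1mx subrr add0r.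
have Trows y : T y = blockrow V rho *m (Pirho *m y) ->
    u y = blockrow V rho *m (Pirho *m u y).
  by rewrite /T -[RHS]add0r => /addIr /eqP; rewrite subr_eq0 => /eqP.
have urow y k i : T y = blockrow V rho *m (Pirho *m y) -> inr k i -> k != rho ->
    A k i *m Pz 0 *m y = A k i *m Qz 0 *m (y *m Th).
  move=> /Trows hy r kr; apply/eqP; rewrite -subr_eq0 -!mulmxA -mulmxBr.
  by rewrite (mulmxA (Qz 0)) -/(u y) hy V_coord.
have uproj y : T y = blockrow V rho *m (Pirho *m y) -> proj *m Pz 0 *m y = 0.
  move=> /Trows hy.
  have : proj *m u y = 0 by rewrite hy proj_blockrow.
  by rewrite /u mulmxBr !mulmxA proj_Q0 !mul0mx subr0.
have Tinj y : T y = 0 -> y = 0.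
  move=> Ty; have Piy : Pirho *m y = 0 by rewrite -PiT Ty mulmx0.
  have Ty' : T y = blockrow V rho *m (Pirho *m y) by rewrite Ty Piy mulmx0.
  apply: (@chain_eq0 y 0 0 Piy) => [|k i r kr|]; [by left| |exact: uproj].
  by rewrite mulmx0 addr0 urow.
have [x0 Tx0] := linear_surjective TL Tinj (blockrow V rho).
have Pix0 : Pirho *m x0 = 1%:M by rewrite -PiT Tx0 Pirho_V.
have Tx0' : T x0 = blockrow V rho *m (Pirho *m x0) by rewrite Pix0 mulmx1.
(* In the last rows of the chains j > rho only the D-term is left, so it vanishes; solving with
   W_(rho+1) produces G_rho. *)
have Gx0 : EA1 rho.+1 *m x0 = Gn *m (A rho 1%N *m x0).
  have e : EA rho.+1 *m (D *m (Sa 0 *m x0)) = 0.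
    apply: EA_eq0 => j jr; have jm : inr j j by lia.
    have := urow x0 j j Tx0' jm; rewrite coord_P0 // coord_Q0 // ltnn add0r.
    have -> : beta j j == rho by rewrite /beta /alpha; lia.
    have -> : (al j j < rho)%N = false by rewrite /alpha; lia.
    by rewrite mul0mx -!mulmxA => -> //; lia.
  move: e; rewrite Sa0_mul !mulmxDr => /eqP; rewrite addrC addr_eq0 => /eqP e.
  apply: (can_inj (mulKmx W1)).
  have -> : Wn rho.+1 *m (EA1 rho.+1 *m x0) = EA rho.+1 *m (D *m (E rho.+1 *m (EA1 rho.+1 *m x0))).
    by rewrite /Wn -!mulmxA.
  rewrite e /Gn !mulNmx mulmxN; congr (- _).
  have -> : invmx (Wn rho.+1) *m EA rho.+1 *m D *m V rho 1 *m (A rho 1 *m x0)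
     = invmx (Wn rho.+1) *m (EA rho.+1 *m (D *m (V rho 1 *m (A rho 1 *m x0)))).
    by rewrite -!mulmxA.
  by rewrite mulKVmx.
exists x0; split=> //.
have xcol (i : 'I_rho) : A rho i.+1 *m x0 = submxcol 1%:M i.
  by rewrite -Pix0 -submxcol_mul /Pirho mxcolK.
apply: (@coord_ext R m n s V A) => [k i r|]; last first.
  by rewrite !mulmxA uproj // proj_Q0 !mul0mx.
have [e|kr] := eqVneq k rho; last by rewrite !mulmxA urow // !mulmxA.
subst k; case: i r => [|i] r; first by lia.
rewrite !mulmxA coord_P0 // coord_Q0 //.
have -> : (al rho i.+1 < rho)%N by rewrite /alpha; lia.
have ir : (i < rho)%N by lia.
rewrite (xcol (Ordinal ir)) submxcol_mul mul1mx mulmxDl.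
(* Inner rows are the shift of Theta. In the last row the D-term reappears and equals S_rho after
   substituting G_rho. *)
have [ilt|ige] := ltnP i.+1 rho.
  have -> : (beta rho i.+1 == rho) = false by rewrite /beta /alpha; lia.
  by rewrite mul0mx addr0 (xcol (Ordinal ilt)) (@Theta_row _ _ _ _ _ (Ordinal ilt)).
have ie : i.+1 = rho by lia.
have -> : beta rho i.+1 == rho by rewrite /beta /alpha; lia.
have rho0 : (0 < rho)%N by lia.
rewrite mul0mx add0r (@Theta_last _ _ _ _ _ (Ordinal rho0)) // -(xcol (Ordinal rho0)) /=.
by rewrite -(mulmxA _ (Sa 0)) Sa0_mul Gx0 (mulmxA _ Gn) -mulmxDl mulmxA ie.
Qed.

Variable z : R -> R.
Hypothesis z_gt0 : \forall t \near (0 : R)^'+, 0 < z t.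
Hypothesis z_small : forall e, 0 < e -> \forall t \near (0 : R)^'+, z t <= e.

(** A power z^e is constant for e = 0 and at most z otherwise, once z <= 1. *)
Lemma scaling_bigO f g : bigO z (fun t => Sc f g (z t) - Sc f g 0).
Proof.
have mono e (M : 'M[K]_n) : bigO z (fun t => (z t ^+ e)%:C *: M - ((0 : R) ^+ e)%:C *: M).
  exists (nrm M); near=> t.
  have z0 : 0 < z t by near: t.
  have z1 : z t <= 1 by near: t; apply: z_small.
  rewrite -scalerBl nrmZ mulrC ler_wpM2l ?nrm_ge0 // -rmorphB normcR.
  case: e => [|e]; first by rewrite subrr normr0 ltW.
  have z0' := ltW z0.
  rewrite expr0n subr0 ger0_norm ?exprn_ge0 // exprS ger_pMr //.
  by rewrite exprn_ile1.
apply: (@bigO_ext _ _ _ _ (fun t => \sum_(1 <= k < m.+1) \sum_(1 <= i < k.+1)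
   ((z t ^+ f k i)%:C *: (V k i *m A k i) - ((0 : R) ^+ f k i)%:C *: (V k i *m A k i))
   + ((z t ^+ g)%:C *: proj - ((0 : R) ^+ g)%:C *: proj))).
  apply: nearW => t; rewrite /scaling opprD addrACA -sumrB; congr (_ + _).
  by apply: eq_bigr => k _; rewrite -sumrB.
by apply: bigOD => //; apply: bigO_sum => k _; apply: bigO_sum => i _.
Unshelve. all: by end_near.
Qed.

Theorem invariant_family : exists (x0 : 'M[K]_(n, b)) (x : R -> 'M[K]_(n, b)) (tTh : R -> 'M[K]_b),
  [/\ Pirho *m x0 = 1%:M, EA1 rho.+1 *m x0 = Gn *m (A rho 1%N *m x0),
      bigO z (fun t => x t - x0), bigO z (fun t => tTh t - Th) &
      \forall t \near (0 : R)^'+, Pirho *m x t = 1%:M /\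
        (C + (z t ^+ rho)%:C *: D) *m (Sa (z t) *m x t)
        = (Sa (z t) *m x t) *m (lambda%:M + (z t)%:C *: tTh t)].
Proof.
have [x0 [Pix0 Gx0 Px0]] := limit_solution.
have uniq0 h : Pirho *m h = 0 ->
    Pz 0 *m h - Qz 0 *m h *m Th = Qz 0 *m x0 *m (Pirho *m Pz 0 *m h) -> h = 0.
  move=> Pih /eqP; rewrite subr_eq => /eqP Ph.
  have {}Ph : Pz 0 *m h = Qz 0 *m (h *m Th + x0 *m (Pirho *m Pz 0 *m h)).
    by rewrite Ph mulmxDr !mulmxA addrC.
  (* The second alternative for Psi is the variation of Theta = Pi P x. *)
  apply: (chain_eq0 Pih (or_intror erefl)) => [k i r kr|].
    by rewrite -(mulmxA (A k i)) Ph (mulmxA (A k i)).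
  by rewrite -(mulmxA proj) Ph (mulmxA proj) proj_Q0 mul0mx.
have hP : bigO z (fun t => Pz (z t) - Pz 0).
  have h := bigOz_mulB z_gt0 z_small (bigOz_mulB z_gt0 z_small (scaling_bigO
     (fun k i => rho - beta k i)%N 0) (bigOz_const z D)) (scaling_bigO al rho).
  by apply: bigO_ext h; apply: nearW => t; symmetry; apply: sub_addl.
have [x [tTh [hx hTh hxx]]] := pencil_family z_gt0 z_small Pix0 Px0 (Pirho_Q 0) uniq0
  hP (scaling_bigO gamma 1) (nearW _ (fun t => Pirho_Q (z t))).
exists x0, x, tTh; split=> //; apply: filterS hxx => t [Pix Px]; split=> //.
have := scaled_pencil (z t) => /(congr1 (mulmx^~ (x t))).
rewrite -[RHS]mulmxA Px => e.
have {}e : (N + (z t ^+ rho)%:C *: D) *m (Sa (z t) *m x t)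
    = (z t)%:C *: (Sa (z t) *m x t *m tTh t).
  rewrite mulmxA e -/(Qz (z t)) !(mulmxA (Sb (z t))) -scaled_shift.
  by rewrite -!scalemxAl.
rewrite (mulmxDr (Sa (z t) *m x t)) mul_mx_scalar -scalemxAr.
exact: shifted_eigen.
Qed.

End InvariantFamily.

(** * Expansions in powers of t^(1/rho) *)

Section Root.
Variable R : realType.
Variable rho : nat.
Hypothesis rho_gt0 : (0 < rho)%N.

Definition root_t (t : R) : R := t `^ (1 / rho%:R).

Lemma root_t_exp t j : 0 < t -> t `^ (j%:R / rho%:R) = root_t t ^+ j.
Proof.
move=> t0; rewrite /root_t -powR_mulrn ?powR_ge0 // -powRrM.
by rewrite div1r mulrC.
Qed.

Lemma root_t_rho t : 0 < t -> root_t t ^+ rho = t.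
Proof.
move=> t0; rewrite -root_t_exp // divff ?pnatr_eq0 -?lt0n // powRr1 //.
exact: ltW.
Qed.

Lemma root_t_sub t j : 0 < t -> (j <= rho)%N ->
  t `^ (1 - j%:R / rho%:R) = root_t t ^+ (rho - j).
Proof.
move=> t0 jr; rewrite -root_t_exp // natrB // mulrBl divff //.
by rewrite pnatr_eq0 -lt0n.
Qed.

Lemma near_gt0 : \forall t \near (0 : R)^'+, 0 < t.
Proof. exact: nbhs_right_gt. Qed.

Lemma root_t_gt0 : \forall t \near (0 : R)^'+, 0 < root_t t.
Proof. by apply: filterS near_gt0 => t t0; apply: powR_gt0. Qed.

Lemma root_t_small e : 0 < e -> \forall t \near (0 : R)^'+, root_t t <= e.
Proof.
move=> e0; near=> t.
have t0 : 0 < t by near: t; apply: near_gt0.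
have te : t <= e ^+ rho by near: t; apply: nbhs_right_le; rewrite exprn_gt0.
rewrite -(ler_pXn2r rho_gt0) ?nnegrE ?powR_ge0 ?(ltW e0) //.
by rewrite root_t_rho.
Unshelve. all: by end_near.
Qed.

(** For 1 <= i <= k this differs from [alpha] only when k = rho, by one, and at i = 1 when k > rho:
    the places where subtracting the limit gains a factor z. *)
Definition delta_exp k i :=
  if (k < rho)%N then (rho - (k.+1 - i))%N
  else if k == rho then i else if (i <= 1)%N then 1%N else minn i.-1 rho.

Lemma delta_root k i t : 0 < t -> (1 <= i <= k)%N ->
  delta rho k t i = root_t t ^+ delta_exp k i.
Proof.
move=> t0 ik; rewrite /delta /delta_exp; case: ifP => kr.
  by rewrite root_t_sub //; lia.
case: ifP => _; first by rewrite root_t_exp.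
by case: ifP => _; rewrite ?root_t_exp // expr1.
Qed.

End Root.

Section Presentation.
Variable R : realType.
Local Notation K := R[i].
Variables (m n : nat) (s : nat -> nat) (rho : nat).
Variables (V : forall j i : nat, 'M[K]_(n, s j)) (A : forall j i : nat, 'M[K]_(s j, n)).
Hypothesis rho_m : (1 <= rho <= m)%N.
Local Notation z := (@root_t R rho).
Local Notation Sa := (scaling m V A (alpha rho) rho).
Variable b : nat.
Variables (y : R -> 'M[K]_(n, b)) (y0 : 'M[K]_(n, b)).
Variables (G : 'M[K]_(\sum_(i < m.+1 - rho.+1) s (rho.+1 + i)%N, s rho)).
Hypothesis y_lim : bigO z (fun t => y t - y0).
Hypothesis y0_top : EA1 m A rho.+1 *m y0 = G *m (A rho 1%N *m y0).

(** The subtracted entries are those collected in E_rho [I; G]. Scaling acts on the left, so the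
    same coordinates serve y = x and y = x F, that is, the structured basis and L_rho. *)
Definition component k t : 'M[K]_(\sum_(i < k) s k, b) :=
  \mxcol_(i < k) ((z t ^+ alpha rho k i.+1)%:C *: (A k i.+1 *m y t)
    - if (i == 0%N :> nat) && (rho <= k)%N then A k 1%N *m y0 else 0).

Lemma scaling_component t :
  Sa (z t) *m y t = Esplit m V rho *m col_mx 1%:M G *m (A rho 1%N *m y0)
   + \sum_(1 <= k < m.+1) blockrow V k *m component k t
   + (z t ^+ rho)%:C *: (coordproj m V A *m y t).
Proof.
rewrite /scaling mulmxDl -scalemxAl; congr (_ + _).
have -> : Esplit m V rho *m col_mx 1%:M G *m (A rho 1%N *m y0)
    = \sum_(1 <= k < m.+1) \sum_(1 <= i < k.+1)
       V k i *m (if (i.-1 == 0)%N && (rho <= k)%N then A k 1%N *m y0 else 0).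
  rewrite /Esplit mul_row_col mulmx1 mulmxDl -[E _ _ _ *m _ *m _]mulmxA -y0_top E_EA1.
  have inner k : (rho <= k)%N -> \sum_(1 <= i < k.+1)
       V k i *m (if (i.-1 == 0)%N && (rho <= k)%N then A k 1%N *m y0 else 0)
      = V k 1%N *m (A k 1%N *m y0).
    move=> kr; rewrite big_ltn ?eqxx ?kr /=; last by lia.
    rewrite big_nat big1 ?addr0 // => i ir.
    by have -> : (i.-1 == 0)%N = false by [lia]; rewrite mulmx0.
  rewrite [RHS](@big_cat_nat _ _ _ rho) /=; [|lia|lia].
  rewrite [X in _ = X + _](_ : _ = 0) ?add0r; last first.
    rewrite big_nat big1 // => k kr.
    rewrite big_nat big1 // => i ir; rewrite [(rho <= k)%N](_ : _ = false) ?andbF ?mulmx0 //.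
    by lia.
  rewrite [RHS]big_ltn ?inner //; last by lia.
  by congr (_ + _); apply: eq_big_nat => k kr; rewrite inner //; lia.
rewrite -big_split mulmx_suml; apply: eq_bigr => k _.
rewrite mulmx_suml /blockrow /component mul_mxrow_mxcol.
rewrite big_add1 /= [in RHS]big_add1 /= !big_mkord -big_split.
by apply: eq_bigr => i _ /=; rewrite -mulmxDr addrC subrK -scalemxAl -scalemxAr mulmxA.
Qed.

Let z_gt0 := @root_t_gt0 R rho.
Let rho_gt0 : (0 < rho)%N. Proof. by case/andP: rho_m. Qed.
Let z_small := @root_t_small R rho rho_gt0.

Lemma root_bounded_scale a c e (B : R -> 'M[K]_(a, c)) :
  bigO (fun=> 1) B -> bigO (fun t => z t ^+ e) (fun t => (z t ^+ e)%:C *: B t).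
Proof.
move=> hB; apply: bigO_le (bigO_scale _ hB).
  by apply: filterS z_gt0 => t t0; rewrite mulr1 lexx andbT exprn_ge0 // ltW.
by apply: filterS z_gt0 => t t0; rewrite exprn_ge0 // ltW.
Qed.

(** What the chains do not account for lies in the complement, whose weight is z^rho = t. *)
Lemma presentation_error :
  isO id (fun t => Sa (z t) *m y t
    - (Esplit m V rho *m col_mx 1%:M G *m (A rho 1%N *m y0)
       + \sum_(1 <= k < m.+1) blockrow V k *m component k t)).
Proof.
apply: bigO_isO.
have h := root_bounded_scale rho (bigOMl (bigO_const (coordproj m V A))
   (bigOz_limit_bounded z_gt0 z_small y_lim)).
apply: (@bigO_le _ _ _ (fun t => z t ^+ rho)).
  by apply: filterS (near_gt0 R) => t t0; rewrite root_t_rho // lexx ltW.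
apply: bigO_ext h; apply: nearW => t.
by rewrite scaling_component addrAC subrr add0r.
Qed.

Lemma component_delta k : k != rho -> isO_rows (delta rho k) (component k).
Proof.
move=> kr i; apply: bigO_isO; have ik := ltn_ord i.
apply: (@bigO_le _ _ _ (fun t => z t ^+ delta_exp rho k i.+1)).
  apply: filterS (near_gt0 R) => t t0; rewrite delta_root //.
  by rewrite lexx exprn_ge0 // powR_ge0.
apply: (@bigO_ext _ _ _ _ (fun t => (z t ^+ alpha rho k i.+1)%:C *: (A k i.+1 *m y t)
    - if (i == 0%N :> nat) && (rho <= k)%N then A k 1%N *m y0 else 0)).
  by apply: nearW => t; rewrite mxcolK.
have [/andP[/eqP i0 rk]|hi] := boolP ((i == 0%N :> nat) && (rho <= k)%N).
  have -> : delta_exp rho k i.+1 = 1%N by rewrite /delta_exp i0 /= (negbTE kr) ltnNge rk.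
  have -> : alpha rho k i.+1 = 0%N by rewrite /alpha i0; lia.
  rewrite i0; apply: bigO_ext (bigOMl (bigO_const (A k 1%N)) y_lim).
  by apply: nearW => t; rewrite expr0 scale1r -mulmxBr.
apply: (@bigO_ext _ _ _ _ (fun t => (z t ^+ alpha rho k i.+1)%:C *: (A k i.+1 *m y t))).
  by apply: nearW => t; rewrite subr0.
have -> : delta_exp rho k i.+1 = alpha rho k i.+1.
  rewrite /delta_exp /alpha (negbTE kr); case: ltnP => kl; first by lia.
  by case: ifP => hi1; move: hi; rewrite kl andbT; lia.
apply: root_bounded_scale.
exact: bigOMl (bigO_const _) (bigOz_limit_bounded z_gt0 z_small y_lim).
Qed.

(** The weight z^i at 0-based position i, times y - y0 = O(z), gives z^(i+1). *)
Lemma component_rho : isO_rows (delta rho rho) (fun t => component rho t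
  - \mxcol_(i < rho) (if i == 0%N :> nat then 0
       else (z t ^+ i)%:C *: (A rho i.+1 *m y0))).
Proof.
move=> i; apply: bigO_isO; have ik := ltn_ord i.
apply: (@bigO_le _ _ _ (fun t => z t ^+ i.+1)).
  apply: filterS (near_gt0 R) => t t0; rewrite delta_root //.
  by rewrite /delta_exp ltnn eqxx lexx exprn_ge0 // powR_ge0.
apply: (@bigO_ext _ _ _ _ (fun t => (z t ^+ i)%:C *: (A rho i.+1 *m (y t - y0)))).
  apply: nearW => t; rewrite submxcolB !mxcolK leqnn andbT.
  have -> : alpha rho rho i.+1 = i by rewrite /alpha; lia.
  case: eqP => [->|_]; last by rewrite subr0 -scalerBr mulmxBr.
  by rewrite subr0 expr0 !scale1r mulmxBr.
apply: (@bigO_le _ _ _ (fun t => z t ^+ i * z t)).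
  by apply: filterS z_gt0 => t t0; rewrite exprSr lexx mulr_ge0 ?exprn_ge0 // ltW.
apply: bigO_scale; last exact: bigOMl (bigO_const _) y_lim.
by apply: filterS z_gt0 => t t0; rewrite exprn_ge0 // ltW.
Qed.

End Presentation.

(** * Reversal of the conjugate chains *)

Section Reversal.
Variable R : realType.
Local Notation K := R[i].
Variables (m n : nat) (s : nat -> nat) (rho b : nat).
Variable V : forall j i : nat, 'M[K]_(n, s j).

(* Reversing each chain of Vc turns (lambda + N)^* into conj(lambda) + N. *)
Definition revfam (k i : nat) : 'M[K]_(n, s k) := V k (k.+1 - i)%N.

Definition revrows k (X : 'M[K]_(\sum_(i < k) s k, b)) : 'M[K]_(\sum_(i < k) s k, b) :=
  \mxcol_(i < k) submxcol X (rev_ord i).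

Lemma blockrow_rev k X : blockrow V k *m revrows X = blockrow revfam k *m X.
Proof.
rewrite -[in RHS](submxcolK X) /blockrow /revrows !mul_mxrow_mxcol.
rewrite (reindex_inj rev_ord_inj) /=; apply: eq_bigr => i _; rewrite rev_ordK.
by rewrite /revfam; congr (V _ _ *m _); have := ltn_ord i; lia.
Qed.

Lemma isO_rows_rev k (X : R -> 'M[K]_(\sum_(i < k) s k, b)) :
  isO_rows (delta rho k) X -> isO_rows (deltac rho k) (fun t => revrows (X t)).
Proof.
move=> h i; have [c hc] := h (rev_ord i); exists c; apply: filterS hc => t.
rewrite /revrows mxcolK /deltac /=.
by have -> : (k.+1 - i.+1 = (k - i.+1).+1)%N by have := ltn_ord i; lia.
Qed.

Lemma Esplit_rev k : Esplit m revfam k = Ecsplit m V k.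
Proof.
by rewrite /Esplit /Ecsplit /revfam subn1; congr row_mx.
Qed.

End Reversal.

(** * The structured basis *)

Section StructuredPairs.
Variable R : realType.
Local Notation K := R[i].
Variables (n : nat) (Delta C D : 'M[K]_n) (lambda : K) (rho : nat).

Lemma trC_row a b c (X : 'M[K]_(a, b)) (Y : 'M[K]_(a, c)) :
  (row_mx X Y)^t* = col_mx (X^t*) (Y^t*).
Proof. by rewrite tr_row_mx map_col_mx. Qed.

Lemma trC_mxrow a c (q : 'I_c -> nat) (B : forall j, 'M[K]_(a, q j)) :
  (\mxrow_j B j)^t* = \mxcol_j (B j)^t*.
Proof. by apply/matrixP => i j; rewrite !mxE. Qed.

Lemma trC_mxcol a c (q : 'I_c -> nat) (B : forall j, 'M[K]_(q j, a)) :
  (\mxcol_j B j)^t* = \mxrow_j (B j)^t*.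
Proof. by apply/matrixP => i j; rewrite !mxE. Qed.

Lemma submxcol_resolution r d :
  \sum_(i < r) (submxcol (1%:M : 'M[K]_(\sum_(i < r) d)) i)^t* *m submxcol 1%:M i = 1%:M.
Proof. by rewrite -mul_mxrow_mxcol -trC_mxcol submxcolK trC1 mulmx1. Qed.

Lemma trC_scalar a (x : K) : (x%:M : 'M[K]_a)^t* = (x^*)%R%:M.
Proof. by rewrite tr_scalar_mx map_scalar_mx. Qed.

Lemma trC_exp a (X : 'M[K]_a) k : (X ^+ k)^t* = (X^t*) ^+ k.
Proof.
elim: k => [|k IH]; first by rewrite !expr0; exact: trC1.
by rewrite exprS exprSr -[X * _]/(X *m _) trCM IH.
Qed.

Hypothesis Delta_herm : Delta^t* = Delta.

(** The Gram block of Lc against L is left out: it is the adjoint of the opposite block, as Delta is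
    Hermitian and the weight is real. *)
Lemma structured_pairP l t (L Lc : 'M[K]_(n, l)) Om :
  let B := lambda%:M + rho_root rho t *: Om in
  let w := (t `^ (1 - 1 / rho%:R))%:C in
  structured_pair Delta C D lambda rho t L Lc Om <->
  [/\ (C + t%:C *: D) *m L = L *m B, (C + t%:C *: D) *m Lc = Lc *m B^t*,
      L^t* *m Delta *m L = 0, L^t* *m Delta *m Lc = w%:M
    & Lc^t* *m Delta *m Lc = 0].
Proof.
move=> B w; rewrite /structured_pair -/B -/w mul_mx_row mul_row_block !mulmx0 addr0 add0r.
rewrite trC_row mul_col_mx mul_col_row /swap_mx scale_block_mx !scaler0 scalemx1.
split=> [[/eq_row_mx[-> ->] /eq_block_mx[-> -> _ ->]]|[-> -> -> h ->]] //.
split=> //; rewrite h; congr (block_mx _ _ _ _).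
by rewrite -[L in LHS]trmxCK -[Delta]Delta_herm -!trCM mulmxA h trC_scalar conj_realC.
Qed.

Lemma structured_pair_mul l l' t (L Lc : 'M[K]_(n, l)) Om
    (F Fc : 'M[K]_(l, l')) (Om' : 'M[K]_l') :
  structured_pair Delta C D lambda rho t L Lc Om ->
  Om *m F = F *m Om' -> Om^t* *m Fc = Fc *m Om'^t* -> F^t* *m Fc = 1%:M ->
  structured_pair Delta C D lambda rho t (L *m F) (Lc *m Fc) Om'.
Proof.
move=> /structured_pairP[e1 e2 e3 e4 e5] OF OFc FFc; apply/structured_pairP.
rewrite !trCM; split.
- rewrite mulmxA e1 -!mulmxA; congr (_ *m _).
  by rewrite mulmxDl mulmxDr mul_scalar_mx mul_mx_scalar -scalemxAl OF scalemxAr.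
- rewrite mulmxA e2 -!mulmxA; congr (_ *m _).
  rewrite !trCD !trCZ !trC_scalar mulmxDl mulmxDr mul_scalar_mx mul_mx_scalar.
  by rewrite -scalemxAl OFc scalemxAr.
- by rewrite -!mulmxA !(mulmxA (L^t*)) !(mulmxA (L^t* *m Delta)) e3 mul0mx mulmx0.
- rewrite -!mulmxA !(mulmxA (L^t*)) !(mulmxA (L^t* *m Delta)) e4 mul_scalar_mx -scalemxAr.
  by rewrite FFc scalemx1.
- by rewrite -!mulmxA !(mulmxA (Lc^t*)) !(mulmxA (Lc^t* *m Delta)) e5 mul0mx mulmx0.
Qed.

(** H is self-adjoint for Delta, so Gram matrices intertwine the blocks. For L and Lh this makes M
    conjugate B' to the adjoint of B, and dividing by M removes the conjugation. The last two
    conclusions are the same identity for each family against itself, ready for [isotropic_near]. *)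
Lemma normalized_pair b (H : 'M[K]_n) (L Lh : 'M[K]_(n, b)) (B B' M : 'M[K]_b) (w : K) :
  Delta *m H = H^t* *m Delta -> w != 0 -> M \in unitmx ->
  H *m L = L *m B -> H *m Lh = Lh *m B' -> L^t* *m Delta *m Lh = w *: M ->
  let Lc := Lh *m invmx M in
  [/\ H *m Lc = Lc *m B^t*, L^t* *m Delta *m Lc = w%:M,
      B^t* *m (L^t* *m Delta *m L) = (L^t* *m Delta *m L) *m B
    & B *m (Lc^t* *m Delta *m Lc) = (Lc^t* *m Delta *m Lc) *m B^t*].
Proof.
move=> DH w0 Mu HL HLh gram Lc.
have adj c d (X : 'M[K]_(n, c)) (Y : 'M[K]_(n, d)) :
    X^t* *m Delta *m (H *m Y) = (H *m X)^t* *m Delta *m Y.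
  by rewrite -!mulmxA (mulmxA Delta) DH trCM !mulmxA.
have MB : M *m B' = B^t* *m M.
  have := adj _ _ L Lh; rewrite HL HLh trCM mulmxA -!(mulmxA (B^t*)) gram.
  by rewrite -scalemxAl -scalemxAr; apply: scalerI.
have HLc : H *m Lc = Lc *m B^t*.
  rewrite /Lc mulmxA HLh -!mulmxA; congr (_ *m _).
  by apply: (can_inj (mulKmx Mu)); rewrite mulmxA MB -mulmxA mulmxV // mulmx1 mulKVmx.
split=> //.
- by rewrite /Lc mulmxA gram -scalemxAl mulmxV // scalemx1.
- by have := adj _ _ L L; rewrite HL trCM -!mulmxA.
- have := adj _ _ Lc Lc; rewrite HLc (trCM Lc) trmxCK; move: (Lc) => X.
  by rewrite -!mulmxA.
Qed.

Lemma scale_split b e (x : R) (I X Y : 'M[K]_b) : (0 < e)%N ->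
  (x ^+ e.-1)%:C *: (I + x%:C *: (X + Y))
  = ((x ^+ e.-1)%:C *: I + (x ^+ e)%:C *: X) + (x ^+ e)%:C *: Y.
Proof.
by move=> e0; rewrite scalerDr scalerA -rmorphM -exprSr prednK // scalerDr addrA.
Qed.

Variable z : R -> R.
Hypothesis z_gt0 : \forall t \near (0 : R)^'+, 0 < z t.
Hypothesis z_small : forall e, 0 < e -> \forall t \near (0 : R)^'+, z t <= e.

(* The two diagonal blocks have eigenvalues near lambda and its conjugate, so the
   homogeneous Sylvester equation has only the zero solution. *)
Lemma isotropic_near b (mu : K) (T : R -> 'M[K]_b) : mu^*%R != mu -> bigO (fun=> 1) T ->
  \forall t \near (0 : R)^'+, forall G : 'M[K]_b,
    (mu%:M + (z t)%:C *: T t)^t* *m G = G *m (mu%:M + (z t)%:C *: T t) -> G = 0.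
Proof.
move=> mun [c hT].
have d0 : 0 < normc (mu^*%R - mu).
  rewrite lt_neqAle normc_ge0 andbT eq_sym; apply: contra mun => /eqP/eq0_normc/eqP.
  by rewrite subr_eq0.
near=> t => G hG; apply: nrm_eq0; apply/eqP; rewrite eq_le nrm_ge0 andbT leNgt.
apply/negP => G0.
have z0 : 0 < z t by near: t.
have Tc : nrm (T t) <= c * 1 by near: t.
(* The right side of [e] below has norm at most 2 c z nrm G; the factor 4 makes that half of the
   left side or less. *)
have zc : 4 * c * z t <= normc (mu^*%R - mu) by near: t; apply: near_small.
have e : (mu^*%R - mu) *: G = (z t)%:C *: (G *m T t - (T t)^t* *m G).
  move: hG; rewrite trCD trC_scalar trCZ conj_realC mulmxDl mulmxDr mul_scalar_mx.
  rewrite mul_mx_scalar -scalemxAl -scalemxAr => hG'; rewrite scalerBl scalerBr.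
  apply/eqP; rewrite subr_eq addrAC eq_sym subr_eq eq_sym; apply/eqP.
  by rewrite hG' addrC.
have := congr1 (@nrm R b b) e; rewrite !nrmZ normcR ger0_norm ?(ltW z0) //.
have h1 := nrmM_le (lexx (nrm G)) Tc.
have h2 : nrm ((T t)^t* *m G) <= c * 1 * nrm G by rewrite nrmM_le ?nrm_trC.
have h3 := ler_wpM2l (ltW z0) (nrmB_le h1 h2).
have h4 := ler_wpM2r (ltW G0) zc.
have c0 : 0 <= c by have := nrm_ge0 (T t); lra.
have h5 : 0 < normc (mu^*%R - mu) * nrm G by rewrite mulr_gt0.
by move=> h6; lra.
Unshelve. all: by end_near.
Qed.

End StructuredPairs.

(** * The two invariant families and their Gram matrix *)

Section StructuredFamily.
Variable R : realType.
Local Notation K := R[i].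
Variables (m n : nat) (s : nat -> nat) (rho : nat).
Variables (V Vc : forall j i : nat, 'M[K]_(n, s j)) (Delta C D : 'M[K]_n) (lambda : K).
Local Notation inr k i := ((1 <= i <= k)%N && (k <= m)%N).

Hypothesis rho_m : (1 <= rho <= m)%N.
Hypothesis Delta_herm : Delta^t* = Delta.
Hypothesis DC : Delta *m C = (Delta *m C)^t*.
Hypothesis DD : Delta *m D = (Delta *m D)^t*.
Hypothesis lambda_conj : lambda^*%R != lambda.
Hypothesis gram_VcV : forall k i i', inr k i -> inr k i' ->
  (Vc k i)^t* *m Delta *m V k i' = (i == i')%:R%:M.
Hypothesis gram_VcV0 : forall k k' i i', inr k i -> inr k' i' -> k != k' ->
  (Vc k i)^t* *m Delta *m V k' i' = 0.
Hypothesis CV1 : forall k, (1 <= k <= m)%N -> C *m V k 1%N = lambda *: V k 1%N.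
Hypothesis CVS : forall k i, inr k i -> inr k i.+1 ->
  C *m V k i.+1 = lambda *: V k i.+1 + V k i.
Hypothesis CVc : forall k i, inr k i ->
  C *m Vc k i = lambda^*%R *: Vc k i + (if (i < k)%N then Vc k i.+1 else 0).
Hypothesis ker : forall (mu : K) b (y : 'M[K]_(n, b)), mu = lambda \/ mu = lambda^*%R ->
  C *m y = mu *: y ->
  (forall k i, inr k i -> (Vc k i)^t* *m Delta *m y = 0) ->
  (forall k i, inr k i -> (V k i)^t* *m Delta *m y = 0) -> y = 0.
Hypothesis Wu : forall k, (1 <= k <= m)%N -> W m V Vc Delta D k \in unitmx.

Let A k i := (Vc k i)^t* *m Delta.
Let Vd := revfam Vc.
Let Ad k i := (V k (k.+1 - i)%N)^t* *m Delta.

Let DeltaC : Delta *m C = C^t* *m Delta.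
Proof. by rewrite DC trCM Delta_herm. Qed.

Let DeltaD : Delta *m D = D^t* *m Delta.
Proof. by rewrite DD trCM Delta_herm. Qed.

Let gram_VVc k i i' : inr k i -> inr k i' ->
  (V k i)^t* *m Delta *m Vc k i' = (i == i')%:R%:M.
Proof.
move=> r r'; have := gram_VcV r' r => /(congr1 (fun M => M^t*)).
rewrite !trCM trmxCK Delta_herm mulmxA => ->; rewrite trC_scalar eq_sym.
by rewrite rmorph_nat.
Qed.

Let gram_VVc0 k k' i i' : inr k i -> inr k' i' -> k != k' ->
  (V k i)^t* *m Delta *m Vc k' i' = 0.
Proof.
move=> r r' kk; rewrite eq_sym in kk; have := gram_VcV0 r' r kk => /(congr1 (fun M => M^t*)).
by rewrite !trCM trmxCK Delta_herm mulmxA => ->; rewrite trC0.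
Qed.

Lemma biorthogonal_primal : biorthogonal m V A.
Proof. by split; [exact: gram_VcV|exact: gram_VcV0]. Qed.

Lemma biorthogonal_dual : biorthogonal m Vd Ad.
Proof.
split=> [k i i' r r'|k k' i i' r r' kk]; rewrite /Ad /Vd /revfam.
  rewrite gram_VVc; [|lia|lia].
  by congr (_%:R%:M); apply/eqP/eqP; lia.
by rewrite gram_VVc0 //; lia.
Qed.

Lemma coord_C_primal k i : inr k i ->
  A k i *m C = lambda *: A k i + (if (i < k)%N then A k i.+1 else 0).
Proof.
move=> r; rewrite /A -mulmxA DeltaC mulmxA -trCM CVc // trCD trCZ conjCK.
rewrite mulmxDl -scalemxAl; case: ifP => // _.
by rewrite trC0 mul0mx.
Qed.

Let V_C k i : inr k i -> (V k i)^t* *m Delta *m C =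
  lambda^*%R *: ((V k i)^t* *m Delta) + (if (1 < i)%N then (V k i.-1)^t* *m Delta else 0).
Proof.
move=> r; rewrite -mulmxA DeltaC mulmxA -trCM.
case: i r => [|[|i]] r; first by lia.
  by rewrite CV1 ?trCZ ?scalemxAl ?addr0 //; lia.
by rewrite CVS ?trCD ?trCZ ?mulmxDl ?scalemxAl //; lia.
Qed.

Lemma coord_C_dual k i : inr k i ->
  Ad k i *m C = lambda^*%R *: Ad k i + (if (i < k)%N then Ad k i.+1 else 0).
Proof.
move=> r; rewrite /Ad V_C; last by lia.
have -> : (1 < k.+1 - i)%N = (i < k)%N by lia.
by have -> : (k.+1 - i).-1 = (k.+1 - i.+1)%N by lia.
Qed.

(** The adjoints of the V_ki times Delta are left chains for conj(lambda), which differs from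
    lambda; by induction along each chain they annihilate y as well, and [ker] applies. *)
Lemma kernel_primal b (y : 'M[K]_(n, b)) : C *m y = lambda *: y ->
  (forall k i, inr k i -> A k i *m y = 0) -> y = 0.
Proof.
move=> Cy Ay; apply: (ker (or_introl erefl) Cy) => // k i.
elim: i => [|i IH] r; first by lia.
have := congr1 (mulmx^~ y) (V_C r).
rewrite -(mulmxA _ C) Cy mulmxDl -scalemxAr -scalemxAl [X in _ + X](_ : _ = 0).
  rewrite addr0 => /eqP; rewrite -subr_eq0 -scalerBl scaler_eq0 subr_eq0.
  by rewrite eq_sym (negbTE lambda_conj) => /eqP.
case: ifP => i1; last by rewrite mul0mx.
by rewrite IH //; lia.
Qed.

Lemma kernel_dual b (y : 'M[K]_(n, b)) : C *m y = lambda^*%R *: y ->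
  (forall k i, inr k i -> Ad k i *m y = 0) -> y = 0.
Proof.
move=> Cy Ay; apply: (ker (or_intror erefl) Cy) => [k i r|k i r]; last first.
  by have := Ay k (k.+1 - i)%N; rewrite /Ad subKn; [apply; lia|lia].
(* The left chains built from Vc end at i = k, so this induction descends from there. *)
have [d di] : exists d, d = (k - i)%N by eexists.
elim: d i di r => [|d IH] i di r; have := congr1 (mulmx^~ y) (coord_C_primal r);
  rewrite -(mulmxA _ C) Cy mulmxDl -scalemxAr -scalemxAl [X in _ + X](_ : _ = 0);
  try (rewrite addr0 => /eqP; rewrite -subr_eq0 -scalerBl scaler_eq0 subr_eq0;
    by rewrite (negbTE lambda_conj) => /eqP).
  by have -> : (i < k)%N = false by [lia]; rewrite mul0mx.
have -> : (i < k)%N by lia.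
by rewrite /A IH //; lia.
Qed.

Lemma EA_primal k : EA m A k = (Ec m Vc k)^t* *m Delta.
Proof. by rewrite /EA /Ec trC_mxrow mxcol_mul. Qed.

Lemma EA_dual k : EA m Ad k = (E m V k)^t* *m Delta.
Proof.
rewrite /EA /E trC_mxrow mxcol_mul; apply: eq_mxcol => i.
by rewrite /Ad subSnn.
Qed.

Lemma E_dual k : E m Vd k = Ec m Vc k.
Proof. by apply: eq_mxrow => i; rewrite /Vd /revfam subn1. Qed.

Lemma Wn_primal k : Wn m V A D k = W m V Vc Delta D k.
Proof. by rewrite /Wn EA_primal. Qed.

Lemma Gn_primal : Gn m V A D rho = G m V Vc Delta D rho.
Proof. by rewrite /Gn /G Wn_primal EA_primal !mulmxA. Qed.

Lemma Sn_primal : Sn m V A D rho = Srho m V Vc Delta D rho.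
Proof. by rewrite /Sn /Srho Gn_primal. Qed.

Lemma Wn_dual k : Wn m Vd Ad D k = (W m V Vc Delta D k)^t*.
Proof.
rewrite /Wn EA_dual E_dual /W !trCM trmxCK -!mulmxA; congr (_ *m _).
by rewrite Delta_herm !mulmxA DeltaD.
Qed.

Lemma Gn_dual : Gn m Vd Ad D rho = Gc m V Vc Delta D rho.
Proof.
rewrite /Gn /Gc Wn_dual EA_dual !mulmxA.
have -> : Vd rho 1%N = Vc rho rho by rewrite /Vd /revfam subn1.
by rewrite -map_invmx -trmx_inv.
Qed.

Let W0 : Wn m V A D rho \in unitmx.
Proof. by rewrite Wn_primal; apply: Wu. Qed.

(** For rho = m the matrix W_(rho+1) has size zero. *)
Let W_empty (k : nat) (M : 'M[K]_(\sum_(i < m.+1 - k) s (k + i)%N)) : (m < k)%N -> M \in unitmx.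
Proof.
move=> mk; suff e : (\sum_(i < m.+1 - k) s (k + i)%N = 0)%N.
  by move: M; rewrite e => M; rewrite unitmxE det_mx00 unitr1.
by have -> : (m.+1 - k = 0)%N by [lia]; rewrite big_ord0.
Qed.

Let W1 : Wn m V A D rho.+1 \in unitmx.
Proof.
have [h|h] := leqP rho.+1 m; last exact: W_empty.
by rewrite Wn_primal; apply: Wu; lia.
Qed.

Let trC_unit k (M : 'M[K]_k) : M \in unitmx -> M^t* \in unitmx.
Proof. by rewrite map_unitmx unitmx_tr. Qed.

Let Wd0 : Wn m Vd Ad D rho \in unitmx.
Proof. by rewrite Wn_dual; apply: trC_unit; apply: Wu. Qed.

Let Wd1 : Wn m Vd Ad D rho.+1 \in unitmx.
Proof.
have [h|h] := leqP rho.+1 m; last exact: W_empty.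
by rewrite Wn_dual; apply: trC_unit; apply: Wu; lia.
Qed.

Let CVd1 k : (1 <= k <= m)%N -> C *m Vd k 1%N = lambda^*%R *: Vd k 1%N.
Proof.
move=> kr; rewrite /Vd /revfam subn1 /= CVc; last by lia.
by rewrite ltnn addr0.
Qed.

Let CVdS k i : inr k i -> inr k i.+1 ->
  C *m Vd k i.+1 = lambda^*%R *: Vd k i.+1 + Vd k i.
Proof.
move=> r r'; rewrite /Vd /revfam CVc; last by lia.
have -> : (k.+1 - i.+1 < k)%N by lia.
by have -> : (k.+1 - i.+1).+1 = (k.+1 - i)%N by lia.
Qed.

Let rho_gt0 : (0 < rho)%N. Proof. by case/andP: rho_m. Qed.
Local Notation z := (@root_t R rho).
Let z_gt0 := @root_t_gt0 R rho.
Let z_small := @root_t_small R rho rho_gt0.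

Definition primal_family := invariant_family rho_m biorthogonal_primal CV1 CVS
  coord_C_primal kernel_primal W1 W0 z_gt0 z_small.

Definition dual_family := invariant_family rho_m biorthogonal_dual CVd1 CVdS
  coord_C_dual kernel_dual Wd1 Wd0 z_gt0 z_small.

Local Notation b := (\sum_(i < rho) s rho)%N.
Local Notation Sa := (scaling m V A (alpha rho) rho).
Local Notation Sd := (scaling m Vd Ad (alpha rho) rho).
Local Notation proj := (coordproj m V A).

(** Only X is decomposed: on Y the adjoint of V_ki times Delta is already a coordinate of the
    reversed dual family. *)
Lemma gram_expand c d (X : 'M[K]_(n, c)) (Y : 'M[K]_(n, d)) :
  X^t* *m Delta *m Y = \sum_(1 <= k < m.+1) \sum_(1 <= i < k.+1)
      (A k i *m X)^t* *m (Ad k (k.+1 - i)%N *m Y) + (proj *m X)^t* *m Delta *m Y.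
Proof.
have e : X = \sum_(1 <= k < m.+1) \sum_(1 <= i < k.+1) V k i *m (A k i *m X) + proj *m X.
  rewrite mulmxBl mul1mx mulmx_suml addrC -addrA [X in _ + X](_ : _ = 0) ?addr0 //.
  rewrite addrC; apply/eqP; rewrite subr_eq0; apply/eqP; apply: eq_bigr => k _.
  by rewrite mulmx_suml; apply: eq_bigr => i _; rewrite mulmxA.
rewrite {1}e trCD !mulmxDl; congr (_ + _).
rewrite trC_sum !mulmx_suml; apply: eq_big_nat => k kr.
rewrite trC_sum !mulmx_suml; apply: eq_big_nat => i ir.
by rewrite trCM /Ad subKn ?mulmxA //; lia.
Qed.

Lemma scaled_bounded c d e (X : R -> 'M[K]_(c, d)) : bigO (fun=> 1) X ->
  bigO (fun=> 1) (fun t => (z t ^+ e)%:C *: X t).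
Proof.
move=> hX; apply: (bigO_le _ (root_bounded_scale rho e hX)).
near=> t; have z0 : 0 <= z t by apply: powR_ge0.
have z1 : z t <= 1 by near: t; apply: z_small.
by rewrite exprn_ge0 // exprn_ile1.
Unshelve. all: by end_near.
Qed.

(* At block (k, i) the two scalings contribute z^(alpha k i + alpha k (k+1-i)), an
   exponent which is at least rho when k differs from rho, and rho - 1 otherwise. *)
Lemma gram_scaling (x xh : R -> 'M[K]_(n, b)) :
  bigO (fun=> 1) x -> bigO (fun=> 1) xh ->
  (\forall t \near (0 : R)^'+, forall i : 'I_rho, A rho i.+1 *m x t = submxcol 1%:M i) ->
  (\forall t \near (0 : R)^'+, forall i : 'I_rho,
     Ad rho i.+1 *m xh t = submxcol 1%:M (rev_ord i)) ->
  exists2 N : R -> 'M[K]_b, bigO (fun=> 1) N &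
    \forall t \near (0 : R)^'+, (Sa (z t) *m x t)^t* *m Delta *m (Sd (z t) *m xh t)
      = (z t ^+ rho.-1)%:C *: (1%:M + (z t)%:C *: N t).
Proof.
move=> hx hxh hxr hxhr.
pose ex k i := (alpha rho k i + alpha rho k (k.+1 - i))%N.
pose term k i t := (A k i *m x t)^t* *m (Ad k (k.+1 - i)%N *m xh t).
(* The truncated subtraction is harmless because ex k i >= rho for k != rho; the last summand comes
   from the complement, of weight z^rho. *)
exists (fun t => \sum_(1 <= k < m.+1) \sum_(1 <= i < k.+1)
    (if k == rho then 0 else (z t ^+ (ex k i - rho))%:C *: term k i t)
    + (proj *m x t)^t* *m Delta *m (Sd (z t) *m xh t)).
  apply: bigOD.
    apply: bigO_sum => k _; apply: bigO_sum => i _; case: eqP => _; first exact: bigO0.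
    apply: scaled_bounded; apply: bigOMl; last exact: bigOMl (bigO_const _) hxh.
    exact: bigO_trC (bigOMl (bigO_const _) hx).
  apply: bigOMl.
    by apply: bigOMr (bigO_const _); apply: bigO_trC (bigOMl (bigO_const _) hx).
  apply: bigOMl hxh; apply: (bigOz_limit_bounded z_gt0 z_small).
  exact: scaling_bigO.
apply: filterS2 hxr hxhr => t xr xhr; set zt := z t.
rewrite gram_expand mulmxA proj_scaling; last exact: biorthogonal_primal.
rewrite -scalemxAl trCZ conj_realC -!scalemxAl.
rewrite (scale_split _ _ _ _ rho_gt0); congr (_ + _).
have tE k i : inr k i ->
    (A k i *m (Sa zt *m x t))^t* *m (Ad k (k.+1 - i)%N *m (Sd zt *m xh t))
    = (zt ^+ ex k i)%:C *: term k i t.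
  move=> r; have r' : inr k (k.+1 - i)%N by lia.
  rewrite (mulmxA (A k i)) (coord_scaling biorthogonal_primal _ _ _ r).
  rewrite (mulmxA (Ad _ _)) (coord_scaling biorthogonal_dual _ _ _ r').
  rewrite -!scalemxAl trCZ conj_realC -scalemxAl -scalemxAr scalerA -rmorphM -exprD.
  by [].
have rin : rho \in index_iota 1 m.+1 by rewrite mem_index_iota; lia.
rewrite (bigD1_seq rho) ?iota_uniq //= [in RHS](bigD1_seq rho) ?iota_uniq //= eqxx.
rewrite [X in _ *: (X + _)]big1 // add0r; congr (_ + _).
  rewrite -[in RHS](submxcol_resolution R rho (s rho)) scaler_sumr big_add1 /= big_mkord.
  apply: eq_bigr => i _; have ir := ltn_ord i.
  rewrite tE; last by lia.
  have -> : ex rho i.+1 = rho.-1 by rewrite /ex /alpha; lia.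
  rewrite /term xr subSS.
  have -> : (rho - i = (rev_ord i).+1)%N by rewrite /=; lia.
  by rewrite xhr rev_ordK.
rewrite scaler_sumr [LHS]big_seq_cond [RHS]big_seq_cond; apply: eq_bigr => k.
rewrite mem_index_iota => /andP[kr kne]; rewrite (negbTE kne) scaler_sumr; apply: eq_big_nat => i ir.
rewrite tE; last by lia.
rewrite scalerA -rmorphM -exprD; congr ((_ ^+ _)%:C *: _).
by rewrite /ex /alpha; lia.
Qed.

Lemma Pirho_row (B : forall j i : nat, 'M[K]_(s j, n)) (X : 'M[K]_(n, b)) :
  Pirho B rho *m X = 1%:M -> forall i : 'I_rho, B rho i.+1 *m X = submxcol 1%:M i.
Proof. by move=> e i; rewrite -e -submxcol_mul /Pirho mxcolK. Qed.

(** Coordinate i of the reversed chains pairs with coordinate rho + 1 - i along V_rho; permuting the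
    block columns of the dual family accordingly makes the leading Gram matrix the identity. *)
Definition revmx : 'M[K]_b := \mxcol_(i < rho) submxcol 1%:M (rev_ord i).

Lemma revmx_mul : revmx *m revmx = 1%:M.
Proof.
rewrite /revmx mxcol_mul -[RHS]submxcolK; apply: eq_mxcol => i.
by rewrite submxcol_mul mul1mx mxcolK rev_ordK.
Qed.

Theorem structured_family :
  exists (x0 y0 : 'M[K]_(n, b)) (x y : R -> 'M[K]_(n, b)) (tTh : R -> 'M[K]_b),
  [/\ [/\ bigO z (fun t => x t - x0), bigO z (fun t => y t - y0)
       & bigO z (fun t => tTh t - Theta rho (Srho m V Vc Delta D rho))],
     [/\ forall i : 'I_rho, A rho i.+1 *m x0 = submxcol 1%:M i,
         forall i : 'I_rho, Ad rho i.+1 *m y0 = submxcol 1%:M (rev_ord i),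
         EA1 m A rho.+1 *m x0 = G m V Vc Delta D rho *m (A rho 1%N *m x0)
       & EA1 m Ad rho.+1 *m y0 = Gc m V Vc Delta D rho *m (Ad rho 1%N *m y0)],
     \forall t \near (0 : R)^'+,
       forall i : 'I_rho, A rho i.+1 *m x t = submxcol 1%:M i
   & \forall t \near (0 : R)^'+, structured_pair Delta C D lambda rho t
       (Sa (z t) *m x t) (Sd (z t) *m y t) (tTh t)].
Proof.
have [x0 [x [tTh [Pix0 Gx0 hx hTh hxx]]]] := primal_family.
have [u0 [u [tTd [Piu0 Gu0 hu hTd huu]]]] := dual_family.
rewrite Gn_primal in Gx0; rewrite Gn_dual in Gu0; rewrite Sn_primal in hTh.
have hxb := bigOz_limit_bounded z_gt0 z_small hx.
have rowJ (w : 'M[K]_(n, b)) : Pirho Ad rho *m w = 1%:M ->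
    forall i : 'I_rho, Ad rho i.+1 *m (w *m revmx) = submxcol 1%:M (rev_ord i).
  move=> e i; rewrite mulmxA (Pirho_row e) submxcol_mul mul1mx.
  by rewrite /revmx mxcolK.
have huJ : bigO z (fun t => u t *m revmx - u0 *m revmx).
  exact: (bigOz_mulB z_gt0 z_small hu (bigOz_const z revmx)).
have hxrow : \forall t \near (0 : R)^'+, forall i : 'I_rho, A rho i.+1 *m x t = submxcol 1%:M i.
  by apply: filterS hxx => t [e _]; apply: Pirho_row.
have hurow : \forall t \near (0 : R)^'+, forall i : 'I_rho,
    Ad rho i.+1 *m (u t *m revmx) = submxcol 1%:M (rev_ord i).
  by apply: filterS huu => t [e _]; apply: rowJ.
have [N hN gramN] := gram_scaling hxb (bigOz_limit_bounded z_gt0 z_small huJ) hxrow hurow.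
pose M t := 1%:M + (z t)%:C *: N t.
have hM : bigO z (fun t => M t - 1%:M).
  apply: (@bigO_ext _ _ _ _ (fun t => (z t)%:C *: N t)).
    by apply: nearW => t; rewrite /M addrAC subrr add0r.
  apply: (bigO_le _ (bigO_scale _ hN)); apply: filterS z_gt0 => t t0.
    by rewrite mulr1 lexx ltW.
  exact: ltW.
have [Mu hMi] := bigOz_invmx z_gt0 z_small hM.
pose y t := u t *m revmx *m invmx (M t).
exists x0, (u0 *m revmx), x, y, tTh; split.
- split; [exact: hx| |exact: hTh]; rewrite -[u0 *m revmx]mulmx1.
  exact: (bigOz_mulB z_gt0 z_small huJ hMi).
- split; [exact: Pirho_row|exact: rowJ|exact: Gx0|].
  by rewrite mulmxA Gu0 !mulmxA.
- exact: hxrow.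
have hThb := bigOz_limit_bounded z_gt0 z_small hTh.
have hThcb : bigO (fun=> 1) (fun t => (tTh t)^t*) by apply: bigO_trC.
(* The second family carries the adjoint block, so isotropy is also taken for conj(lambda) and the
   adjoint of Theta. *)
have lcc : (lambda^*)^*%R != lambda^*%R by rewrite conjCK eq_sym.
have iso1 := isotropic_near z_gt0 z_small lambda_conj hThb.
have iso2 := isotropic_near z_gt0 z_small lcc hThcb.
near=> t.
have t0 : 0 < t by near: t; apply: near_gt0.
have [_ Hx] : Pirho A rho *m x t = 1%:M /\
    (C + (z t ^+ rho)%:C *: D) *m (Sa (z t) *m x t)
    = (Sa (z t) *m x t) *m (lambda%:M + (z t)%:C *: tTh t) by near: t.
have [_ Hu] : Pirho Ad rho *m u t = 1%:M /\
    (C + (z t ^+ rho)%:C *: D) *m (Sd (z t) *m u t)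
    = (Sd (z t) *m u t) *m (lambda^*%R%:M + (z t)%:C *: tTd t) by near: t.
have gramt : (Sa (z t) *m x t)^t* *m Delta *m (Sd (z t) *m (u t *m revmx))
  = (z t ^+ rho.-1)%:C *: M t by near: t.
have Mtu : M t \in unitmx by near: t.
have iso1t : forall X : 'M[K]_b, (lambda%:M + (z t)%:C *: tTh t)^t* *m X
    = X *m (lambda%:M + (z t)%:C *: tTh t) -> X = 0 by near: t.
have iso2t : forall X : 'M[K]_b, (lambda^*%R%:M + (z t)%:C *: (tTh t)^t*)^t* *m X
    = X *m (lambda^*%R%:M + (z t)%:C *: (tTh t)^t*) -> X = 0 by near: t.
rewrite (root_t_rho rho_gt0 t0) in Hx Hu.
have z0 : 0 < z t by apply: powR_gt0.
have DH : Delta *m (C + t%:C *: D) = (C + t%:C *: D)^t* *m Delta.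
  rewrite mulmxDr -scalemxAr DeltaC DeltaD trCD trCZ conj_realC mulmxDl.
  by rewrite -scalemxAl.
have w0 : (z t ^+ rho.-1)%:C != 0 by rewrite (inj_eq (@complexI R)) expf_neq0 // gt_eqF.
(* Whatever block the dual family carries here, [normalized_pair] replaces it by the adjoint of the
   first one. *)
have HuJ : (C + t%:C *: D) *m (Sd (z t) *m (u t *m revmx)) = (Sd (z t) *m (u t *m revmx))
    *m (revmx *m (lambda^*%R%:M + (z t)%:C *: tTd t) *m revmx).
  rewrite !(mulmxA (Sd (z t))) (mulmxA (C + _)) Hu -!mulmxA.
  by rewrite (mulmxA revmx revmx) revmx_mul mul1mx.
have [e1 e2 e3 e4] := normalized_pair DH w0 Mtu Hx HuJ gramt.
have yE : Sd (z t) *m y t = Sd (z t) *m (u t *m revmx) *m invmx (M t).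
  by rewrite /y !mulmxA.
apply: (eq_ind_r (fun Y => structured_pair Delta C D lambda rho t _ Y _) _ yE).
apply: (structured_pairP C D lambda rho Delta_herm t _ _ _).2; split.
- exact: Hx.
- exact: e1.
- exact: iso1t e3.
- have -> : t `^ (1 - 1 / rho%:R) = z t ^+ rho.-1.
    by rewrite (_ : 1 / rho%:R = 1%:R / rho%:R) // root_t_sub // subn1.
  exact: e2.
- have BE : lambda^*%R%:M + (z t)%:C *: (tTh t)^t*
      = (lambda%:M + (z t)%:C *: tTh t)^t*.
    by rewrite trCD trC_scalar trCZ conj_realC.
  by apply: iso2t; rewrite BE trmxCK; exact: e4.
Unshelve. all: by end_near.
Qed.

End StructuredFamily.

(** * Jordan structure of C *)

Section FullRows.
Variable R : realType.
Local Notation K := R[i].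
Variables (m n : nat) (s : nat -> nat).
Local Notation fam := (forall j i : nat, 'M[K]_(n, s j)).
Local Notation inr k i := ((1 <= i <= k)%N && (k <= m)%N).

Lemma submxblock_diag1 (r : nat) (d : 'I_r -> nat) (i : 'I_r) :
  submxblock (1%:M : 'M[K]_(\sum_i d i)) i i = 1%:M.
Proof. by rewrite -mxdiagZ submxblock_diag. Qed.

Lemma submxblock_off1 (r : nat) (d : 'I_r -> nat) (i j : 'I_r) : i != j ->
  submxblock (1%:M : 'M[K]_(\sum_i d i)) i j = 0.
Proof. by move=> ij; rewrite -mxdiagZ mxblockK (negbTE ij). Qed.

Lemma index_split k i : inr k i -> exists (j : 'I_m) (i' : 'I_j.+1), k = j.+1 /\ i = i'.+1.
Proof.
case: k i => [|k] [|i]; rewrite ?andbF // => /andP[/andP[_ ik] km].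
by exists (Ordinal km), (Ordinal ik).
Qed.

Lemma gram_block (X Y : fam) (Delta : 'M[K]_n) (j j' : 'I_m) (i : 'I_j.+1) (i' : 'I_j'.+1) :
  (X j.+1 i.+1)^t* *m Delta *m Y j'.+1 i'.+1
  = submxblock (submxblock ((fullrow m X)^t* *m Delta *m fullrow m Y) j j') i i'.
Proof.
rewrite /fullrow trC_mxrow mxcol_mul mul_mxcol_mxrow mxblockK.
by rewrite /blockrow trC_mxrow mxcol_mul mul_mxcol_mxrow mxblockK.
Qed.

Lemma fullrow_trC_eq0 (X : fam) b (y : 'M[K]_(n, b)) :
  (forall k i, inr k i -> (X k i)^t* *m y = 0) -> (fullrow m X)^t* *m y = 0.
Proof.
move=> h; rewrite /fullrow trC_mxrow mxcol_mul -[RHS]submxcolK; apply: eq_mxcol => j.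
rewrite submxcol0 /blockrow trC_mxrow mxcol_mul -[RHS]submxcolK; apply: eq_mxcol => i.
by rewrite submxcol0 h //; have := ltn_ord i; have := ltn_ord j; lia.
Qed.

Lemma fullrow_Njordan (X : fam) (C : 'M[K]_n) (x : K) :
  C *m fullrow m X = fullrow m X *m (x%:M + Njordan K s m) ->
  forall k i, inr k i ->
  C *m X k i = x *: X k i + (if (1 < i)%N then X k i.-1 else 0).
Proof.
rewrite mulmxDr mul_mx_scalar -mul_scalar_mx /Njordan {2}/fullrow mul_mxrow_mxdiag.
move=> e k i /index_split[j [i' [-> ->]]].
have {e} := congr1 (fun M => submxrow (submxrow M j) i') e.
rewrite !submxrowD -!mul_submxrow /fullrow !mxrowK mul_scalar_mx => ->.
congr (_ + _); rewrite /blockrow /Nblock mul_mxrow_mxblock mxrowK.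
have := ltn_ord i'; case: (nat_of_ord i') => [|i0] /= i'j.
  by apply: big1 => i1 _; rewrite mulmx0.
rewrite (bigD1 (Ordinal (ltnW i'j))) //= eqxx mulmx1 big1 ?addr0 // => i1 i1ne.
rewrite eqSS eq_sym -(inj_eq val_inj) /= in i1ne *.
by rewrite (negbTE i1ne) mulmx0.
Qed.

(** Taking adjoints first lets N act on block rows from the left, where its superdiagonal can be
    read off. *)
Lemma fullrow_NjordanC (X : fam) (C : 'M[K]_n) (x : K) :
  C *m fullrow m X = fullrow m X *m (x%:M + Njordan K s m)^t* ->
  forall k i, inr k i ->
  C *m X k i = x^*%R *: X k i + (if (i < k)%N then X k i.+1 else 0).
Proof.
move=> e k i /index_split[j [i' [-> ->]]].
have : (fullrow m X)^t* *m C^t*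
    = (fullrow m X)^t* *m x%:M + Njordan K s m *m (fullrow m X)^t*.
  by rewrite -trCM e trCM trmxCK mulmxDl scalar_mxC.
rewrite /Njordan /fullrow trC_mxrow mul_mxdiag_mxcol => {}e.
have {e} := congr1 (fun M => submxcol (submxcol M j) i') e.
rewrite !submxcolD -!submxcol_mul !mxcolK /blockrow trC_mxrow !mxcolK.
rewrite /Nblock mul_mxblock_mxrow mxcolK mul_mx_scalar => e.
have := congr1 (fun M => M^t*) e; rewrite trCM trCD trCZ !trmxCK => ->.
congr (_ + _); have := ltn_ord i'; rewrite ltnS => i'j.
have [ij|ij] := ltnP i' j.
  have i1 : (i'.+1 < j.+1)%N by lia.
  rewrite (bigD1 (Ordinal i1)) //= eqxx mul1mx big1 ?addr0.
    by rewrite trmxCK i1.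
  by move=> k1; rewrite -(inj_eq val_inj) /= => /negbTE->; rewrite mul0mx.
have -> : (i'.+1 < j.+1)%N = false by lia.
rewrite -[RHS]trC0; congr (_^t*); apply: big1 => k1 _; have := ltn_ord k1 => h.
have -> : (k1 == i'.+1 :> nat) = false by lia.
by rewrite mul0mx.
Qed.

(** In the coordinates w = U^-1 y the Gram matrix swaps the two chain parts, so orthogonality to
    both families removes both. The remaining part satisfies the eigenvalue equation of C_C for mu,
    hence vanishes. *)
Lemma jordan_kernel (X Xc : fam) (q : nat) (UC : 'M[K]_(n, q)) (CC DeltaC : 'M[K]_q)
    (C Delta : 'M[K]_n) (J : 'M[K]_(\sum_(j < m) \sum_(i < j.+1) s j.+1)) (mu : K) :
  let U := row_mx (row_mx (fullrow m X) (fullrow m Xc)) UC in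
  invertible_mx U ->
  C *m U = U *m block_mx (block_mx J 0 0 (J^t*)) 0 0 CC ->
  U^t* *m Delta *m U = block_mx (swap_mx K _) 0 0 DeltaC ->
  mu \notin spectrum CC ->
  forall b (y : 'M[K]_(n, b)), C *m y = mu *: y ->
  (forall k i, inr k i -> (Xc k i)^t* *m Delta *m y = 0) ->
  (forall k i, inr k i -> (X k i)^t* *m Delta *m y = 0) -> y = 0.
Proof.
move=> U [U' [UU' U'U]] CU gram muCC b y Cy hXc hX.
pose w := U' *m y; have yE : y = U *m w by rewrite /w mulmxA UU' mul1mx.
have Dw : block_mx (block_mx J 0 0 (J^t*)) 0 0 CC *m w = mu *: w.
  rewrite -[LHS]mul1mx -U'U -mulmxA (mulmxA U) -CU -mulmxA -yE Cy.
  by rewrite -scalemxAr.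
have Gw : block_mx (swap_mx K _) 0 0 DeltaC *m w = U^t* *m Delta *m y.
  by rewrite -gram -(mulmxA _ U) -yE.
have h1 : (fullrow m X)^t* *m Delta *m y = 0.
  by rewrite -mulmxA; apply: fullrow_trC_eq0 => k i r; rewrite mulmxA hX.
have h2 : (fullrow m Xc)^t* *m Delta *m y = 0.
  by rewrite -mulmxA; apply: fullrow_trC_eq0 => k i r; rewrite mulmxA hXc.
have GR : U^t* *m Delta *m y = col_mx (col_mx 0 0) (UC^t* *m Delta *m y).
  by rewrite /U !trC_row !mul_col_mx h1 h2.
move: Dw Gw yE; rewrite GR.
rewrite -[w]vsubmxK -[usubmx w]vsubmxK.
move: (usubmx (usubmx w)) (dsubmx (usubmx w)) (dsubmx w) => w1 w2 w3.
rewrite /swap_mx !mul_block_col !mul0mx !mul1mx !addr0 !add0r.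
rewrite !scale_col_mx => /eq_col_mx[_ Cw3] /eq_col_mx[/eq_col_mx[-> ->] _] ->.
have -> : w3 = 0.
  have u : CC - mu%:M \in unitmx by apply: not_root_unitmx; rewrite -mem_spectrum.
  by rewrite -[w3](mulKmx u) mulmxBl mul_scalar_mx Cw3 subrr mulmx0.
by rewrite !col_mx0 mulmx0.
Qed.

Lemma jordan_relations (X Xc : fam) (q : nat) (UC : 'M[K]_(n, q)) (CC DeltaC : 'M[K]_q)
    (C Delta : 'M[K]_n) (x : K) :
  let U := row_mx (row_mx (fullrow m X) (fullrow m Xc)) UC in
  let J := x%:M + Njordan K s m in
  C *m U = U *m block_mx (block_mx J 0 0 (J^t*)) 0 0 CC ->
  U^t* *m Delta *m U = block_mx (swap_mx K _) 0 0 DeltaC ->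
  [/\ C *m fullrow m X = fullrow m X *m J,
      C *m fullrow m Xc = fullrow m Xc *m J^t*
    & (fullrow m Xc)^t* *m Delta *m fullrow m X = 1%:M].
Proof.
move=> U J CU gram; move: CU.
rewrite /U !mul_mx_row !mul_row_block !mulmx0 !addr0 !add0r.
move=> /eq_row_mx[/eq_row_mx[-> ->] _]; split=> //.
move: gram; rewrite /U !trC_row => gram.
have := congr1 (fun M => dlsubmx (ulsubmx M)) gram.
rewrite /swap_mx block_mxKul block_mxKdl => <-.
rewrite (mul_col_mx (col_mx _ _)) mul_col_row block_mxKul.
by rewrite mul_col_mx mul_col_row block_mxKdl.
Qed.

End FullRows.

(** * Block form of invariant subspaces of Theta *)

Section Factors.
Variable R : realType.
Local Notation K := R[i].
Variables (r d l : nat) (S : 'M[K]_d) (Om : 'M[K]_l).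

Lemma Theta_right_power (F : 'M[K]_(\sum_(i < r) d, l)) (o i : 'I_r) : o = 0%N :> nat ->
  Theta r S *m F = F *m Om -> submxcol F i = submxcol F o *m Om ^+ i.
Proof.
move=> o0 TF; case: i => i ir /=; elim: i ir => [|i IH] ir.
  rewrite expr0 mulmx1; congr submxcol; apply: val_inj.
  by rewrite /= o0.
have ir' := ltnW ir.
have e : submxcol (Theta r S *m F) (Ordinal ir') = submxcol F (Ordinal ir).
  by rewrite -submxcol_mul (@Theta_row _ _ _ _ _ (Ordinal ir)) // submxcol_mul mul1mx.
rewrite -e TF -submxcol_mul (IH ir') -mulmxA exprSr.
by [].
Qed.

Lemma Theta_left_power (G : 'M[K]_(l, \sum_(i < r) d)) (o i : 'I_r) : o.+1 = r ->
  G *m Theta r S = Om *m G -> submxrow G i = Om ^+ (r - i.+1) *m submxrow G o.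
Proof.
move=> o1 GT; have [k ki] : exists k, k = (r - i.+1)%N by eexists.
rewrite -ki; elim: k i ki => [|k IH] i ki; have ir := ltn_ord i.
  rewrite expr0 mul1mx; congr submxrow; apply: val_inj => /=; lia.
have ir' : (i.+1 < r)%N by lia.
rewrite -(mul_Theta_succ S G (erefl : Ordinal ir' = i.+1 :> nat)) GT -mul_submxrow.
rewrite (IH (Ordinal ir')); last by rewrite /=; lia.
by rewrite mulmxA exprS.
Qed.

(** Q is the first block row of F and Qc the last one of Fc. The shift part of Theta generates the
    other block rows, and the block S closes the cycle into the relations with the power r. *)
Lemma Theta_factors (F Fc : 'M[K]_(\sum_(i < r) d, l)) : (0 < r)%N ->
  Theta r S *m F = F *m Om -> (Theta r S)^t* *m Fc = Fc *m Om^t* ->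
  exists Q Qc : 'M[K]_(d, l),
  [/\ F = \mxcol_(i < r) (Q *m Om ^+ i),
      Fc = \mxcol_(i < r) (Om ^+ (r - i.+1) *m Qc^t*)^t*,
      S *m Q = Q *m Om ^+ r
    & S^t* *m Qc = Qc *m (Om^t*) ^+ r].
Proof.
move=> r0 TF TFc.
have GT : Fc^t* *m Theta r S = Om *m Fc^t*.
  by have := congr1 (fun M => M^t*) TFc; rewrite !trCM !trmxCK.
have o1 : (r.-1 < r)%N by lia.
pose a := Ordinal r0; pose z := Ordinal o1.
have zr : z.+1 = r by rewrite /= prednK.
have FcE i : submxcol Fc i = (submxrow (Fc^t*) i)^t*.
  rewrite -[in LHS](submxcolK Fc) mxcolK -{2}(submxcolK Fc) trC_mxcol mxrowK.
  by rewrite trmxCK.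
exists (submxcol F a), (submxcol Fc z); split.
- rewrite -[LHS]submxcolK; apply: eq_mxcol => i.
  exact: Theta_right_power.
- rewrite -[LHS]submxcolK; apply: eq_mxcol => i.
  by rewrite !FcE trmxCK (@Theta_left_power _ z i).
- have := congr1 (fun M => submxcol M z) TF; rewrite -!submxcol_mul.
  rewrite (@Theta_last _ _ _ _ z a) // -mulmxA submxcol_mul mul1mx => ->.
  rewrite (@Theta_right_power F a z) // -mulmxA.
  by congr (_ *m _); rewrite -[_ *m Om]exprSr zr.
- have := congr1 (fun M => submxrow M a) GT.
  rewrite (@mul_Theta_first _ _ _ _ _ _ z a) // -mul_submxrow.
  rewrite (@Theta_left_power _ z a) // mulmxA => e.
  rewrite !FcE; have := congr1 (fun M => M^t*) e; rewrite (trCM _ S) => ->.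
  rewrite [(_ *m _ *m _)^t*]trCM; congr (_ *m _); rewrite -trC_exp; congr (_^t*).
  by rewrite -[Om *m _]exprS subn1 prednK.
Qed.

End Factors.

(** * Expansions in the block form of the statement *)

Section FinalForms.
Variable R : realType.
Local Notation K := R[i].

Lemma expr_scalemx l (c : K) (X : 'M[K]_l) k : (c *: X) ^+ k = c ^+ k *: X ^+ k.
Proof.
elim: k => [|k IH]; first by rewrite !expr0 scale1r.
rewrite !exprS IH -[(c *: X) * _]/((c *: X) *m _) -scalemxAl -scalemxAr scalerA.
by [].
Qed.

Lemma scalar_blocks_rows r d (c : nat -> K) :
  scalar_blocks r d c = \mxcol_(i < r) (c i.+1 *: submxcol 1%:M i).
Proof.
rewrite -[LHS]submxcolK; apply: eq_mxcol => i.
rewrite -[LHS]submxrowK -mul_scalar_mx -[submxcol 1%:M i]submxrowK mul_mxrow.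
apply: eq_mxrow => j; rewrite -!submxblockEv submxblock_one mul_scalar_mx mxblockK.
case: (eqVneq i j) => [e|_]; last by rewrite raddf0 scaler0.
by subst j; rewrite conform_mx_id scalemx1.
Qed.

Lemma isO_rows_near g k w b (X Y : R -> 'M[K]_(\sum_(i < k) w, b)) :
  (\forall t \near (0 : R)^'+, X t = Y t) -> isO_rows g X -> isO_rows g Y.
Proof.
by move=> e h i; have [c hc] := h i; exists c; apply: filterS2 e hc => t ->.
Qed.

Variables (m n : nat) (s : nat -> nat) (rho b : nat).
Variables (Vc : forall j i : nat, 'M[K]_(n, s j)) (A : forall j i : nat, 'M[K]_(s j, n)).
Variables (y : R -> 'M[K]_(n, b)) (y0 : 'M[K]_(n, b)).
Variables (G : 'M[K]_(\sum_(i < m.+1 - rho.+1) s (rho.+1 + i)%N, s rho)).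
Hypothesis rho_m : (1 <= rho <= m)%N.
Hypothesis y_lim : bigO (root_t rho) (fun t => y t - y0).
Hypothesis y0_top : EA1 m A rho.+1 *m y0 = G *m (A rho 1%N *m y0).
Local Notation z := (@root_t R rho).

Lemma dual_presentation_error :
  isO id (fun t => scaling m (revfam Vc) A (alpha rho) rho (z t) *m y t
    - (Ecsplit m Vc rho *m col_mx 1%:M G *m (A rho 1%N *m y0)
       + \sum_(1 <= k < m.+1) blockrow Vc k *m revrows (component rho A y y0 k t))).
Proof.
have := presentation_error (revfam Vc) rho_m y_lim y0_top; congr isO.
apply/funext => t; rewrite Esplit_rev; congr (_ - (_ + _)).
by apply: eq_bigr => k _; rewrite blockrow_rev.
Qed.

Lemma dual_component_delta k : k != rho ->
  isO_rows (deltac rho k) (fun t => revrows (component rho A y y0 k t)).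
Proof. by move=> kr; apply/isO_rows_rev/(component_delta A rho_m y_lim kr). Qed.

Lemma dual_component_rho : isO_rows (deltac rho rho) (fun t =>
  revrows (component rho A y y0 rho t)
  - \mxcol_(i < rho) (if i.+1 == rho then 0
       else (z t ^+ (rho - i.+1))%:C *: (A rho (rho - i)%N *m y0))).
Proof.
have := isO_rows_rev (component_rho A rho_m y_lim); congr isO_rows.
apply/funext => t; rewrite /revrows -[RHS]mxcolB; apply: eq_mxcol => i.
rewrite submxcolB [X in _ - X]mxcolK /=; have := ltn_ord i => ir.
have -> : (rho - i.+1 == 0)%N = (i.+1 == rho) by lia.
by rewrite -subSn // subSS.
Qed.

End FinalForms.

Theorem theorem6 (R : realType) (n : nat) (Delta C D : 'M[R[i]]_n)
  (lambda : R[i]) (m : nat) (s : nat -> nat)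
  (V Vc : forall j i : nat, 'M[R[i]]_(n, s j))
  (q : nat) (UC : 'M[R[i]]_(n, q)) (CC DeltaC : 'M[R[i]]_q)
  (rho l : nat)
  (F Fc : 'M[R[i]]_(\sum_(i < rho) s rho, l)) (Omega : 'M[R[i]]_l) :
  Delta^t* = Delta -> Delta \in unitmx ->
  Delta *m C = (Delta *m C)^t* -> Delta *m D = (Delta *m D)^t* ->
  lambda \isn't Num.real ->
  (1 <= m)%N -> (0 < s m)%N ->
  let U := row_mx (row_mx (fullrow m V) (fullrow m Vc)) UC in
  let J : 'M[R[i]]_(\sum_(j < m) \sum_(i < j.+1) s j.+1) :=
    lambda%:M + Njordan R[i] s m in
  invertible_mx U ->
  C *m U = U *m block_mx (block_mx J 0 0 (J^t*)) 0 0 CC ->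
  U^t* *m Delta *m U = block_mx (swap_mx R[i] _) 0 0 DeltaC ->
  lambda \notin spectrum CC -> (lambda^*)%R \notin spectrum CC ->
  (forall k, (1 <= k <= m)%N -> W m V Vc Delta D k \in unitmx) ->
  (1 <= rho <= m)%N ->
  let S := Srho m V Vc Delta D rho in
  let Th := Theta rho S in
  \rank F = l -> \rank Fc = l ->
  Th *m F = F *m Omega -> Th^t* *m Fc = Fc *m Omega^t* ->
  F^t* *m Fc = 1%:M ->
  (spectrum Omega `<=` spectrum Th)%mset ->
  (spectrum Omega `&` (spectrum Th `\` spectrum Omega))%mset = mset0 ->
  let factors (Q Qc : 'M[R[i]]_(s rho, l)) :=
    [/\ F = \mxcol_(i < rho) (Q *m Omega ^+ i),
        Fc = \mxcol_(i < rho) (Omega ^+ (rho - i.+1) *m Qc^t*)^t*,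
        S *m Q = Q *m Omega ^+ rho
      & S^t* *m Qc = Qc *m (Omega^t*) ^+ rho] in
  (exists Q Qc, factors Q Qc) /\
  forall Q Qc, factors Q Qc ->
  exists (tV tVc : R -> 'M[R[i]]_(n, \sum_(j < rho) s rho))
         (tTheta : R -> 'M[R[i]]_(\sum_(j < rho) s rho)),
  perturbed_structured_basis m V Vc Delta C D lambda tV tVc tTheta /\
  exists (tF tFc : R -> 'M[R[i]]_(\sum_(i < rho) s rho, l))
         (tOmega : R -> 'M[R[i]]_l),
  let L := fun t => tV t *m tF t in
  let Lc := fun t => tVc t *m tFc t in
  [/\ [/\ isO (fun t => t `^ (1 / rho%:R)) (fun t => tF t - F),
          isO (fun t => t `^ (1 / rho%:R)) (fun t => tFc t - Fc)
        & isO (fun t => t `^ (1 / rho%:R)) (fun t => tOmega t - Omega)],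
      \forall t \near (0 : R)^'+,
        [/\ tTheta t *m tF t = tF t *m tOmega t,
            (tTheta t)^t* *m tFc t = tFc t *m (tOmega t)^t*,
            (tF t)^t* *m tFc t = 1%:M
          & structured_pair Delta C D lambda rho t (L t) (Lc t) (tOmega t)],
      exists X : forall k : nat, R -> 'M[R[i]]_(\sum_(i < k) s k, l),
        [/\ isO id (fun t => L t
              - (Esplit m V rho *m col_mx 1%:M (G m V Vc Delta D rho) *m Q
                 + \sum_(1 <= k < m.+1) blockrow V k *m X k t)),
            forall k, (1 <= k <= m)%N -> k != rho ->
              isO_rows (delta rho k) (X k)
          & isO_rows (delta rho rho) (fun t => X rho t
              - \mxcol_(i < rho)
                  (if i == 0%N :> nat then 0
                   else Q *m (rho_root rho t *: Omega) ^+ i))]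
    & exists Xc : forall k : nat, R -> 'M[R[i]]_(\sum_(i < k) s k, l),
        [/\ isO id (fun t => Lc t
              - (Ecsplit m Vc rho *m col_mx 1%:M (Gc m V Vc Delta D rho) *m Qc
                 + \sum_(1 <= k < m.+1) blockrow Vc k *m Xc k t)),
            forall k, (1 <= k <= m)%N -> k != rho ->
              isO_rows (deltac rho k) (Xc k)
          & isO_rows (deltac rho rho) (fun t => Xc rho t
              - \mxcol_(i < rho)
                  (if i.+1 == rho then 0
                   else (rho_root rho t *: Omega) ^+ (rho - i.+1) *m Qc^t*)^t*)]].
Proof.
move=> hD Du DC DD lnr m1 sm U J Uinv CU gram lCC lcCC Wu rho_m S Th rF rFc.
move=> ThF ThFc FFc sub dis factors.
have rho0 : (0 < rho)%N by case/andP: rho_m.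
have lconj : lambda^*%R != lambda by apply: contra lnr; rewrite CrealE.
have [RV RVc RG] := jordan_relations CU gram.
have CVr := fullrow_Njordan RV.
have CVcr := fullrow_NjordanC RVc.
have CV1 k : (1 <= k <= m)%N -> C *m V k 1%N = lambda *: V k 1%N.
  by move=> kr; rewrite CVr ?addr0 //; lia.
have CVS k i : ((1 <= i <= k) && (k <= m))%N -> ((1 <= i.+1 <= k) && (k <= m))%N ->
    C *m V k i.+1 = lambda *: V k i.+1 + V k i.
  by move=> r r'; rewrite CVr // ltnS; have -> : (0 < i)%N by lia.
have gV k i i' : ((1 <= i <= k) && (k <= m))%N -> ((1 <= i' <= k) && (k <= m))%N ->
    (Vc k i)^t* *m Delta *m V k i' = (i == i')%:R%:M.
  move=> /index_split[j [i1 [-> ->]]].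
  case: i' => [|i'] r; first by lia.
  have i'j : (i' < j.+1)%N by lia.
  rewrite (gram_block Vc V Delta i1 (Ordinal i'j)) RG submxblock_diag1.
  by rewrite submxblock_one eqSS -(inj_eq val_inj).
have gV0 k k' i i' : ((1 <= i <= k) && (k <= m))%N -> ((1 <= i' <= k') && (k' <= m))%N ->
    k != k' -> (Vc k i)^t* *m Delta *m V k' i' = 0.
  move=> /index_split[j [i1 [-> ->]]] /index_split[j' [i1' [-> ->]]].
  rewrite eqSS (inj_eq val_inj) => jj.
  by rewrite gram_block RG submxblock_off1 // submxblock0.
have ker (mu : R[i]) b (y : 'M[R[i]]_(n, b)) : mu = lambda \/ mu = lambda^*%R ->
    C *m y = mu *: y ->
    (forall k i, ((1 <= i <= k) && (k <= m))%N -> (Vc k i)^t* *m Delta *m y = 0) ->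
    (forall k i, ((1 <= i <= k) && (k <= m))%N -> (V k i)^t* *m Delta *m y = 0) -> y = 0.
  by case=> ->; [apply: (jordan_kernel Uinv CU gram lCC)
                |apply: (jordan_kernel Uinv CU gram lcCC)].
have [x0 [y0 [x [y [tTh [[hx hy hTh] [rx0 ry0 Gx0 Gy0] hxr pairs]]]]]] :=
  structured_family rho_m hD DC DD lconj gV gV0 CV1 CVS CVcr ker Wu.
pose z := @root_t R rho.
have z_gt0 : \forall t \near (0 : R)^'+, 0 < z t := @root_t_gt0 R rho.
have z_small := @root_t_small R rho rho0.
have [tF [tFc [tOm [hF hFc hOm hFF]]]] := simple_pair_family z_gt0 z_small ThF ThFc FFc dis hTh.
split; first exact: Theta_factors.
move=> Q Qc [FE FcE SQ SQc].
pose A k i := (Vc k i)^t* *m Delta.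
pose Ad k i := (V k (k.+1 - i)%N)^t* *m Delta.
pose a := Ordinal rho0.
have rx1 : A rho 1%N *m x0 = submxcol 1%:M a by exact: (rx0 a).
have lr : (rho.-1 < rho)%N by lia.
have revE (i : 'I_rho) : (rho - i = (rev_ord i).+1)%N by have := ltn_ord i; rewrite /=; lia.
have ryr (i : 'I_rho) : Ad rho (rho - i)%N *m y0 = submxcol 1%:M i.
  by rewrite revE ry0 rev_ordK.
have ry1 : Ad rho 1%N *m y0 = submxcol 1%:M (Ordinal lr).
  by rewrite -(ryr (Ordinal lr)) /=; congr (Ad rho _ *m _); lia.
have ra_last c (M : 'M[R[i]]_(c, s rho)) :
    row_at rho rho M = M *m submxcol 1%:M (Ordinal lr).
  by rewrite -(row_at_one (Ordinal lr)) /= prednK.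
(* The leading coordinate of x0 is the first block row of the identity, so F contributes its first
   block Q; dually, Fc contributes its last block Qc. *)
have rF1 : A rho 1%N *m (x0 *m F) = Q.
  by rewrite mulmxA rx1 submxcol_mul mul1mx FE mxcolK expr0 mulmx1.
have rFc1 : Ad rho 1%N *m (y0 *m Fc) = Qc.
  rewrite mulmxA ry1 submxcol_mul mul1mx FcE mxcolK /=.
  by rewrite prednK // subnn expr0 mul1mx trmxCK.
have hxF : bigO z (fun t => x t *m tF t - x0 *m F) by exact: bigOz_mulB.
have hyF : bigO z (fun t => y t *m tFc t - y0 *m Fc) by exact: bigOz_mulB.
have GxF : EA1 m A rho.+1 *m (x0 *m F) = G m V Vc Delta D rho *m (A rho 1%N *m (x0 *m F)).
  by rewrite mulmxA Gx0 !mulmxA.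
have GyF : EA1 m Ad rho.+1 *m (y0 *m Fc) = Gc m V Vc Delta D rho *m (Ad rho 1%N *m (y0 *m Fc)).
  by rewrite mulmxA Gy0 !mulmxA.
pose tV t := scaling m V A (alpha rho) rho (z t) *m x t.
pose tVc t := scaling m (revfam Vc) Ad (alpha rho) rho (z t) *m y t.
exists tV, tVc, tTh; split.
  split; first exact: bigO_isO.
  - exists (fun k t => component rho A x x0 k t); split.
    + rewrite (row_at_one a) -rx1 (mulmxA (Esplit m V rho)).
      exact: (presentation_error V rho_m hx Gx0).
    + by move=> k _; apply: (component_delta A rho_m hx).
    (* The coordinates of x t along V_rho are exactly the identity for small t, so this coefficient
       has no error term. *)
    + move: hxr (near_gt0 R); apply: filterS2 => t xr t0.
      rewrite scalar_blocks_rows; apply: eq_mxcol => i; rewrite leqnn andbT.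
      have -> : alpha rho rho i.+1 = i by have := ltn_ord i; rewrite /alpha; lia.
      rewrite [A _ _ *m x t]xr eqSS; case: eqP => [i0|_]; last by rewrite subr0 root_t_exp.
      have -> : i = a by apply: val_inj.
      by rewrite rx1 expr0 scale1r scale0r subrr.
  - exists (fun k t => revrows (component rho Ad y y0 k t)); split.
    + rewrite ra_last -ry1 (mulmxA (Ecsplit m Vc rho)).
      exact: (dual_presentation_error Vc rho_m hy Gy0).
    + by move=> k _; apply: (dual_component_delta Ad rho_m hy).
    + apply: isO_rows_near (dual_component_rho Ad rho_m hy).
      apply: filterS (near_gt0 R) => t t0; congr (_ - _); rewrite scalar_blocks_rows.
      apply: eq_mxcol => i; case: eqP => _; first by rewrite scale0r.
      by rewrite ryr root_t_exp.
  - exact: pairs.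
exists tF, tFc, tOm; split.
- by split; apply: bigO_isO.
- apply: filterS2 pairs hFF => t pt [e1 e2 e3]; split=> //.
  exact: (structured_pair_mul hD pt e1 e2 e3).
- exists (fun k t => component rho A (fun t => x t *m tF t) (x0 *m F) k t); split.
  + have := presentation_error V rho_m hxF GxF; rewrite rF1; congr isO.
    by apply/funext => t; rewrite /tV mulmxA.
  + by move=> k _; apply: (component_delta A rho_m hxF).
  + have := component_rho A rho_m hxF; congr isO_rows.
    apply/funext => t; congr (_ - _); apply: eq_mxcol => i; case: eqP => // _.
    rewrite (mulmxA (A _ _)) rx0 submxcol_mul mul1mx FE mxcolK.
    by rewrite expr_scalemx -rmorphXn scalemxAr.
- exists (fun k t => revrows (component rho Ad (fun t => y t *m tFc t) (y0 *m Fc) k t)); split.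
  + have := dual_presentation_error Vc rho_m hyF GyF; rewrite rFc1; congr isO.
    by apply/funext => t; rewrite /tVc mulmxA.
  + by move=> k _; apply: (dual_component_delta Ad rho_m hyF).
  + have := dual_component_rho Ad rho_m hyF; congr isO_rows.
    apply/funext => t; congr (_ - _); apply: eq_mxcol => i; case: eqP => _; first by rewrite trC0.
    rewrite (mulmxA (Ad _ _)) ryr submxcol_mul mul1mx {1}FcE mxcolK.
    by rewrite expr_scalemx -rmorphXn -scalemxAl trCZ conj_realC.
Qed.
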